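(* Let $u\in C^4(\Omega)\cap C^{0,1}(\bar\Omega)$ be an elliptic solution of a generated Jacobian equation $\det[D^2u-A(\cdot,u,Du)]=B(\cdot,u,Du)$ in the domain $\Omega$, with generating function $g$ and with $J_1[u](\Omega)\subset\mathcal U_0\subset\subset\mathcal U$. Then, for any strictly contained subdomain $\Omega'\subset\subset\Omega$, we have the estimate $$\sup_{\Omega'}|D^2u|\le C,$$ where $C$ depends on $n,\mathcal U,\mathcal U_0,g,B$, $R_0=\operatorname{dist}(\Omega',\partial\Omega)$ and $\omega[u](\Omega',\Omega)$, the quantity $$\omega[u](\Omega',\Omega)=\inf_{x_0\in\Omega',\,R<R_0}\omega[u](x_0,R)$$ denoting a lower bound on the modulus of strict $g$-convexity $\omega[u](x_0,R)$ of $u$ over $\Omega'$.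
   Context: $\Omega\subset\mathbb R^n$ is a bounded domain. The one-jet of $u$ is $J_1[u](\Omega)=\{(x,u(x),Du(x)):x\in\Omega\}$. $\mathcal U_0\subset\subset\mathcal U$ means $\overline{\mathcal U_0}$ is a compact subset of $\mathcal U$. $u$ is elliptic if $D^2u-A(\cdot,u,Du)>0$ in $\Omega$. Generated Jacobian equation: $\Gamma\subset\mathbb R^n\times\mathbb R^n\times\mathbb R$ is a domain, with points $(x,y,z)$, such that the sets $I(x,y)=\{z\in\mathbb R:(x,y,z)\in\Gamma\}$ are open intervals; $g\in C^2(\Gamma)$ is the generating function, with $g_z<0$ in $\Gamma$; $\mathcal U=\{(x,g(x,y,z),g_x(x,y,z)):(x,y,z)\in\Gamma\}$; there exist unique $C^1$ mappings $Y:\mathcal U\to\mathbb R^n$, $Z:\mathcal U\to\mathbb R$ with $g(x,Y,Z)=u$, $g_x(x,Y,Z)=p$ at each $(x,u,p)\in\mathcal U$; and $A(\cdot,u,p)=g_{xx}(\cdot,Y(\cdot,u,p),Z(\cdot,u,p))$. Standing assumptions: $\mathcal U$ is convex in $p$ for fixed $(x,u)$; $A$ and the scalar function $B$ are $C^2$ on $\mathcal U$, $B>0$; and $A$ is regular: $(D_{p_kp_l}A_{ij})\xi_i\xi_j\eta_k\eta_l\ge0$ in $\mathcal U$ whenever $\xi,\eta\in\mathbb R^n$, $\xi\cdot\eta=0$ (repeated indices summed). Modulus of strict $g$-convexity: for $x_0\in\Omega$ put $y_0=Y(x_0,u(x_0),Du(x_0))$, $z_0=Z(x_0,u(x_0),Du(x_0))$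 and $g_0=g(\cdot,y_0,z_0)$. For $h>0$ define the section $$S_h(u,g_0)=\{x\in\Omega:\ (x,y_0,z_0-h)\in\Gamma,\ u(x)<g(x,y_0,z_0-h)\},$$ and let $S_h(u,g_0,x_0)$ be the connected component of $S_h(u,g_0)$ containing $x_0$ (for $h$ with $(x_0,y_0,z_0-h)\in\Gamma$, so that $x_0\in S_h(u,g_0)$). For $0<R<\operatorname{dist}(x_0,\partial\Omega)$, $$\omega[u](x_0,R)=\sup\{h:\ S_h(u,g_0,x_0)\subset B_R(x_0)\},$$ where $B_R(x_0)$ is the open ball of radius $R$ and centre $x_0$.
   Formalization: The infimum over R<R_0 is always 0, so C depends instead on a positive function m(R) bounding inf over x_0 of ω[u](x_0,R) from below; and ω takes the sup over h such that all S_t with 0<t≤h lie in B_R, since sections cut off by the boundary of Γ break the estimate. *)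

(* Defs.v *)
From HB Require Import structures.
From mathcomp Require Import all_boot all_order all_algebra.
From mathcomp Require Import all_classical all_reals all_analysis.

Set Implicit Arguments.
Unset Strict Implicit.
Unset Printing Implicit Defensive.

Import Order.TTheory GRing.Theory Num.Theory.
Import numFieldNormedType.Exports.

Local Open Scope classical_set_scope.
Local Open Scope ring_scope.

(* [class_C k D f]: f is of class C^k on D, for D open.  A function is C^(k+1)
   iff it is Frechet differentiable and all its directional derivatives are
   C^k; in finite dimension this is the usual notion. *)
Fixpoint class_C (R : realType) (V W : normedModType R) (k : nat)
    (D : set V) (f : V -> W) : Prop :=
  if k is k'.+1 then
    (forall x, D x -> differentiable f x) /\
    (forall v, class_C k' D ('D_v f))
  else forall x, D x -> {for x, continuous f}.

Definition domain (T : topologicalType) (D : set T) : Prop :=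
  [/\ open D, connected D & D !=set0].

Definition compactly_contained (T : topologicalType) (A B : set T) : Prop :=
  compact (closure A) /\ closure A `<=` B.

Definition boundary (T : topologicalType) (A : set T) : set T :=
  closure A `\` interior A.

Section Euclidean.
Context {R : realType} {n : nat}.
Local Notation V := 'rV[R]_n.

(* The library norm on matrices is the sup norm; the one below is the Euclidean
   (Frobenius) norm, used for row vectors and for Hessians. *)
Definition enorm {m p : nat} (M : 'M[R]_(m, p)) : R :=
  Num.sqrt (\sum_i \sum_j M i j ^+ 2).

Definition eball (x : V) (r : R) : set V := [set y | enorm (y - x) < r].

(* An infimum of reals: it is only used for sets that are both nonempty. *)
Definition edistance (A B : set V) : R :=
  inf [set enorm (x - y) | x in A & y in B].

Definition grad (f : V -> R) (x : V) : V := \row_i 'D_(delta_mx 0 i) f x.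

Definition hess (f : V -> R) (x : V) : 'M[R]_n :=
  \matrix_(i, j) 'D_(delta_mx 0 i) ('D_(delta_mx 0 j) f) x.

Definition posdef (M : 'M[R]_n) : Prop :=
  forall xi : V, xi != 0 -> 0 < \sum_i \sum_j M i j * xi 0 i * xi 0 j.

Definition jet (u : V -> R) (x : V) : V * R * V := (x, u x, grad u x).

End Euclidean.

Section GeneratedJacobian.
Context {R : realType} {n : nat}.
Local Notation V := 'rV[R]_n.

(* Points (x, y, z) of Gam and points (x, u, p) of the jet set U. *)
Implicit Types (Gam : set (V * V * R)) (g : V * V * R -> R).
Implicit Types (Y : V * R * V -> V) (Z : V * R * V -> R).

Definition gx g (q : V * V * R) : V := grad (fun x => g (x, q.1.2, q.2)) q.1.1.
Definition gxx g (q : V * V * R) : 'M[R]_n :=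
  hess (fun x => g (x, q.1.2, q.2)) q.1.1.
Definition gz g (q : V * V * R) : R :=
  derive1 (fun z : R => g (q.1.1, q.1.2, z)) q.2.

Definition generating_function Gam g : Prop :=
  [/\ domain Gam,
      forall x y, open [set z | Gam (x, y, z)] /\
                  is_interval [set z | Gam (x, y, z)],
      class_C 2 Gam g
    & forall q, Gam q -> gz g q < 0].

Definition jetset Gam g : set (V * R * V) :=
  [set (q.1.1, g q, gx g q) | q in Gam].

(* Y and Z are total functions, but only their values on the jet set matter.
   Uniqueness is pointwise: (Y, Z) is the only point (y, z) over x with
   (x, y, z) in Gam that solves the two equations.  Differentiating this
   left-inverse identity shows that (x, y, z) |-> (x, g, g_x) has an invertible
   differential, so the jet set is open and [class_C] applies to it. *)
Definition dual_maps Gam g Y Z : Prop :=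
  [/\ forall x u p, jetset Gam g (x, u, p) -> forall y z,
        (Gam (x, y, z) /\ g (x, y, z) = u /\ gx g (x, y, z) = p) <->
        (y = Y (x, u, p) /\ z = Z (x, u, p)),
      class_C 1 (jetset Gam g) Y
    & class_C 1 (jetset Gam g) Z].

Definition matA g Y Z (q : V * R * V) : 'M[R]_n := gxx g (q.1.1, Y q, Z q).

Definition regular (U : set (V * R * V)) (A : V * R * V -> 'M[R]_n) : Prop :=
  forall x u p (xi eta : V), U (x, u, p) ->
    \sum_i xi 0 i * eta 0 i = 0 ->
    0 <= \sum_i \sum_j \sum_k \sum_l
      'D_(delta_mx 0 k) ('D_(delta_mx 0 l) (fun p' : V => A (x, u, p') i j)) p
        * xi 0 i * xi 0 j * eta 0 k * eta 0 l.

Definition elliptic g Y Z (Om : set V) (u : V -> R) : Prop :=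
  forall x, Om x -> posdef (hess u x - matA g Y Z (jet u x)).

Definition gje_solution g Y Z (B : V * R * V -> R) (Om : set V) (u : V -> R)
    : Prop :=
  forall x, Om x ->
    \det (hess u x - matA g Y Z (jet u x)) = B (jet u x).

(* The section S_h(u, g(., y0, z0)). *)
Definition gsection Gam g (Om : set V) (u : V -> R) (y0 : V) (z0 h : R) : set V :=
  [set x | [/\ Om x, Gam (x, y0, z0 - h) & u x < g (x, y0, z0 - h)]].

(* The modulus omega[u](x0, r) = sup {h : S_h(u, g_0, x0) is in B_r(x0)}.
   Sections are meant to increase with the height, so that the admissible
   heights form an interval (0, h).  They can fail to increase where
   (x, y0, z0 - t) leaves Gam: a large section may then be cut short by the
   boundary of Gam and lie in the ball while lower sections do not.  The
   admissible heights are therefore those below which all sections lie in the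
   ball; the supremum may be +oo. *)
Definition modulus Gam g Y Z (Om : set V) (u : V -> R) (x0 : V) (r : R) : \bar R :=
  let y0 := Y (jet u x0) in
  let z0 := Z (jet u x0) in
  ereal_sup [set h%:E | h in [set h : R | 0 < h /\
    forall t, 0 < t -> t <= h ->
      Gam (x0, y0, z0 - t) /\
      connected_component (gsection Gam g Om u y0 z0 t) x0 `<=` eball x0 r]].

(* The modulus over a subdomain is kept as a function of the radius r: it tends
   to 0 as r -> 0, so a further infimum over r would always be 0. *)
Definition modulus_over Gam g Y Z (Om : set V) (u : V -> R) (Om' : set V) (r : R)
    : \bar R :=
  ereal_inf [set modulus Gam g Y Z Om u x0 r | x0 in Om'].

End GeneratedJacobian.

(* Main.v *)
Require Import Defs.
From HB Require Import structures.
From mathcomp Require Import all_boot all_order all_algebra.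
From mathcomp Require Import all_classical all_reals all_analysis.
From mathcomp Require Import perm ring lra.

Set Implicit Arguments.
Unset Strict Implicit.
Unset Printing Implicit Defensive.

Import Order.TTheory GRing.Theory Num.Theory.
Import numFieldNormedType.Exports.

Local Open Scope classical_set_scope.
Local Open Scope ring_scope.

(* Pogorelov's argument in a small section.  For x0 in Omega' and h small, put
   eta = g(., y0, z0 - h) - u; it is positive in the component of the section at
   x0, which lies in a small ball, and vanishes on its boundary.  Maximise, over
   the closed component and unit vectors xi,
     eta^tau * w_xixi * exp (beta/2 |Du|^2 + kappa/2 |x - x0|^2),
   where w = D^2u - A(., u, Du).  At an interior maximum xi is the eigenvector of
   w for its largest eigenvalue L; the first and second order conditions there,
   combined with the equation log det w = log B differentiated twice along xi and
   with the regularity of A (used once for the fourth derivatives and once to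
   bound the linearised operator on eta from below), give eta^2 L <= C once
   beta, tau, kappa and then the radius are chosen in this order.  The value at
   x0, where eta >= c h, is bounded by the maximum. *)

(** * Second order jets *)

(* All second derivatives are taken along lines t |-> x + t e, where they obey
   one-variable calculus; no second Frechet differential is needed. *)
Section SecondOrderJets.
Context {R : realType}.

(** The obstacle is the third derivatives of u, for which no bound is available. At the maximum they
    occur in two ways. Linearly, through the first order coefficients G of the linearised equation:
    contracting the first order condition with G cancels them all and leaves only kappa G . (x -
    x0). Quadratically, as squares of D_a w_oo / L: the concavity of log det supplies the squares of
    D_o w_ab / L, and D_a w_oo and D_o w_oa differ only by derivatives of A. The good terms that
    remain are beta L, from |Du|^2, and kappa tr w^-1, from |x - x0|^2. So beta beats constants of
    the data, tau makes the squares of D eta / eta absorbable, kappa beats multiples of tau, and a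
    small radius pays for what kappa costs. Regularity holds only in directions orthogonal to the
    one in which A is evaluated, so each use loses one component along it: in the fourth derivatives
    this is u_oa, bounded for a <> o because w is diagonal; for eta it is D_a eta, absorbed like the
    other squares. The worst terms left are tau / eta and tau / (eta^2 L), whence the bound on eta^2
    L. *)

Definition jet2 (f : R -> R) (f0 f1 f2 : R) : Prop :=
  exists f' : R -> R,
    [/\ f 0 = f0, \forall t \near (0 : R), is_derive (t : R) 1 f (f' t),
        f' 0 = f1 & is_derive (0 : R) 1 f' f2].

Lemma jet2_cst (c : R) : jet2 (fun=> c) c 0 0.
Proof.
exists (fun=> 0); split => //; last exact: is_derive_cst.
by near=> t; exact: is_derive_cst.
Unshelve. all: by end_near. Qed.

Lemma jet2_id : jet2 id 0 1 0.
Proof.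
exists (fun=> 1); split => //; last exact: is_derive_cst.
by near=> t; exact: is_derive_id.
Unshelve. all: by end_near. Qed.

Lemma jet2D f f0 f1 f2 g g0 g1 g2 : jet2 f f0 f1 f2 -> jet2 g g0 g1 g2 ->
  jet2 (fun t => f t + g t) (f0 + g0) (f1 + g1) (f2 + g2).
Proof.
move=> [f' [<- df <- ddf]] [g' [<- dg <- ddg]].
exists (fun t => f' t + g' t); split => //; last exact: is_deriveD.
by near=> t; apply: is_deriveD; near: t.
Unshelve. all: by end_near. Qed.

Lemma jet2M f f0 f1 f2 g g0 g1 g2 : jet2 f f0 f1 f2 -> jet2 g g0 g1 g2 ->
  jet2 (fun t => f t * g t) (f0 * g0) (f1 * g0 + f0 * g1)
    (f2 * g0 + 2 * f1 * g1 + f0 * g2).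
Proof.
move=> [f' [<- df <- ddf]] [g' [<- dg <- ddg]].
exists (fun t => f' t * g t + f t * g' t); split => //.
- near=> t.
  have df0 : is_derive (t : R) 1 f (f' t) by near: t.
  have dg0 : is_derive (t : R) 1 g (g' t) by near: t.
  apply: is_derive_eq (is_deriveM df0 dg0) _.
  by rewrite /GRing.scale/=; ring.
- have df0 : is_derive (0 : R) 1 f (f' 0) by exact: nbhs_singleton df.
  have dg0 : is_derive (0 : R) 1 g (g' 0) by exact: nbhs_singleton dg.
  apply: is_derive_eq (is_deriveD (is_deriveM ddf dg0) (is_deriveM df0 ddg)) _.
  by rewrite /GRing.scale/=; ring.
Unshelve. all: by end_near. Qed.

Lemma jet2_val f f0 f1 f2 g0 g1 g2 : jet2 f f0 f1 f2 ->
  f0 = g0 -> f1 = g1 -> f2 = g2 -> jet2 f g0 g1 g2.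
Proof. by move=> + <- <- <-. Qed.

Lemma jet2Z c f f0 f1 f2 : jet2 f f0 f1 f2 ->
  jet2 (fun t => c * f t) (c * f0) (c * f1) (c * f2).
Proof.
by move=> /(jet2M (jet2_cst c))/jet2_val; apply; ring.
Qed.

Lemma jet2Zr c f f0 f1 f2 : jet2 f f0 f1 f2 ->
  jet2 (fun t => f t * c) (f0 * c) (f1 * c) (f2 * c).
Proof.
by move=> /jet2M/(_ (jet2_cst c))/jet2_val; apply; ring.
Qed.

Lemma jet2N f f0 f1 f2 : jet2 f f0 f1 f2 ->
  jet2 (fun t => - f t) (- f0) (- f1) (- f2).
Proof.
move=> /(jet2Z (-1)); rewrite !mulN1r.
by under eq_fun do rewrite mulN1r.
Qed.

Lemma jet2B f f0 f1 f2 g g0 g1 g2 : jet2 f f0 f1 f2 -> jet2 g g0 g1 g2 ->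
  jet2 (fun t => f t - g t) (f0 - g0) (f1 - g1) (f2 - g2).
Proof. by move=> jf /jet2N; exact: jet2D. Qed.

Lemma jet2_sum (I : Type) (s : seq I) (f : I -> R -> R) f0 f1 f2 :
  (forall i, jet2 (f i) (f0 i) (f1 i) (f2 i)) ->
  jet2 (fun t => \sum_(i <- s) f i t) (\sum_(i <- s) f0 i)
    (\sum_(i <- s) f1 i) (\sum_(i <- s) f2 i).
Proof.
move=> jf; elim: s => [|i s IH].
  by under eq_fun do rewrite big_nil; rewrite !big_nil; exact: jet2_cst.
under eq_fun do rewrite big_cons.
by rewrite !big_cons; exact: jet2D.
Qed.

Lemma jet2_ln f f0 f1 f2 : 0 < f0 -> jet2 f f0 f1 f2 ->
  jet2 (fun t => ln (f t)) (ln f0) (f1 / f0) (f2 / f0 - (f1 / f0) ^+ 2).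
Proof.
move=> f0p [f' [f0E df f1E ddf]]; rewrite -f0E in f0p *; rewrite -f1E.
have df0 : is_derive (0 : R) 1 f (f' 0) by exact: nbhs_singleton df.
have cf : {for 0, continuous f}.
  by apply/differentiable_continuous/derivable1_diffP; case: df0.
exists (fun t => (f t)^-1 * f' t); split => //.
- near=> t.
  apply: is_derive1_comp; last by near: t.
  apply: is_derive1_ln; near: t.
  exact: (cvgr_gt (f 0) cf).
- by rewrite mulrC.
- have := is_deriveM (is_deriveV (lt0r_neq0 f0p) df0) ddf.
  move=> h; apply: is_derive_eq h _; rewrite /GRing.scale/=; field.
  exact: lt0r_neq0.
Unshelve. all: by end_near. Qed.

Lemma jet2_ext f g f0 f1 f2 : (\forall t \near (0 : R), f t = g t) ->
  jet2 f f0 f1 f2 -> jet2 g f0 f1 f2.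
Proof.
move=> fg [f' [f0E df f1E ddf]]; exists f'; split => //.
  by rewrite -f0E; apply/esym; exact: nbhs_singleton fg.
have fg' := near_join fg.
near=> t.
apply: (near_eq_is_derive (f := f)); last by near: t.
by near: t.
Unshelve. all: by end_near. Qed.

Lemma jet2_der f f0 f1 f2 : jet2 f f0 f1 f2 -> is_derive (0 : R) 1 f f1.
Proof. by move=> [f' [_ /nbhs_singleton + <- _]]. Qed.

Lemma jet2_unique f f0 f1 f2 g0 g1 g2 : jet2 f f0 f1 f2 -> jet2 f g0 g1 g2 ->
  [/\ f0 = g0, f1 = g1 & f2 = g2].
Proof.
move=> [f' [<- df <- ddf]] [g' [<- dg <- ddg]]; split => //.
  have /nbhs_singleton d1 := df; have /nbhs_singleton d2 := dg.
  by rewrite -(@derive_val _ _ _ _ _ _ _ d1) (@derive_val _ _ _ _ _ _ _ d2).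
have : is_derive (0 : R) 1 f' g2.
  apply: near_eq_is_derive ddg; near=> t.
  have d1 : is_derive (t : R) 1 f (f' t) by near: t.
  have d2 : is_derive (t : R) 1 f (g' t) by near: t.
  by rewrite -(@derive_val _ _ _ _ _ _ _ d1) (@derive_val _ _ _ _ _ _ _ d2).
by move=> d2; rewrite -(@derive_val _ _ _ _ _ _ _ ddf) (@derive_val _ _ _ _ _ _ _ d2).
Unshelve. all: by end_near. Qed.

(** If f2 were positive, f' would be positive just to the right of 0, where it vanishes, and the
    mean value theorem would give a larger value of f there. *)
Lemma jet2_max f f0 f1 f2 : jet2 f f0 f1 f2 ->
  (\forall t \near (0 : R), f t <= f 0) -> f1 = 0 /\ f2 <= 0.
Proof.
move=> [f' [_ df <- ddf]] mx.
have [e /= e0 He] : exists2 e : R, 0 < e & forall t, `|t| < e ->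
    is_derive (t : R) 1 f (f' t) /\ f t <= f 0.
  have /nbhs_ballP[e /= e0 He] : \forall t \near (0 : R),
      is_derive (t : R) 1 f (f' t) /\ f t <= f 0.
    by near=> t; split; near: t.
  by exists e => // t te; apply: He; rewrite /ball/= sub0r normrN.
have He1 t : `|t| < e -> is_derive (t : R) 1 f (f' t) by move=> /He[].
have He2 t : `|t| < e -> f t <= f 0 by move=> /He[].
have f'0 : f' 0 = 0.
  have : is_derive (0 : R) 1 f 0.
    apply: (@derive1_at_max _ f (- e) e).
    - by rewrite ge0_cp// ltW.
    - move=> t; rewrite in_itv/= => /andP[t1 t2].
      have := He1 t; rewrite ltr_norml t1 t2 => /(_ isT) [].
      by [].
    - by rewrite in_itv/= oppr_lt0 e0.
    - by move=> t; rewrite in_itv/= => te; apply: He2; rewrite ltr_norml.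
  have := He1 0; rewrite normr0 => /(_ e0) d1 d2.
  by rewrite -(@derive_val _ _ _ _ _ _ _ d1) (@derive_val _ _ _ _ _ _ _ d2).
split => //; rewrite leNgt; apply/negP => f2p.
have : (fun h : R => h^-1 *: (f' (h *: 1 + 0) - f' 0)) @ 0^' --> f2.
  by rewrite -(@derive_val _ _ _ _ _ _ _ ddf); by case: ddf.
move=> /cvgr_gt/(_ _ f2p) /nbhs_ballP[d /= d0 Hd].
pose t := Num.min d e / 2.
have m0 : 0 < Num.min d e by rewrite lt_min d0 e0.
have t0 : 0 < t by rewrite divr_gt0.
have tm : t < Num.min d e by rewrite ltr_pdivrMr// ltr_pMr// ltr1n.
have [td te] : t < d /\ t < e by apply/andP; rewrite -lt_min.
have [||c] := @MVT _ f f' 0 t t0.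
- move=> x; rewrite in_itv/= => /andP[x0 xt]; apply: He1.
  by rewrite gtr0_norm// (lt_trans xt).
- apply: continuous_in_subspaceT => x; rewrite inE/= in_itv/= => /andP[x0 xt].
  apply/differentiable_continuous/derivable1_diffP.
  by have [|//] := He1 x; rewrite ger0_norm// (le_lt_trans xt).
rewrite in_itv/= => /andP[c0 ct] ftE.
have := He2 t; rewrite gtr0_norm// => /(_ te); rewrite -subr_le0 ftE subr0.
apply/negP; rewrite -ltNge mulr_gt0//.
have := Hd c; rewrite /ball/= sub0r normrN gtr0_norm// => /(_ (lt_trans ct td)).
rewrite gt_eqF// => /(_ isT).
by rewrite f'0 subr0 addr0 /GRing.scale/= mulr1 pmulr_rgt0// invr_gt0.
Unshelve. all: by end_near. Qed.

End SecondOrderJets.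

(** * Chain rules along lines and curves *)

Section Lines.
Context {R : realType}.

Lemma is_derive_line (V W : normedModType R) (f : V -> W) (x e : V) (t : R) (d : W) :
  is_derive (x + t *: e) e f d ->
  is_derive t (1 : R) (fun s : R => f (x + s *: e)) d.
Proof.
move=> [dv dE].
have E : (fun h : R => h^-1 *: (((fun s : R => f (x + s *: e)) \o shift t) (h *: (1:R)) -
    f (x + t *: e))) = (fun h => h^-1 *: ((f \o shift (x + t *: e)) (h *: e) - f (x + t *: e))).
  apply/funext => h /=; do 3 f_equal.
  by rewrite scalerDl addrCA /GRing.scale/= mulr1.
by split; [rewrite /derivable E|rewrite /derive E].
Qed.

Lemma jet2_line (V : normedModType R) (f : V -> R) (x e : V) :
  (\forall y \near x, differentiable f y) -> differentiable ('D_e f) x ->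
  jet2 (fun t => f (x + t *: e)) (f x) ('D_e f x) ('D_e ('D_e f) x).
Proof.
move=> df ddf; exists (fun t => 'D_e f (x + t *: e)); split => /=.
- by rewrite scale0r addr0.
- have c0 : (fun t : R => x + t *: e) @ (0 : R) --> x + 0 *: e.
    by apply: cvgD; [exact: cvg_cst|apply: cvgZr_tmp; exact: cvg_id].
  rewrite scale0r addr0 in c0.
  near=> t; have dt : differentiable f (x + t *: e) by near: t; exact: (c0 _ df).
  exact/is_derive_line/derivableP/diff_derivable.
- by rewrite scale0r addr0.
- apply: (@is_derive_line V _ ('D_e f) x e 0); rewrite scale0r addr0.
  exact/derivableP/diff_derivable.
Unshelve. all: by end_near. Qed.

Lemma is_derive_bigsum (V W : normedModType R) (I : Type) (s : seq I)
    (f : I -> V -> W) (df : I -> W) (x v : V) :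
  (forall k, is_derive x v (f k) (df k)) ->
  is_derive x v (fun y => \sum_(k <- s) f k y) (\sum_(k <- s) df k).
Proof.
move=> dk; elim: s => [|k s IH].
  under eq_fun do rewrite big_nil; rewrite big_nil; exact: is_derive_cst.
under eq_fun do rewrite big_cons; rewrite big_cons.
exact: is_deriveD.
Qed.

Lemma is_derive_combination (X : normedModType R) (I : Type) (s : seq I)
    (b : I -> X) (c : I -> R -> R) (c' : I -> R) (t : R) :
  (forall k, is_derive t (1 : R) (c k) (c' k)) ->
  is_derive t (1 : R) (fun r => \sum_(k <- s) c k r *: b k) (\sum_(k <- s) c' k *: b k).
Proof.
move=> dc; apply: is_derive_bigsum => k.
have df : differentiable (c k) t by apply/derivable1_diffP; case: (dc k).
split; first exact/derivable1_diffP/differentiableZl.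
rewrite deriveE; last exact/differentiableZl.
rewrite diffZl// -deriveE//; congr (_ *: _).
by case: (dc k).
Qed.

Lemma is_derive_chain (X : normedModType R) (I : Type) (s : seq I)
    (b : I -> X) (c : I -> R -> R) (c' : I -> R) (t : R) (F : X -> R) :
  (forall k, is_derive t (1 : R) (c k) (c' k)) ->
  differentiable F (\sum_(k <- s) c k t *: b k) ->
  is_derive t (1 : R) (fun r => F (\sum_(k <- s) c k r *: b k))
    (\sum_(k <- s) c' k * 'D_(b k) F (\sum_(k <- s) c k t *: b k)).
Proof.
move=> dc dF; have dg := @is_derive_combination _ _ s b c c' t dc.
set g := (fun r => \sum_(k <- s) c k r *: b k) in dg *.
have dg' : differentiable g t by apply/derivable1_diffP; case: dg.
split; first exact/derivable1_diffP/differentiable_comp.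
rewrite deriveE; last exact: differentiable_comp.
rewrite (@diff_comp _ _ _ _ g F t dg' dF)/=.
rewrite -[X in 'd F _ X]deriveE// (@derive_val _ _ _ _ _ _ _ dg) linear_sum.
by apply: eq_bigr => k _; rewrite linearZ/= deriveE.
Qed.

(** The curve moves in the span of fixed vectors b k, so F is differentiated only along these and
    all the variation sits in real coefficients. *)
Lemma jet2_chain (X : normedModType R) (I : finType)
    (b : I -> X) (c : I -> R -> R) (c0 c1 c2 : I -> R) (F : X -> R) (p : X) :
  \sum_k c0 k *: b k = p ->
  (forall k, jet2 (c k) (c0 k) (c1 k) (c2 k)) ->
  (\forall t \near (0 : R), differentiable F (\sum_k c k t *: b k)) ->
  (forall k, differentiable ('D_(b k) F) p) ->
  jet2 (fun t => F (\sum_k c k t *: b k)) (F p)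
    (\sum_k c1 k * 'D_(b k) F p)
    (\sum_k \sum_l c1 k * c1 l * 'D_(b l) ('D_(b k) F) p + \sum_k c2 k * 'D_(b k) F p).
Proof.
move=> c0p jc dF ddF.
have /choice[c' Hc] : forall k, exists c' : R -> R,
    [/\ c k 0 = c0 k, \forall t \near (0 : R), is_derive (t : R) (1 : R) (c k) (c' t),
        c' 0 = c1 k & is_derive (0 : R) 1 c' (c2 k)] by move=> k; exact: jc.
have nc : \forall t \near (0 : R), forall k, is_derive (t : R) (1 : R) (c k) (c' k t).
  apply: (@filter_forall R I (fun k (t : R) => is_derive (t : R) (1 : R) (c k) (c' k t)) (nbhs (0 : R)) _ _).
  by move=> k; case: (Hc k).
have pE : \sum_k c k 0 *: b k = p.
  by rewrite -c0p; apply: eq_bigr => k _; case: (Hc k) => ->.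
exists (fun t => \sum_k c' k t * 'D_(b k) F (\sum_k c k t *: b k)); split.
- by rewrite pE.
- near=> t; apply: is_derive_chain; last by near: t.
  by near: t.
- by rewrite pE; apply: eq_bigr => k _; case: (Hc k) => _ _ ->.
- have dk k : is_derive (0 : R) 1
      (fun t => c' k t * 'D_(b k) F (\sum_k c k t *: b k))
      (\sum_l c1 k * c1 l * 'D_(b l) ('D_(b k) F) p + c2 k * 'D_(b k) F p).
    have [c0E dc c1E dc'] := Hc k.
    have dF' : is_derive (0 : R) 1 (fun t => 'D_(b k) F (\sum_k c k t *: b k))
        (\sum_l c1 l * 'D_(b l) ('D_(b k) F) p).
      rewrite -pE; apply: is_derive_chain; last by rewrite pE.
      move=> l; have [_ /nbhs_singleton + <- _] := Hc l; exact.
    apply: is_derive_eq (is_deriveM dc' dF') _.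
    rewrite pE c1E; congr (_ + _); last exact: mulrC.
    by rewrite scaler_sumr; apply: eq_bigr => l _; rewrite /GRing.scale/= mulrA.
  rewrite -big_split/=.
  exact: is_derive_bigsum dk.
Unshelve. all: by end_near. Qed.

End Lines.

(** * Symmetry of second derivatives *)

Section ClassC.
Context {R : realType}.

Lemma nbhs_norm (V : normedModType R) (x : V) (A : set V) :
  nbhs x A -> exists2 r : R, 0 < r & forall y, `|x - y| < r -> A y.
Proof.
by rewrite -nbhs_ballE => -[r /= r0 Hr]; exists r => // y xy; apply: Hr; rewrite -ball_normE.
Qed.

Lemma class_CW (V W : normedModType R) k (D : set V) (f : V -> W) :
  class_C k.+1 D f -> class_C k D f.
Proof.
elim: k f => [|k IH] f [df ddf]; first by move=> x /df /differentiable_continuous.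
by split=> // v; exact/IH/ddf.
Qed.

Lemma derive_comb (V : normedModType R) (I : Type) (s : seq I) (c : I -> R) (b : I -> V)
    (f : V -> R) x : differentiable f x ->
  'D_(\sum_(i <- s) c i *: b i) f x = \sum_(i <- s) c i * 'D_(b i) f x.
Proof.
move=> df; rewrite deriveE// linear_sum.
by apply: eq_bigr => i _; rewrite linearZ/= deriveE.
Qed.

(** Mean value theorem in v for the difference in w, then in w. The left-hand side is symmetric in v
    and w, which is what [schwarz] exploits. *)
Lemma double_mvt (V : normedModType R) (f : V -> R) (x v w : V) (h : R) : 0 < h ->
  (forall s t : R, 0 <= s <= h -> 0 <= t <= h ->
     differentiable f (x + s *: v + t *: w) /\
     differentiable ('D_v f) (x + s *: v + t *: w)) ->
  exists s t : R, [/\ 0 <= s <= h, 0 <= t <= h &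
    f (x + h *: v + h *: w) - f (x + h *: w) - (f (x + h *: v) - f x) =
    h * h * 'D_w ('D_v f) (x + s *: v + t *: w)].
Proof.
move=> h0 H.
have h1 : 0 <= (0 : R) <= h by rewrite lexx ltW.
have h2 : 0 <= h <= h by rewrite lexx ltW.
pose F s := f (x + s *: v + h *: w) - f (x + s *: v).
pose F' s := 'D_v f (x + s *: v + h *: w) - 'D_v f (x + s *: v).
have dF (s : R) : 0 <= s <= h -> is_derive s (1 : R) F (F' s).
  move=> sh; apply: is_deriveB.
    have := @is_derive_line R V R f (x + h *: w) v s ('D_v f (x + s *: v + h *: w)).
    rewrite addrAC => /(_ (derivableP (diff_derivable _))).
    under eq_fun do rewrite addrAC.
    by apply; have [] := H s h sh h2.
  apply/is_derive_line/derivableP/diff_derivable.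
  by have [] := H s 0 sh h1; rewrite scale0r addr0.
have [||s] := @MVT _ F F' 0 h h0.
- by move=> s; rewrite in_itv/= => /andP[s0 sh]; apply: dF; rewrite !ltW.
- apply: continuous_in_subspaceT => s; rewrite inE/= in_itv/= => /dF[ds _].
  exact/differentiable_continuous/derivable1_diffP.
rewrite in_itv/= subr0 => /andP[s0 sh] FE.
have sh' : 0 <= s <= h by rewrite !ltW.
pose G t := 'D_v f (x + s *: v + t *: w).
pose G' t := 'D_w ('D_v f) (x + s *: v + t *: w).
have dG (t : R) : 0 <= t <= h -> is_derive t (1 : R) G (G' t).
  move=> th; apply: (@is_derive_line _ _ _ ('D_v f)).
  apply/derivableP/diff_derivable.
  by have [] := H s t sh' th.
have [||t] := @MVT _ G G' 0 h h0.
- by move=> t; rewrite in_itv/= => /andP[t0 th]; apply: dG; rewrite !ltW.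
- apply: continuous_in_subspaceT => t; rewrite inE/= in_itv/= => /dG[dt _].
  exact/differentiable_continuous/derivable1_diffP.
rewrite in_itv/= subr0 => /andP[t0 th] GE.
exists s, t; split; [exact: sh'|by rewrite !ltW|].
transitivity (F h - F 0); first by rewrite /F scale0r addr0; ring.
rewrite FE /F'; rewrite /G scale0r addr0 in GE; rewrite GE /G'; ring.
Qed.

Lemma not_both_close (a b c : R) :
  `|a - c| < `|a - b| / 2 -> `|b - c| < `|a - b| / 2 -> False.
Proof.
move=> L1 L2; have := ltrD L1 L2; rewrite -splitr ltNge => /negP; apply.
by rewrite (_ : a - b = (a - c) - (b - c)) ?ler_normB//; ring.
Qed.

(** By [double_mvt] in both orders, the two mixed derivatives take a common value at points of any
    small parallelogram at x; being continuous at x, they agree there. *)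
Lemma schwarz (V : normedModType R) (D : set V) (f : V -> R) (v w x : V) :
  open D -> class_C 2 D f -> D x -> 'D_v ('D_w f) x = 'D_w ('D_v f) x.
Proof.
move=> oD [df ddf] Dx.
have dfv e y : D y -> differentiable ('D_e f) y by move=> Dy; have [+ _] := ddf e; exact.
have cf e1 e2 : {for x, continuous ('D_e1 ('D_e2 f))}.
  by have [_ /(_ e1)] := ddf e2; exact.
apply/eqP; rewrite -subr_eq0 -normr_eq0; apply/eqP; apply/eqP; apply: contraT => ne.
set a := 'D_v _ x in ne *; set b := 'D_w _ x in ne *.
have e0 : 0 < `|a - b| / 2 by rewrite divr_gt0// lt_neqAle eq_sym ne/=.
have [r /= r0 Hr] : exists2 r : R, 0 < r & forall y, `|x - y| < r ->
    [/\ D y, `|a - 'D_v ('D_w f) y| < `|a - b| / 2 &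
     `|b - 'D_w ('D_v f) y| < `|a - b| / 2].
  have N1 : nbhs x D by exact: open_nbhs_nbhs.
  have N2 := @cvgr_dist_lt _ _ _ _ _ _ _ (cf v w) _ e0.
  have N3 := @cvgr_dist_lt _ _ _ _ _ _ _ (cf w v) _ e0.
  have [r r0 Hr] := nbhs_norm (filterI N1 (filterI (N2 _) (N3 _))).
  exists r; first exact: r0.
  by move=> y xy; case: (Hr y xy) => h1 [h2 h3]; split; [exact: h1|exact: h2|exact: h3].
(* The parallelogram of sides h v and h w stays within r / 2 of x; the 1 covers v = w = 0. *)
pose h := r / (2 * (`|v| + `|w| + 1)).
have n0 : 0 < `|v| + `|w| + 1 by rewrite ltr_wpDl// addr_ge0.
have h0 : 0 < h by rewrite divr_gt0// mulr_gt0.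
have B (s t : R) : 0 <= s <= h -> 0 <= t <= h -> `|x - (x + s *: v + t *: w)| < r.
  move=> /andP[s0 sh] /andP[t0 th].
  rewrite -addrA opprD addrA subrr sub0r normrN.
  apply: (le_lt_trans (ler_normD _ _)); rewrite !normrZ !ger0_norm//.
  apply: (@le_lt_trans _ _ (h * (`|v| + `|w| + 1))).
    have L1 : s * `|v| <= h * `|v| by rewrite ler_wpM2r.
    have L2 : t * `|w| <= h * `|w| by rewrite ler_wpM2r.
    by rewrite !mulrDr mulr1; move: (ltW h0); lra.
  have -> : h * (`|v| + `|w| + 1) = r / 2 by rewrite /h; field; exact: lt0r_neq0.
  by rewrite ltr_pdivrMr// ltr_pMr// ltr1n.
have [|s1 [t1 [s1h t1h E1]]] := @double_mvt V f x v w h h0.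
  by move=> s t sh th; have [Dy _ _] := Hr _ (B s t sh th); split; [exact: df|exact: dfv].
have B' (s t : R) : 0 <= s <= h -> 0 <= t <= h -> `|x - (x + s *: w + t *: v)| < r.
  by move=> sh th; rewrite addrAC; exact: B.
have [|s2 [t2 [s2h t2h E2]]] := @double_mvt V f x w v h h0.
  by move=> s t sh th; have [Dy _ _] := Hr _ (B' s t sh th); split; [exact: df|exact: dfv].
have E : 'D_w ('D_v f) (x + s1 *: v + t1 *: w) = 'D_v ('D_w f) (x + s2 *: w + t2 *: v).
  have hh : h * h != 0 by exact/lt0r_neq0/mulr_gt0.
  have E12 := E1; rewrite [x + h *: v + _]addrAC in E12.
  have := E12; have -> : forall p q : R, p - q - (f (x + h *: v) - f x) =
    p - f (x + h *: v) - (q - f x) by move=> p q; ring.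
  rewrite E2 => /(mulfI hh) e; exact: (esym e).
have [_ _ L1] := Hr _ (B _ _ s1h t1h).
have [_ L2 _] := Hr _ (B' _ _ s2h t2h).
rewrite -E in L2.
by exfalso; exact: not_both_close L2 L1.
Qed.

(** Linearity in the inner direction: after exchanging the two derivatives it becomes linearity of
    the differential of ['D_v f]. *)
Lemma derive2_comb (V : normedModType R) (D : set V) (I : Type) (s : seq I)
    (c : I -> R) (b : I -> V) (f : V -> R) (v x : V) :
  open D -> class_C 2 D f -> D x ->
  'D_v ('D_(\sum_(i <- s) c i *: b i) f) x = \sum_(i <- s) c i * 'D_v ('D_(b i) f) x.
Proof.
move=> oD cf Dx; rewrite (schwarz _ _ oD cf Dx) derive_comb; last first.
  by case: cf => _ /(_ v)[+ _]; exact.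
by apply: eq_bigr => i _; rewrite (schwarz _ _ oD cf Dx).
Qed.

End ClassC.

(** * Derivatives of log det *)

Section LogDet.
Context {R : realType}.

Lemma is_derive_prod n (f : 'I_n -> R -> R) (f' : 'I_n -> R) (t : R) :
  (forall i, is_derive t (1 : R) (f i) (f' i)) ->
  is_derive t (1 : R) (fun s => \prod_i f i s)
    (\sum_k \prod_i (if i == k then f' i else f i t)).
Proof.
elim: n f f' => [|n IH] f f' df.
  under eq_fun do rewrite big_ord0; rewrite big_ord0; exact: is_derive_cst.
under eq_fun do rewrite big_ord_recl.
have dP := IH _ _ (fun i => df (lift ord0 i)).
apply: is_derive_eq (is_deriveM (df ord0) dP) _.
rewrite big_ord_recl /= addrC; congr (_ + _).
  rewrite big_ord_recl eqxx/= /GRing.scale/= mulrC; congr (_ * _).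
rewrite scaler_sumr; apply: eq_bigr => k _.
rewrite big_ord_recl /= /GRing.scale/=; congr (_ * _).
Qed.

(** Jacobi's formula. The product rule differentiates one row k at a time, and the determinant with
    row k replaced is expanded along that row. *)
Lemma is_derive_det n (M : R -> 'M[R]_n) (M' : 'M[R]_n) (t : R) :
  (forall i j, is_derive t (1 : R) (fun s => M s i j) (M' i j)) ->
  is_derive t (1 : R) (fun s => \det (M s))
    (\sum_i \sum_j M' i j * cofactor (M t) i j).
Proof.
move=> dM; rewrite /determinant.
have dP (s : 'S_n) : is_derive t (1 : R)
    (fun r => (-1) ^+ s * \prod_i M r i (s i))
    ((-1) ^+ s * \sum_k \prod_i (if i == k then M' i (s i) else M t i (s i))).
  exact: (is_deriveZ ((-1) ^+ s) (is_derive_prod (fun i => dM i (s i)))).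
apply: is_derive_eq (is_derive_bigsum _ dP) _.
under eq_bigr do rewrite mulr_sumr.
rewrite exchange_big/=; apply: eq_bigr => k _.
pose N := \matrix_(i, j) (if i == k then M' i j else M t i j).
transitivity (\det N).
  by apply: eq_bigr => s _; congr (_ * _); apply: eq_bigr => i _; rewrite mxE.
rewrite (expand_det_row N k); apply: eq_bigr => j _.
rewrite mxE eqxx; congr (_ * _); rewrite /cofactor; congr (_ * \det _).
by apply/matrixP => a b; rewrite !mxE eq_sym (negbTE (neq_lift _ _)).
Qed.

(** Jacobi's formula with the cofactors written as det times inverse reads tr (M^-1 M') = b' / b.
    Differentiating it once more, with the derivative - M^-1 M' M^-1 of the inverse, gives the
    second identity; both are read off where M is diagonal. *)
Lemma log_det_jet n (M : R -> 'M[R]_n) (lam : 'I_n -> R) (M1 M2 : 'M[R]_n)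
    (b : R -> R) (b0 b1 b2 : R) :
  (forall i, 0 < lam i) ->
  (forall i j, jet2 (fun t => M t i j) (lam i *+ (i == j)) (M1 i j) (M2 i j)) ->
  jet2 b b0 b1 b2 -> (\forall t \near (0 : R), \det (M t) = b t) -> 0 < b0 ->
  \sum_a M1 a a / lam a = b1 / b0 /\
  \sum_a M2 a a / lam a - \sum_a \sum_c M1 a c * M1 c a / (lam a * lam c) =
    b2 / b0 - (b1 / b0) ^+ 2.
Proof.
move=> lam0 jM jb detb b0p.
have lamN i : lam i != 0 by exact: lt0r_neq0.
have M0 : M 0 = diag_mx (\row_i lam i).
  apply/matrixP => i j; rewrite !mxE.
  by have [f' [-> _ _ _]] := jM i j.
have /choice[M' HM'] : forall ij : 'I_n * 'I_n, exists f' : R -> R,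
    [/\ M 0 ij.1 ij.2 = lam ij.1 *+ (ij.1 == ij.2),
     \forall t \near (0 : R), is_derive (t : R) (1 : R) (fun t => M t ij.1 ij.2) (f' t),
        f' 0 = M1 ij.1 ij.2 & is_derive (0 : R) 1 f' (M2 ij.1 ij.2)].
  by move=> [i j]; exact: jM.
have [b' [b0E db b1E ddb]] := jb.
have dM0 i j : is_derive (0 : R) (1 : R) (fun t => M t i j) (M1 i j) by exact: jet2_der (jM i j).
have nM : \forall t \near (0 : R), forall ij : 'I_n * 'I_n,
    is_derive (t : R) (1 : R) (fun t => M t ij.1 ij.2) (M' ij t).
  apply: (@filter_forall R _ (fun ij (t : R) => is_derive (t : R) (1 : R) (fun t => M t ij.1 ij.2) (M' ij t)) (nbhs (0 : R)) _ _).
  by move=> ij; case: (HM' ij).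
have bp : \forall t \near (0 : R), 0 < b t.
  have cb : {for 0, continuous b}.
    by apply/differentiable_continuous/derivable1_diffP; case: (jet2_der jb).
  by apply: (cvgr_gt (b 0) cb); rewrite b0E.
pose N t := invmx (M t).
have cofN t i j : 0 < b t -> \det (M t) = b t -> cofactor (M t) i j = b t * N t j i.
  move=> bt dt; rewrite /N /invmx unitmxE unitfE dt gt_eqF//= !mxE mulrA mulfV ?gt_eqF// mul1r.
  by [].
(* Needed on a neighbourhood of 0, since it is differentiated below. *)
have jac : \forall t \near (0 : R), \sum_i \sum_j M' (i, j) t * N t j i = b' t / b t.
  have dd := near_join detb.
  near=> t.
  have bt : 0 < b t by near: t.
  have dt : \det (M t) = b t by near: t; exact: detb.
  have d1 : is_derive t (1 : R) b (b' t) by near: t.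
  have d2 : is_derive t (1 : R) b (\sum_i \sum_j M' (i, j) t * cofactor (M t) i j).
    apply: (@near_eq_is_derive _ _ _ (fun s => \det (M s))); first by near: t.
    have d3 : forall ij : 'I_n * 'I_n,
      is_derive (t : R) (1 : R) (fun t => M t ij.1 ij.2) (M' ij t) by near: t.
    have d4 := @is_derive_det n M (\matrix_(i, j) M' (i, j) t) t.
    have e i j : is_derive t (1 : R) (fun s => M s i j) ((\matrix_(i, j) M' (i, j) t) i j).
      by rewrite mxE; exact: (d3 (i, j)).
    apply: is_derive_eq (d4 e) _.
    by apply: eq_bigr => i _; apply: eq_bigr => j _; rewrite mxE.
  rewrite -(@derive_val _ _ _ _ _ _ _ d1) (@derive_val _ _ _ _ _ _ _ d2).
  rewrite mulr_suml; apply: eq_bigr => i _; rewrite mulr_suml; apply: eq_bigr => j _.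
  by rewrite cofN//; field; exact: lt0r_neq0.
have N0 : N 0 = diag_mx (\row_i (lam i)^-1).
  have P : diag_mx (\row_i (lam i)^-1) *m diag_mx (\row_i lam i) = 1%:M.
    rewrite mulmx_diag -diag_const_mx; congr diag_mx.
    by apply/rowP => i; rewrite !mxE mulVf.
  have [_ U] := mulmx1_unit P.
  by rewrite /N M0 -[LHS]mul1mx -P -mulmxA mulmxV// mulmx1.
(* Only differentiability of the inverse is extracted from cofactors over the determinant; its
   derivative is found afterwards by differentiating M N = 1. *)
have [dN dNE] : exists dN : 'M[R]_n, forall i j, is_derive (0 : R) (1 : R) (fun t => N t i j) (dN i j).
  suff /choice[g Hg] : forall ij : 'I_n * 'I_n, exists d, is_derive (0 : R) (1 : R) (fun t => N t ij.1 ij.2) d.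
    by exists (\matrix_(i, j) g (i, j)) => i j; rewrite mxE; exact: (Hg (i, j)).
  move=> [i j]/=.
  have d1 : is_derive (0 : R) (1 : R) (fun t => cofactor (M t) j i)
     ((-1) ^+ (j + i) * \sum_k \sum_l (row' j (col' i M1)) k l * cofactor (row' j (col' i (M 0))) k l).
    have := @is_deriveZ _ _ _ (fun t : R => \det (row' j (col' i (M t)))) ((-1) ^+ (j + i)) 0 1.
    move=> /(_ _ (@is_derive_det _ (fun t => row' j (col' i (M t))) (row' j (col' i M1)) 0 _)).
    apply => k l; rewrite !mxE; under eq_fun do rewrite !mxE; exact: dM0.
  have b00 : b 0 != 0 by rewrite b0E gt_eqF.
  have d2 := is_deriveM d1 (is_deriveV b00 (jet2_der jb)).
  eexists; apply: near_eq_is_derive d2; near=> t.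
  have bt : 0 < b t by near: t.
  have dt : \det (M t) = b t by near: t; exact: detb.
  by change (cofactor (M t) j i * (b t)^-1 = N t i j); rewrite cofN//; field; exact: lt0r_neq0.
have dNv i j : dN i j = - (M1 i j / (lam i * lam j)).
  have NM : \forall t \near (0 : R), \sum_k M t i k * N t k j = (i == j)%:R.
    near=> t.
    have bt : 0 < b t by near: t.
    have dt : \det (M t) = b t by near: t; exact: detb.
    have U : M t \in unitmx by rewrite unitmxE unitfE dt gt_eqF.
    by have := congr1 (fun A : 'M[R]_n => A i j) (mulmxV U); rewrite !mxE.
  have d1 : is_derive (0 : R) (1 : R) (fun t => \sum_k M t i k * N t k j)
      (\sum_k (M 0 i k * dN k j + N 0 k j * M1 i k)).
    by apply: is_derive_bigsum => k; exact: (is_deriveM (dM0 i k) (dNE k j)).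
  have d2 : is_derive (0 : R) (1 : R) (fun t => \sum_k M t i k * N t k j) 0.
    have d0 : is_derive (0 : R) (1 : R) (cst ((i == j)%:R : R)) (0 : R) by exact: is_derive_cst.
    apply: near_eq_is_derive d0; near=> t.
    by apply/esym; near: t.
  have := @derive_val _ _ _ _ _ _ _ d1; rewrite (@derive_val _ _ _ _ _ _ _ d2).
  rewrite big_split/= M0 N0 (bigD1 i)//= big1 => [|k ki]; last first.
    by rewrite !mxE eq_sym (negbTE ki) mulr0n mul0r.
  rewrite [X in _ + X](bigD1 j)//= [X in _ + (_ + X)]big1 => [|k kj]; last first.
    by rewrite !mxE (negbTE kj) mulr0n mul0r.
  rewrite !mxE !eqxx !mulr1n !addr0 => /esym/eqP; rewrite addr_eq0 => /eqP e.
  apply: (mulfI (lamN i)); rewrite e; field; rewrite !lamN//.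
have jac0 := nbhs_singleton jac.
have M'0 i j : M' (i, j) 0 = M1 i j by case: (HM' (i, j)).
split.
  rewrite -b1E -b0E -jac0; apply: eq_bigr => i _; rewrite (bigD1 i)//= big1 => [|k ki].
    by rewrite M'0 N0 !mxE eqxx mulr1n addr0.
  by rewrite N0 !mxE (negbTE ki) mulr0n mulr0.
have d1 : is_derive (0 : R) (1 : R) (fun t => \sum_i \sum_j M' (i, j) t * N t j i)
    (\sum_i \sum_j (M' (i, j) 0 * dN j i + N 0 j i * M2 i j)).
  apply: is_derive_bigsum => i; apply: is_derive_bigsum => j.
  by have [_ _ _ dd] := HM' (i, j); exact: (is_deriveM dd (dNE j i)).
have b00 : b 0 != 0 by rewrite b0E gt_eqF.
have d2 := near_eq_is_derive jac d1.
have d3 : is_derive (0 : R) (1 : R) (fun t => b' t / b t) (b2 / b0 - (b1 / b0) ^+ 2).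
  have := is_deriveM ddb (is_deriveV b00 (jet2_der jb)).
  move=> h; apply: is_derive_eq h _; rewrite /GRing.scale/= b0E b1E; field.
  exact: lt0r_neq0.
rewrite -(@derive_val _ _ _ _ _ _ _ d3) (@derive_val _ _ _ _ _ _ _ d2).
rewrite -sumrB; apply: eq_bigr => i _.
rewrite big_split/= addrC; congr (_ + _).
  rewrite (bigD1 i)//= big1 => [|k ki]; last by rewrite N0 !mxE (negbTE ki) mulr0n mul0r.
  by rewrite N0 !mxE eqxx mulr1n addr0 mulrC.
rewrite -sumrN; apply: eq_bigr => j _; rewrite M'0 dNv [lam j * _]mulrC mulrN mulrA.
Unshelve. all: by end_near. Qed.

End LogDet.

(** * Spectral frames *)

Section Frames.
Context {R : realType} {n : nat}.
Local Notation V := 'rV[R]_n.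
Implicit Types (x y z : V) (M : 'M[R]_n).

Definition dot x y : R := \sum_i x 0 i * y 0 i.
Definition qform M x y : R := \sum_i \sum_j M i j * x 0 i * y 0 j.

Lemma dotC x y : dot x y = dot y x.
Proof. by apply: eq_bigr => i _; rewrite mulrC. Qed.

Lemma dotDl x y z : dot (x + y) z = dot x z + dot y z.
Proof. by rewrite -big_split; apply: eq_bigr => i _; rewrite mxE mulrDl. Qed.

Lemma dotZl a x y : dot (a *: x) y = a * dot x y.
Proof. by rewrite mulr_sumr; apply: eq_bigr => i _; rewrite mxE mulrA. Qed.

Lemma dotDr x y z : dot z (x + y) = dot z x + dot z y.
Proof. by rewrite dotC dotDl !(dotC z). Qed.

Lemma dotZr a x y : dot y (a *: x) = a * dot y x.
Proof. by rewrite dotC dotZl dotC. Qed.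

Lemma dot_sumr (I : Type) (s : seq I) (c : I -> R) (b : I -> V) x :
  dot x (\sum_(i <- s) c i *: b i) = \sum_(i <- s) c i * dot x (b i).
Proof.
elim: s => [|i s IH]; last by rewrite !big_cons dotDr dotZr IH.
by rewrite !big_nil; apply: big1 => i _; rewrite mxE mulr0.
Qed.

Lemma dot_ge0 x : 0 <= dot x x.
Proof. by apply: sumr_ge0 => i _; rewrite -expr2 sqr_ge0. Qed.

Lemma dot_eq0 x : dot x x = 0 -> x = 0.
Proof.
move=> /eqP; rewrite psumr_eq0 => [|i _]; last by rewrite -expr2 sqr_ge0.
move=> /allP h; apply/rowP => i; rewrite mxE.
by have := h i (mem_index_enum _); rewrite -expr2 sqrf_eq0 => /eqP.
Qed.

Lemma qformDl M x y z : qform M (x + y) z = qform M x z + qform M y z.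
Proof.
rewrite -big_split; apply: eq_bigr => i _; rewrite -big_split.
by apply: eq_bigr => j _; rewrite !mxE /= mulrDr mulrDl.
Qed.

Lemma qformZl M a x y : qform M (a *: x) y = a * qform M x y.
Proof.
rewrite mulr_sumr; apply: eq_bigr => i _; rewrite mulr_sumr.
by apply: eq_bigr => j _; rewrite !mxE; ring.
Qed.

Lemma qformDr M x y z : qform M z (x + y) = qform M z x + qform M z y.
Proof.
rewrite -big_split; apply: eq_bigr => i _; rewrite -big_split.
by apply: eq_bigr => j _; rewrite !mxE /= mulrDr.
Qed.

Lemma qformZr M a x y : qform M y (a *: x) = a * qform M y x.
Proof.
rewrite mulr_sumr; apply: eq_bigr => i _; rewrite mulr_sumr.
by apply: eq_bigr => j _; rewrite !mxE; ring.
Qed.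

Definition mxsymmetric M := forall i j, M i j = M j i.

Lemma qformC M x y : mxsymmetric M -> qform M x y = qform M y x.
Proof.
move=> sM; rewrite /qform exchange_big; apply: eq_bigr => i _.
by apply: eq_bigr => j _; rewrite sM; ring.
Qed.

(** Serves as the first order condition at a maximum of the Rayleigh quotient, without calculus on
    the sphere. *)
Lemma quadratic_vanish (b c : R) : (forall t, 2 * t * b <= t ^+ 2 * c) -> b = 0.
Proof.
move=> h; apply/eqP/negPn/negP => b0.
have k0 : 0 < `|c| + 1 by rewrite ltr_wpDl.
set k := `|c| + 1 in k0; have ck : c / k <= 1.
  by rewrite ler_pdivrMr// mul1r (le_trans (ler_norm _))// lerDl.
have q0 : 0 < b ^+ 2 / k by rewrite divr_gt0// lt_neqAle eq_sym sqrf_eq0 b0 sqr_ge0.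
have := h (b / k); rewrite (_ : 2 * (b / k) * b = 2 * (b ^+ 2 / k)); last by ring.
rewrite (_ : (b / k) ^+ 2 * c = (b ^+ 2 / k) * (c / k)); last by ring.
by have := ler_wpM2l (ltW q0) ck; rewrite mulr1; move: q0; lra.
Qed.

Definition eigenframe M (k : nat) (e : nat -> V) (lam : nat -> R) : Prop :=
  (forall i j, (i < k)%N -> (j < k)%N -> dot (e i) (e j) = (i == j)%:R) /\
  (forall i y, (i < k)%N -> qform M (e i) y = lam i * dot (e i) y).

(** The Rayleigh principle: a maximiser of the form on the unit sphere of the orthogonal complement
    of a partial eigenframe is the next eigenvector. *)
Lemma eigenframe_extend M k e lam x : mxsymmetric M -> eigenframe M k e lam ->
  dot x x = 1 -> (forall i, (i < k)%N -> dot (e i) x = 0) ->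
  (forall y, dot y y = 1 -> (forall i, (i < k)%N -> dot (e i) y = 0) ->
     qform M y y <= qform M x x) ->
  eigenframe M k.+1 (fun i => if i == k then x else e i)
    (fun i => if i == k then qform M x x else lam i).
Proof.
move=> sM [on eg] x1 ex mx; set L := qform M x x.
have mx' y : (forall i, (i < k)%N -> dot (e i) y = 0) -> qform M y y <= L * dot y y.
  move=> ey; have := dot_ge0 y; rewrite le_eqVlt => /orP[/eqP/esym y0|y0].
    by rewrite y0 (dot_eq0 y0) -(scale0r x) qformZl !mul0r mulr0.
  pose s := Num.sqrt (dot y y).
  have s0 : 0 < s by rewrite sqrtr_gt0.
  have sE : s * s = dot y y by rewrite -expr2 sqr_sqrtr// ltW.
  have y1 : dot (s^-1 *: y) (s^-1 *: y) = 1.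
    by rewrite dotZl dotZr -sE; field; rewrite gt_eqF.
  have ye i : (i < k)%N -> dot (e i) (s^-1 *: y) = 0.
    by move=> ik; rewrite dotZr ey// mulr0.
  by have := mx _ y1 ye; rewrite qformZl qformZr mulrA -invfM sE ler_pdivrMl// mulrC.
have ort z : (forall i, (i < k)%N -> dot (e i) z = 0) -> dot x z = 0 -> qform M x z = 0.
  move=> ez xz; apply: (@quadratic_vanish _ (L * dot z z - qform M z z)) => t.
  have := mx' (x + t *: z).
  rewrite !(dotDl, dotDr, dotZl, dotZr, qformDl, qformDr, qformZl, qformZr).
  rewrite (dotC z x) xz x1 (qformC z x sM) -/L => h.
  have ei i : (i < k)%N -> dot (e i) (x + t *: z) = 0.
    by move=> ik; rewrite dotDr dotZr ex// ez// mulr0 addr0.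
  by move: (h ei); lra.
have key y : qform M x y = L * dot x y.
  (* The residual M x - L x. It is orthogonal to x and, by symmetry of M, to the frame, so it is
     itself an admissible variation and must vanish. *)
  pose z : V := \row_j ((\sum_i M i j * x 0 i) - L * x 0 j).
  have dz w : dot z w = qform M x w - L * dot x w.
    rewrite /dot /qform exchange_big/= mulr_sumr -sumrB; apply: eq_bigr => j _.
    by rewrite mxE mulrBl mulr_suml mulrA.
  suff z0 : z = 0 by apply/eqP; rewrite -subr_eq0 -dz z0 -(scale0r x) dotZl mul0r.
  have zx : dot x z = 0 by rewrite dotC dz x1 mulr1 subrr.
  apply: dot_eq0; rewrite {1}dz zx mulr0 subr0; apply: ort => // i ik.
  by rewrite dotC dz (dotC x) ex// mulr0 subr0 qformC// eg// ex// mulr0.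
split.
- move=> i j; rewrite !ltnS => ik jk.
  have lt l : l != k -> (l <= k)%N -> (l < k)%N by move=> lk; rewrite leq_eqVlt (negbTE lk).
  case: (eqVneq i k) => [iE|ik']; case: (eqVneq j k) => [jE|jk'].
  + by rewrite x1 iE jE eqxx.
  + by rewrite iE eq_sym (negbTE jk') dotC ex// lt.
  + by rewrite jE (negbTE ik') ex// lt.
  + by rewrite on// lt.
- move=> i y; rewrite ltnS => ik; case: (eqVneq i k) => [_|ik']; first exact: key.
  by rewrite eg// ltn_neqAle ik' ik.
Qed.

Lemma continuous_coord i : continuous (fun x : V => x 0 i).
Proof. by move=> x; exact: coord_continuous. Qed.

Lemma continuous_bigsum (T : topologicalType) (I : Type) (s : seq I) (f : I -> T -> R) (t : T) :
  (forall i, {for t, continuous (f i)}) -> {for t, continuous (fun p => \sum_(i <- s) f i p)}.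
Proof.
move=> cf; suff : (fun p => \sum_(i <- s) f i p) @ t --> \sum_(i <- s) f i t by [].
elim: s => [|i s IH].
  by under eq_fun do rewrite big_nil; rewrite big_nil; exact: cvg_cst.
by under eq_fun do rewrite big_cons; rewrite big_cons; apply: cvgD => //; exact: cf.
Qed.

Lemma continuous_dot y : continuous (dot y).
Proof.
move=> x; apply: continuous_bigsum => i; apply: continuousM; first exact: cst_continuous.
exact: continuous_coord.
Qed.

Lemma continuous_dot2 : continuous (fun x => dot x x).
Proof.
move=> x; apply: continuous_bigsum => i.
by apply: continuousM; exact: continuous_coord.
Qed.

Lemma continuous_qform2 M : continuous (fun x => qform M x x).
Proof.
move=> x; apply: continuous_bigsum => i; apply: continuous_bigsum => j.
apply: continuousM; last exact: continuous_coord.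
by apply: continuousM; [exact: cst_continuous|exact: continuous_coord].
Qed.

Lemma rV_norm_le x (r : R) : 0 <= r -> (forall i, `|x 0 i| <= r) -> `|x| <= r.
Proof.
move=> r0 h; rewrite /Num.norm/= mx_normrE.
by apply: bigmax_le => // -[i j] _; rewrite ord1.
Qed.

Lemma rV_coord_le x i : `|x 0 i| <= `|x|.
Proof.
rewrite [leRHS]/Num.norm/= mx_normrE.
exact: (le_bigmax _ (fun ij => `|x ij.1 ij.2|) (0, i)).
Qed.

Lemma sqr_coord_le_dot x i : x 0 i ^+ 2 <= dot x x.
Proof.
rewrite /dot (bigD1 i)//= -expr2 lerDl; apply: sumr_ge0 => j _.
by rewrite -expr2 sqr_ge0.
Qed.

Lemma unit_coord_le x i : dot x x = 1 -> `|x 0 i| <= 1.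
Proof.
move=> x1; have := sqr_coord_le_dot x i; rewrite x1.
by rewrite -real_normK ?num_real// expr_le1.
Qed.

Lemma sphere_compact (A : set V) : closed A -> compact [set x | dot x x = 1 /\ A x].
Proof.
move=> cA; apply: bounded_closed_compact.
  exists 1; split => // r r1 x /= [x1 _].
  apply: rV_norm_le => [|i]; first exact: le_trans (ltW r1).
  by apply: le_trans (ltW r1); exact: unit_coord_le.
rewrite (_ : [set x | _] = ((fun x => dot x x) @^-1` [set 1]) `&` A)//.
apply: closedI => //; apply: preimage_closed; last exact: closed_eq.
by move=> x _; exact: continuous_dot2.
Qed.

Lemma orthogonal_vector k (e : nat -> V) : (k < n)%N ->
  exists x, dot x x = 1 /\ forall i, (i < k)%N -> dot (e i) x = 0.
Proof.
move=> kn; pose E : 'M[R]_(n, k) := \matrix_(j, i) e i 0 j.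
have r : (0 < \rank (kermx E))%N.
  by rewrite mxrank_ker subn_gt0 (leq_ltn_trans (rank_leq_col _)).
have [i Ki] : exists i, row i (kermx E) != 0.
  apply/existsP; rewrite -negb_forall; apply/negP => /forallP h.
  suff K0 : kermx E = 0 by rewrite K0 mxrank0 in r.
  by apply/row_matrixP => i; rewrite row0; apply/eqP.
set v := row i _ in Ki.
have vE : v *m E = 0 by rewrite -row_mul mulmx_ker row0.
have v0 : 0 < dot v v.
  rewrite lt_neqAle dot_ge0 andbT; apply/eqP => /esym/dot_eq0 v0.
  by rewrite v0 eqxx in Ki.
exists ((Num.sqrt (dot v v))^-1 *: v); split.
  rewrite dotZl dotZr mulrA -invfM -expr2 sqr_sqrtr ?ltW// mulVf// gt_eqF//.
move=> j jk; rewrite dotZr; have := congr1 (fun A : 'rV_k => A 0 (Ordinal jk)) vE.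
rewrite !mxE => vj; rewrite [X in _ * X](_ : _ = 0) ?mulr0// -[RHS]vj.
by apply: eq_bigr => l _; rewrite !mxE mulrC.
Qed.

(** The given maximiser xi starts the frame, so the direction found by maximising over unit vectors
    is the eigenvector of the top eigenvalue. *)
Lemma spectral_frame M (xi : V) : mxsymmetric M -> dot xi xi = 1 ->
  (forall y, dot y y = 1 -> qform M y y <= qform M xi xi) ->
  exists (e : 'I_n -> V) (lam : 'I_n -> R) (o : 'I_n),
    [/\ e o = xi, forall a b, dot (e a) (e b) = (a == b)%:R,
        forall a y, qform M (e a) y = lam a * dot (e a) y
      & forall a, lam a <= lam o].
Proof.
move=> sM xi1 mxi.
have n0 : (0 < n)%N.
  rewrite lt0n; apply/eqP => n0; move: xi1; rewrite /dot big1 => [/eqP|i _].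
    by rewrite eq_sym oner_eq0.
  by have := ltn_ord i; rewrite {2}n0.
have H k : (k < n)%N -> exists e lam, eigenframe M k.+1 e lam /\ e 0%N = xi.
  elim: k => [_|k IH kn].
    exists (fun i => if i == 0%N then xi else 0), (fun i => if i == 0%N then qform M xi xi else 0).
    by split=> //; apply: (@eigenframe_extend M 0 (fun=> 0) (fun=> 0)) => // y y1 _; exact: mxi.
  have [e [lam [ef e0]]] := IH (ltnW kn).
  have [v [v1 ve]] := orthogonal_vector e kn.
  have cA : closed [set x | forall i, (i < k.+1)%N -> dot (e i) x = 0].
    rewrite (_ : [set x | _] = \bigcap_(i in [set i | (i < k.+1)%N]) (dot (e i) @^-1` [set 0])).
      apply: closed_bigI => i _; apply: preimage_closed; last exact: closed_eq.
      by move=> x _; exact: continuous_dot.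
    by apply/seteqP; split.
  have [x xA mx] := @compact_EVT_max _ _ (fun x => qform M x x) _
     (ex_intro _ v (conj v1 ve)) (sphere_compact cA)
     (continuous_subspaceT (@continuous_qform2 M)).
  move: xA; rewrite inE/= => -[x1 xe].
  have := @eigenframe_extend M k.+1 e lam x sM ef x1 xe.
  move=> /(_ _)[|H1 H2].
    by move=> y y1 ye; apply: mx; rewrite inE.
  by eexists; eexists; split; first exact: (conj H1 H2).
have [e [lam [[on eg] e0]]] : exists e lam, eigenframe M n e lam /\ e 0%N = xi.
  by have := H n.-1; rewrite prednK// => /(_ (leqnn _)).
have lamE a : (a < n)%N -> lam a = qform M (e a) (e a).
  by move=> an; rewrite eg// on// eqxx mulr1.
exists (fun a : 'I_n => e a), (fun a : 'I_n => lam a), (Ordinal n0); split => //=.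
- by move=> a b; rewrite on.
- by move=> a y; rewrite eg.
- by move=> a; rewrite !lamE// e0; apply: mxi; rewrite on// eqxx.
Qed.

(** A one-sided inverse of a square matrix is two-sided: E E^T = 1 gives E^T E = 1. *)
Lemma frame_resolution (e : 'I_n -> V) i j :
  (forall a b, dot (e a) (e b) = (a == b)%:R) ->
  \sum_a e a 0 i * e a 0 j = (i == j)%:R.
Proof.
move=> on; pose E : 'M[R]_n := \matrix_(a, k) e a 0 k.
have EE : E *m E^T = 1%:M.
  apply/matrixP => a b; rewrite !mxE -on; apply: eq_bigr => k _.
  by rewrite !mxE.
have := congr1 (fun A : 'M[R]_n => A i j) (mulmx1C EE); rewrite !mxE => <-.
by apply: eq_bigr => a _; rewrite !mxE.
Qed.

Lemma frame_expand (e : 'I_n -> V) x :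
  (forall a b, dot (e a) (e b) = (a == b)%:R) ->
  x = \sum_a dot x (e a) *: e a.
Proof.
move=> on; apply/rowP => j; rewrite summxE.
under eq_bigr do rewrite mxE mulr_suml.
rewrite exchange_big/= (bigD1 j)//= [X in _ + X]big1 => [|i ij].
  under eq_bigr do rewrite -mulrA; rewrite -mulr_sumr frame_resolution//.
  by rewrite eqxx mulr1 addr0.
under eq_bigr do rewrite -mulrA; rewrite -mulr_sumr frame_resolution//.
by rewrite (negbTE ij) mulr0.
Qed.

End Frames.

(** * The inequality at the maximum *)

(* Indices i refer to the standard basis, a and b to the eigenframe of w.
   With s_i = D_i w_oo / w_oo: sf, etaf, mf, phif are s, D eta, <Du, D^2u .>, x - x0
   in the eigenframe, W a = D_aa w_oo, T a b = D_o w_ab, q a = sum_k (D_a D_k u)^2,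
   nn a = sum_k D_k u D_aa D_k u, and G is the vector of first order coefficients
   of the linearised equation. *)
Section Algebra.
Context {R : realType} {n : nat}.
Context (C beta kappa tau r eta : R) (lam : 'I_n -> R) (o : 'I_n).
Context (s etad m phi G sf etaf mf phif W etaff q nn : 'I_n -> R).
Context (T : 'I_n -> 'I_n -> R).
Let L := lam o.
Let Tr := \sum_a (lam a)^-1.
Context (C1 : 1 <= C) (b0 : 0 < beta) (k0 : 0 < kappa) (t12 : 12 <= tau) (r0 : 0 <= r).
Context (lam0 : forall a, 0 < lam a) (lamL : forall a, lam a <= L) (L1 : 1 <= L).
Context (eta0 : 0 < eta) (eta1 : eta <= 1).
(** [H1] and [H2] are the first order condition in the standard basis and in the frame, [H3] is the
    second order condition summed with the weights 1 / lam_a. [H4] and [H6] come from the equation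
    differentiated twice along e_o and once in each coordinate, [H8] from regularity applied to eta.
    The T-hypotheses compare D_a w_oo with D_o w_oa. *)
Context (H1 : forall i, s i + tau * (etad i / eta) + beta * m i + kappa * phi i = 0).
Context (H2 : forall a, sf a + tau * (etaf a / eta) + beta * mf a + kappa * phif a = 0).
Context (H3 : \sum_a (lam a)^-1 * (W a / L - sf a ^+ 2 +
  tau * (etaff a / eta - (etaf a / eta) ^+ 2) + beta * (q a + nn a) + kappa) <= 0).
Context (H4 : \sum_a (lam a)^-1 * W a >=
  \sum_a \sum_b (T a b) ^+ 2 * ((lam a)^-1 * (lam b)^-1) + L * (\sum_i G i * s i)
  - C * (1 + Tr) * (1 + L) - C * (1 + L ^+ 2)).
Context (Tsym : forall a, T a o = T o a).
Context (H5o : sf o = T o o / L).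
Context (H5 : forall a, `|sf a - T o a / L| <= C).
Context (H6 : \sum_a (lam a)^-1 * nn a >= \sum_i G i * m i - C * (1 + Tr)).
Context (H7 : forall a, q a >= lam a ^+ 2 - C * lam a).
Context (H8 : \sum_a (lam a)^-1 * etaff a >= \sum_i G i * etad i - C - C * eta * Tr
   - C * \sum_a (lam a)^-1 * `|etaf a|).
Context (H9 : `|\sum_i G i * phi i| <= C * (1 + Tr) * r).
Context (H10 : forall a, `|phif a| <= r).
Context (H11 : forall a, `|mf a| <= C * (1 + lam a)).
Context (H12 : `|etaf o| <= C).

Let w a : R := (lam a)^-1.
Let w0 a : 0 < w a. Proof. by rewrite invr_gt0. Qed.
Let tau0 : 0 < tau. Proof. by apply: lt_le_trans t12. Qed.
Let L0 : 0 < L. Proof. exact: lam0. Qed.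
Let Tr0 : 0 <= Tr. Proof. by apply: sumr_ge0 => a _; rewrite invr_ge0 ltW. Qed.

(* By symmetry of T the pairs (a, o) and (o, a) both contribute, whence the
   factor 2, which leaves room to absorb the squares of s_a. *)
Let Bt a := if a == o then (T o o / L) ^+ 2 else 2 * (T o a / L) ^+ 2.

Let stepB : \sum_a w a * Bt a <= L^-1 * \sum_a \sum_b (T a b) ^+ 2 * (w a * w b).
Proof.
have nonneg a b : 0 <= T a b ^+ 2 * (w a * w b).
  by rewrite mulr_ge0 ?sqr_ge0// mulr_ge0// ltW.
rewrite (bigD1 o)//= [X in _ <= _ * X](bigD1 o)//=.
rewrite [X in _ <= _ * (X + _)](bigD1 o)//= /Bt eqxx.
have A : \sum_(a | a != o) T a o ^+ 2 * (w a * w o) <= \sum_(a | a != o) \sum_b T a b ^+ 2 * (w a * w b).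
  apply: ler_sum => a _; rewrite (bigD1 o)//= lerDl.
  by apply: sumr_ge0 => b _; exact: nonneg.
have E : \sum_(a | a != o) w a * (if a == o then (T o o / L) ^+ 2 else 2 * (T o a / L) ^+ 2)
   = L^-1 * (\sum_(a | a != o) T o a ^+ 2 * (w o * w a)) + L^-1 * (\sum_(a | a != o) T a o ^+ 2 * (w a * w o)).
  rewrite !mulr_sumr -big_split/=; apply: eq_bigr => a ao.
  rewrite (negbTE ao) Tsym /w -/L; field; rewrite !gt_eqF//.
rewrite E; have iL : 0 < L^-1 by rewrite invr_gt0.
rewrite !mulrDr -addrA; apply: lerD.
  by rewrite /w -/L le_eqVlt; apply/orP; left; apply/eqP; field; rewrite gt_eqF.
by rewrite lerD2l ler_pM2l.
Qed.

(** From 2 tau x^2 = (2 / tau) (tau x)^2 with x = D_a eta / eta: tau x is minus a sum of three terms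
    by [H2], so its square costs a factor 3; bounding (1 + lam)^2 by 2 (1 + lam^2) costs another 2
    in [cb]. *)
Let cb := 12 * beta ^+ 2 * C ^+ 2 / tau.
Let ck := 6 * kappa ^+ 2 * r ^+ 2 / tau.

Let cb0 : 0 <= cb.
Proof. by apply: divr_ge0; [rewrite -mulrA mulr_ge0// mulr_ge0// sqr_ge0|exact: ltW]. Qed.

Let ck0 : 0 <= ck.
Proof. by apply: divr_ge0; [rewrite -mulrA mulr_ge0// mulr_ge0// sqr_ge0|exact: ltW]. Qed.

(** For a <> o the factor 2 in [Bt] leaves half of s_a^2 over, and tau >= 12 lets it absorb the 6 /
    tau of it that the square of D_a eta / eta produces. For a = o the two squares cancel exactly
    and nothing is left, but there the weight is 1 / L and D_o eta is bounded. *)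
Let stepP a : - (6 * C ^+ 2) * w a - cb * (w a + lam a) - ck * w a
   - (2 * tau * C ^+ 2 / (eta ^+ 2 * L)) *+ (a == o) <=
  w a * (Bt a - sf a ^+ 2 - 2 * tau * (etaf a / eta) ^+ 2).
Proof.
have C0 : 0 <= C by exact: le_trans C1.
rewrite /Bt; case: eqVneq => [->|ao]; rewrite ?mulr1n ?mulr0n ?subr0.
  have -> : w o * ((T o o / L) ^+ 2 - sf o ^+ 2 - 2 * tau * (etaf o / eta) ^+ 2) =
     - (2 * tau * etaf o ^+ 2 / (eta ^+ 2 * L)).
    by rewrite H5o /w -/L; field; rewrite !gt_eqF.
  have E2 : etaf o ^+ 2 <= C ^+ 2.
    by rewrite -real_normK ?num_real// lerXn2r ?nnegrE.
  have E3 : 2 * tau * etaf o ^+ 2 / (eta ^+ 2 * L) <= 2 * tau * C ^+ 2 / (eta ^+ 2 * L).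
    rewrite ler_pM2r; last by rewrite invr_gt0 mulr_gt0 ?exprn_gt0.
    by rewrite ler_pM2l// mulr_gt0.
  have := ltW (w0 o); have := ltW (lam0 o) => l0 ww.
  have X1 : 0 <= 6 * C ^+ 2 * w o by rewrite !mulr_ge0// sqr_ge0.
  have X2 : 0 <= cb * (w o + lam o) by rewrite mulr_ge0// addr_ge0.
  have X3 : 0 <= ck * w o by rewrite mulr_ge0.
  by move: E3 X1 X2 X3; set A := _ / _; set B := _ / _; lra.
have -> : - (6 * C ^+ 2) * w a - cb * (w a + lam a) - ck * w a =
   w a * (- (6 * C ^+ 2) - cb * (1 + lam a ^+ 2) - ck).
  by rewrite /w; field; rewrite gt_eqF.
rewrite ler_pM2l//.
set p := T o a / L; set x := etaf a / eta; set y := sf a.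
have D : (y - p) ^+ 2 <= C ^+ 2.
  by rewrite -real_normK ?num_real// lerXn2r ?nnegrE//; exact: H5.
(* With d = y - p, the difference 2 p^2 - 3/2 y^2 equals (y - 4 d)^2 / 2 - 6 d^2. *)
have P1 : 2 * p ^+ 2 >= 3 / 2 * y ^+ 2 - 6 * C ^+ 2.
  have := sqr_ge0 (y - 4 * (y - p)); move: D; rewrite !expr2; nra.
have M2 : mf a ^+ 2 <= C ^+ 2 * (2 * (1 + lam a ^+ 2)).
  have : mf a ^+ 2 <= (C * (1 + lam a)) ^+ 2.
    rewrite -real_normK ?num_real// lerXn2r ?nnegrE//.
    by rewrite mulr_ge0// addr_ge0// ltW.
  move/le_trans; apply; rewrite exprMn ler_wpM2l ?sqr_ge0//.
  by have := sqr_ge0 (1 - lam a); rewrite !expr2; lra.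
have F2 : phif a ^+ 2 <= r ^+ 2.
  by rewrite -real_normK ?num_real// lerXn2r ?nnegrE.
have X2 : (tau * x) ^+ 2 <= 3 * (y ^+ 2 + beta ^+ 2 * mf a ^+ 2 + kappa ^+ 2 * phif a ^+ 2).
  have -> : tau * x = - (y + beta * mf a + kappa * phif a).
    by have := H2 a; rewrite -/x -/y; lra.
  have := sqr_ge0 (y - beta * mf a); have := sqr_ge0 (y - kappa * phif a).
  have := sqr_ge0 (beta * mf a - kappa * phif a).
  by rewrite !expr2; lra.
have X3 : 2 * tau * x ^+ 2 <= 6 / tau * y ^+ 2 + cb * (1 + lam a ^+ 2) + ck.
  have -> : 2 * tau * x ^+ 2 = 2 / tau * (tau * x) ^+ 2 by field; rewrite gt_eqF.
  have t2 : 0 <= 2 / tau by rewrite divr_ge0// ltW.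
  apply: (le_trans (ler_wpM2l t2 X2)).
  have := ler_wpM2l (sqr_ge0 beta) M2; have := ler_wpM2l (sqr_ge0 kappa) F2 => Z1 Z2.
  have := ler_wpM2l t2 (lerD Z2 Z1) => Z3.
  have -> : cb * (1 + lam a ^+ 2) = 3 * (2 / tau * (beta ^+ 2 * (C ^+ 2 * (2 * (1 + lam a ^+ 2))))).
    by rewrite /cb; field; rewrite gt_eqF.
  have -> : ck = 3 * (2 / tau * (kappa ^+ 2 * r ^+ 2)) by rewrite /ck; field; rewrite gt_eqF.
  move: Z3; rewrite !mulrDr; set A := 2 / tau * _; set B := 2 / tau * _.
  have -> : 2 / tau * (3 * y ^+ 2) = 6 / tau * y ^+ 2 by ring.
  by rewrite ![2 / tau * (3 * _)]mulrCA -/A -/B; lra.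
have X4 : 6 / tau * y ^+ 2 <= 1 / 2 * y ^+ 2.
  rewrite ler_wpM2r ?sqr_ge0// ler_pdivrMr//. by move: t12; lra.
by lra.
Qed.

Lemma pogorelov_inequality :
  beta * L + kappa * Tr <= 2 * C * (1 + Tr) + 2 * C * L + 6 * C ^+ 2 * Tr
   + kappa * (C * (1 + Tr) * r) + C * (tau / eta) + C * tau * Tr + tau * C ^+ 2 * Tr
   + 2 * tau * C ^+ 2 / (eta ^+ 2 * L) + cb * (Tr + n%:R * L) + ck * Tr
   + beta * (n%:R * C) + beta * (C * (1 + Tr)).
Proof.
have C0 : 0 <= C by exact: le_trans C1.
set te := tau / eta; have te0 : 0 < te by rewrite divr_gt0.
pose S2 := \sum_a w a * (etaf a / eta) ^+ 2.
have X1 : L^-1 * (\sum_a w a * W a) - (\sum_a w a * sf a ^+ 2) + te * (\sum_a w a * etaff a)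
   - tau * S2 + beta * (\sum_a w a * q a) + beta * (\sum_a w a * nn a) + kappa * Tr <= 0.
  apply: le_trans H3; rewrite le_eqVlt; apply/orP; left; apply/eqP.
  rewrite /S2 /Tr !mulr_sumr -!sumrN -!big_split/=; apply: eq_bigr => a _.
  by rewrite /w /te; field; rewrite !gt_eqF.
(* The contraction of [H1] with G: the first order terms of [H4], [H8] and [H6] add up to this sum,
   so only the term in phi survives. *)
have X2 : \sum_i G i * s i + te * (\sum_i G i * etad i) + beta * (\sum_i G i * m i) =
    - (kappa * \sum_i G i * phi i).
  rewrite !mulr_sumr -sumrN -!big_split/=; apply: eq_bigr => i _.
  have -> : s i = - (tau * (etad i / eta) + beta * m i + kappa * phi i) by have := H1 i; lra.
  by rewrite /te; ring.
have X3 : L^-1 * (\sum_a w a * W a) >= L^-1 * (\sum_a \sum_b T a b ^+ 2 * (w a * w b))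
    + \sum_i G i * s i - 2 * C * (1 + Tr) - 2 * C * L.
  have iL : 0 < L^-1 by rewrite invr_gt0.
  have := ler_wpM2l (ltW iL) H4; rewrite -/w; apply: le_trans.
  set S := \sum_a _; set S' := \sum_i _.
  have -> : L^-1 * (S + L * S' - C * (1 + Tr) * (1 + L) - C * (1 + L ^+ 2)) =
    L^-1 * S + S' - C * (1 + Tr) * (L^-1 + 1) - C * (L^-1 + L).
    by field; rewrite gt_eqF.
  have iL1 : L^-1 <= 1 by rewrite invf_le1.
  have Y1 : C * (1 + Tr) * (L^-1 + 1) <= 2 * C * (1 + Tr).
    have : C * (1 + Tr) * (L^-1 + 1) <= C * (1 + Tr) * 2.
      by apply: ler_wpM2l; [rewrite mulr_ge0// addr_ge0|move: iL1; lra].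
    by lra.
  have Y2 : C * (L^-1 + L) <= 2 * C * L.
    have : C * (L^-1 + L) <= C * (2 * L) by apply: ler_wpM2l => //; move: iL1 L1; lra.
    by lra.
  by lra.
(* The loss C |D_a eta| / eta is split by Young's inequality into C^2 and a square. The square makes
   a second copy of tau [S2], besides the one in [X1], hence the 2 tau in [stepP]. *)
have X4 : te * (\sum_a w a * etaff a) >= te * (\sum_i G i * etad i) - C * te - C * tau * Tr
    - tau * C ^+ 2 * Tr - tau * S2.
  have := ler_wpM2l (ltW te0) H8; rewrite -/w; apply: le_trans.
  set S := \sum_i _; set S' := \sum_a _.
  have -> : te * (S - C - C * eta * Tr - C * S') = te * S - C * te - C * tau * Tr - te * C * S'.
    by rewrite /te; field; rewrite gt_eqF.
  suff : te * C * S' <= tau * C ^+ 2 * Tr + tau * S2 by lra.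
  rewrite /S' /S2 /Tr !mulr_sumr -big_split/=; apply: ler_sum => a _.
  have -> : te * C * (w a * `|etaf a|) = tau * w a * (C * (`|etaf a| / eta)).
    by rewrite /te; field; rewrite gt_eqF.
  have -> : tau * C ^+ 2 * (lam a)^-1 + tau * (w a * (etaf a / eta) ^+ 2) =
     tau * w a * (C ^+ 2 + (`|etaf a| / eta) ^+ 2).
    by rewrite !exprMn real_normK ?num_real// /w; ring.
  rewrite ler_pM2l ?mulr_gt0//.
  set x := _ / eta; have := sqr_ge0 (C - x); have := sqr_ge0 x; have := sqr_ge0 C.
  by rewrite !expr2; lra.
have X5 : \sum_a w a * q a >= L - n%:R * C.
  apply: (@le_trans _ _ (\sum_a (lam a - C))).
    rewrite sumrB sumr_const card_ord mulr_natl lerB// (bigD1 o)//= lerDl.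
    by apply: sumr_ge0 => a _; rewrite ltW.
  apply: ler_sum => a _; have := ler_wpM2l (ltW (w0 a)) (H7 a); apply: le_trans.
  by rewrite le_eqVlt; apply/orP; left; apply/eqP; rewrite /w; field; rewrite gt_eqF.
have X6 : - (6 * C ^+ 2) * Tr - cb * (Tr + n%:R * L) - ck * Tr - 2 * tau * C ^+ 2 / (eta ^+ 2 * L)
   <= L^-1 * (\sum_a \sum_b T a b ^+ 2 * (w a * w b)) - \sum_a w a * sf a ^+ 2 - 2 * tau * S2.
  apply: (@le_trans _ _ (\sum_a w a * (Bt a - sf a ^+ 2 - 2 * tau * (etaf a / eta) ^+ 2))); last first.
    have -> : \sum_a w a * (Bt a - sf a ^+ 2 - 2 * tau * (etaf a / eta) ^+ 2) =
      \sum_a w a * Bt a - \sum_a w a * sf a ^+ 2 - 2 * tau * S2.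
      by rewrite /S2 mulr_sumr -!sumrB; apply: eq_bigr => a _; ring.
    by move: stepB; lra.
  apply: le_trans (ler_sum _ (fun a _ => stepP a)).
  rewrite !sumrB -!mulr_sumr big_split/= -/Tr.
  have -> : \sum_a 2 * tau * C ^+ 2 / (eta ^+ 2 * L) *+ (a == o) = 2 * tau * C ^+ 2 / (eta ^+ 2 * L).
    rewrite (bigD1 o)//= big1 => [|a ao]; first by rewrite eqxx addr0 mulr1n.
    by rewrite (negbTE ao) mulr0n.
  rewrite lerB// lerB// lerB// ler_wpM2l// lerD2l.
  apply: (@le_trans _ _ (\sum_(a < n) L)); first by apply: ler_sum.
  by rewrite sumr_const card_ord mulr_natl.
have X7 : kappa * (\sum_i G i * phi i) <= kappa * (C * (1 + Tr) * r).
  by rewrite ler_pM2l//; exact: le_trans (ler_norm _) H9.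
have X8 := ler_wpM2l (ltW b0) X5.
have X9 := ler_wpM2l (ltW b0) H6; rewrite -/w in X9.
rewrite ?(mulrBr beta) in X8 X9.
move: X1 X2 X3 X4 X6 X7 X8 X9; set S1 := \sum_a w a * W a; set Sq := \sum_a w a * q a.
set Sn := \sum_a w a * nn a; set Sf := \sum_a w a * etaff a; set Ss := \sum_i G i * s i.
set Se := \sum_i G i * etad i; set Sm := \sum_i G i * m i; set Sp := \sum_i G i * phi i.
set ST := \sum_a \sum_b _; set S3 := \sum_a w a * sf a ^+ 2.
move: (te * Sf) (te * Se) (L^-1 * S1) (L^-1 * ST) (kappa * Sp) (beta * Sq) (beta * Sn) (beta * Sm) => z1 z2 z3 z4 z5 z6 z7 z8.
move: (kappa * (C * (1 + Tr) * r)) (2 * tau * C ^+ 2 / (eta ^+ 2 * L)) => z9 z10.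
move: (cb * (Tr + n%:R * L)) (ck * Tr) => z11 z12.
by lra.
Qed.

(** Here kappa / 4 is the sum of all constants multiplying Tr, with a 1 for [cb * Tr]; the errors
    from [ck] and from r take a quarter of kappa each. Of beta, 2 C absorbs the multiple of L on the
    right and a further 1 absorbs [cb * (n%:R * L)], so that one L remains. Multiplying by eta^2
    removes the poles tau / eta and 1 / (eta^2 L). *)
Lemma pogorelov_bound :
  12 * beta ^+ 2 * C ^+ 2 * n%:R <= tau -> (0 < n)%N -> beta = 2 * C + 2 ->
  kappa = 4 * (2 * C + 6 * C ^+ 2 + C * tau + tau * C ^+ 2 + 1 + beta * C) ->
  C * r <= 1 / 4 -> 24 * kappa * r ^+ 2 <= tau ->
  eta ^+ 2 * L <= 2 * C + kappa + beta * (n%:R * C) + beta * C + C * tau + 2 * tau * C ^+ 2.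
Proof.
move=> tb n0 bE kE Cr kr.
have C0 : 0 <= C by exact: le_trans C1.
have n1 : 1 <= n%:R :> R by rewrite ler1n.
have cb1 : cb * n%:R <= 1 by rewrite /cb mulrAC ler_pdivrMr// mul1r.
have cb2 : cb <= 1 by apply: le_trans cb1; rewrite ler_peMr.
have ck1 : ck <= kappa / 4.
  rewrite /ck ler_pdivrMr//; have := ler_wpM2l (ltW k0) kr; rewrite !expr2; lra.
have I := pogorelov_inequality.
have J1 : cb * (Tr + n%:R * L) <= Tr + L.
  rewrite mulrDr mulrA lerD//; [by rewrite ler_piMl|by rewrite ler_piMl// ltW].
have J2 : ck * Tr <= kappa / 4 * Tr by rewrite ler_wpM2r.
have J3 : kappa * (C * (1 + Tr) * r) <= kappa / 4 * (1 + Tr).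
  have -> : kappa * (C * (1 + Tr) * r) = kappa * (1 + Tr) * (C * r) by ring.
  have := ler_wpM2l (mulr_ge0 (ltW k0) (addr_ge0 (@ler01 R) Tr0)) Cr; lra.
have M : L <= 2 * C + kappa + beta * (n%:R * C) + beta * C + C * (tau / eta) +
    2 * tau * C ^+ 2 / (eta ^+ 2 * L).
  move: I J1 J2 J3; rewrite {1}bE.
  move: (2 * tau * C ^+ 2 / (eta ^+ 2 * L)) (cb * (Tr + n%:R * L)) (ck * Tr) => z1 z2 z3.
  move: (kappa * (C * (1 + Tr) * r)) (C * (tau / eta)) => z4 z5.
  have kT : kappa * Tr = 4 * (2 * C * Tr + 6 * C ^+ 2 * Tr + C * tau * Tr + tau * C ^+ 2 * Tr + Tr + beta * C * Tr).
    by rewrite kE; ring.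
  rewrite !mulrDr !mulr1 mulrA; set b1 := beta * (n%:R * C).
  by move: kT (ltW k0) (mulr_ge0 (ltW k0) Tr0); lra.
have e2 : 0 < eta ^+ 2 by rewrite exprn_gt0.
have e1 : eta ^+ 2 <= 1 by rewrite expr_le1// ltW.
have bC : 0 <= beta * C by rewrite mulr_ge0// ltW.
have bn : 0 <= beta * (n%:R * C) by rewrite !mulr_ge0// ltW.
have tC : 0 <= C * tau by rewrite mulr_ge0// ltW.
have tC2 : 0 <= 2 * tau * C ^+ 2 by rewrite !mulr_ge0 ?sqr_ge0// ltW.
have N1 := ler_wpM2l (ltW e2) M.
rewrite !(mulrDr (eta ^+ 2)) in N1.
have N2 : eta ^+ 2 * (C * (tau / eta)) <= C * tau.
  have -> : eta ^+ 2 * (C * (tau / eta)) = eta * (C * tau) by field; rewrite gt_eqF.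
  by rewrite ler_piMl.
have N3 : eta ^+ 2 * (2 * tau * C ^+ 2 / (eta ^+ 2 * L)) <= 2 * tau * C ^+ 2.
  have -> : eta ^+ 2 * (2 * tau * C ^+ 2 / (eta ^+ 2 * L)) = 2 * tau * C ^+ 2 / L.
    by field; rewrite !gt_eqF.
  by rewrite ler_pdivrMr// ler_peMr.
have N4 : eta ^+ 2 * (2 * C) <= 2 * C by rewrite ler_piMl// mulr_ge0.
have N5 : eta ^+ 2 * kappa <= kappa by rewrite ler_piMl// ltW.
have N6 : eta ^+ 2 * (beta * (n%:R * C)) <= beta * (n%:R * C) by rewrite ler_piMl.
have N7 : eta ^+ 2 * (beta * C) <= beta * C by rewrite ler_piMl.
by lra.
Qed.

End Algebra.

(** * Functions of the one-jet of u along lines *)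

Section JetSpace.
Context {R : realType} {n : nat}.
Local Notation V := 'rV[R]_n.
Local Notation X := (V * R * V)%type.
Local Notation K := ('I_n + unit + 'I_n)%type.

Definition unitv (i : 'I_n) : V := delta_mx 0 i.

(* Second derivatives on the jet set are only taken along these vectors:
   linearity of 'D_v ('D_w F) in w would require the jet set to be open, which
   is not proved. *)
Definition bas (k : K) : X :=
  match k with
  | inl (inl i) => (unitv i, 0, 0)
  | inl (inr _) => (0, 1, 0)
  | inr i => (0, 0, unitv i)
  end.

Definition co (q : X) (k : K) : R :=
  match k with
  | inl (inl i) => q.1.1 0 i
  | inl (inr _) => q.1.2
  | inr i => q.2 0 i
  end.

Lemma sum_unitv (x : V) : \sum_i x 0 i *: unitv i = x.
Proof. by rewrite [RHS]row_sum_delta. Qed.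

Lemma sum_K (W : nmodType) (F : K -> W) :
  \sum_k F k = \sum_i F (inl (inl i)) + F (inl (inr tt)) + \sum_i F (inr i).
Proof.
rewrite big_sumType/= big_sumType/=; congr (_ + _ + _).
by rewrite (bigD1 tt)//= big1 ?addr0// => -[].
Qed.

Lemma sum_pair3 (I : Type) (s : seq I) (f : I -> V) (g : I -> R) (h : I -> V) :
  \sum_(i <- s) ((f i, g i, h i) : X) =
  (\sum_(i <- s) f i, \sum_(i <- s) g i, \sum_(i <- s) h i).
Proof.
elim: s => [|i s IH]; first by rewrite !big_nil.
by rewrite !big_cons IH.
Qed.

Lemma scale3 (a : R) (x : V) (v : R) (p : V) :
  a *: ((x, v, p) : X) = (a *: x, a * v, a *: p).
Proof. by []. Qed.

Lemma sum_bas_p (zeta : V) : \sum_k zeta 0 k *: bas (inr k) = (0, 0, zeta) :> X.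
Proof.
rewrite -{2}(sum_unitv zeta) /=.
under eq_bigr do rewrite scale3 scaler0 mulr0.
by rewrite sum_pair3 !big1_eq.
Qed.

Lemma co_bas (q : X) : \sum_k co q k *: bas k = q.
Proof.
rewrite sum_K sum_bas_p /=.
have -> : \sum_i q.1.1 0 i *: ((unitv i, 0, 0) : X) = (q.1.1, 0, 0).
  rewrite -{2}(sum_unitv q.1.1).
  under eq_bigr do rewrite scale3 scaler0 mulr0.
  by rewrite sum_pair3 big1_eq big1_eq.
case: q => [[x u] p] /=; rewrite scale3 !scaler0 mulr1.
by apply/eqP; rewrite /eq_op/= /eq_op/= !addr0 !add0r !eqxx.
Qed.

Lemma derive_fiber (W : normedModType R) (F : X -> W) x u v :
  'D_v (fun p : V => F (x, u, p)) = (fun p => 'D_((0, 0, v) : X) F (x, u, p)).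
Proof.
apply/funext => p.
have E : (fun h : R => h^-1 *: (((fun p : V => F (x, u, p)) \o shift p) (h *: v) - F (x, u, p))) =
    (fun h => h^-1 *: ((F \o shift ((x, u, p) : X)) (h *: ((0, 0, v) : X)) - F (x, u, p))).
  apply/funext => h /=; do 3 f_equal.
  by rewrite scale3 scaler0 mulr0; apply/eqP; rewrite /eq_op/= /eq_op/= !add0r !eqxx.
by rewrite /derive E.
Qed.

Context (Om : set V) (u : V -> R) (U : set X).
Context (oOm : open Om) (cu : class_C 3 Om u) (JU : forall y, Om y -> U (jet u y)).

(** The coordinates, in the vectors [bas], of the velocity at t = 0 of the jet along x + t e; [jc2]
    is its acceleration, where third derivatives of u appear only in the p-coordinates. *)
Definition jc1 (x e : V) (k : K) : R :=
  match k with
  | inl (inl i) => e 0 i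
  | inl (inr _) => 'D_e u x
  | inr i => 'D_e ('D_(unitv i) u) x
  end.

Definition jc2 (x e : V) (k : K) : R :=
  match k with
  | inl (inl i) => 0
  | inl (inr _) => 'D_e ('D_e u) x
  | inr i => 'D_e ('D_e ('D_(unitv i) u)) x
  end.

Lemma jet2_line_on (f : V -> R) (x e : V) : class_C 2 Om f -> Om x ->
  jet2 (fun t => f (x + t *: e)) (f x) ('D_e f x) ('D_e ('D_e f) x).
Proof.
move=> [df ddf] Omx; apply: jet2_line; last by have [+ _] := ddf e; exact.
have N : nbhs x Om by exact: open_nbhs_nbhs.
by apply: filterS N => y; exact: df.
Qed.

Lemma near_line (x e : V) : Om x -> \forall t \near (0 : R), Om (x + t *: e).
Proof.
move=> Omx; have c0 : (fun t : R => x + t *: e) @ (0 : R) --> x + 0 *: e.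
  by apply: cvgD; [exact: cvg_cst|apply: cvgZr_tmp; exact: cvg_id].
rewrite scale0r addr0 in c0.
by apply: (c0 Om); exact: open_nbhs_nbhs.
Qed.

Definition chain1 (F : X -> R) (x e : V) : R :=
  \sum_k jc1 x e k * 'D_(bas k) F (jet u x).

Definition chain2 (F : X -> R) (x e : V) : R :=
  \sum_k \sum_l jc1 x e k * jc1 x e l * 'D_(bas l) ('D_(bas k) F) (jet u x)
  + \sum_k jc2 x e k * 'D_(bas k) F (jet u x).

(** F is differentiated only at jets of u, and these lie in U as long as x + t e stays in Om. *)
Lemma jet2_jet (F : X -> R) (x e : V) : class_C 2 U F -> Om x ->
  jet2 (fun t => F (jet u (x + t *: e))) (F (jet u x)) (chain1 F x e) (chain2 F x e).
Proof.
move=> [dF ddF] Omx.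
pose c k t := co (jet u (x + t *: e)) k.
have jc k : jet2 (c k) (co (jet u x) k) (jc1 x e k) (jc2 x e k).
  rewrite /c; case: k => [[i|[]]|i] /=.
  - under eq_fun do rewrite !mxE.
    have := jet2D (jet2_cst (x 0 i)) (jet2M (@jet2_id R) (jet2_cst (e 0 i))).
    by move/jet2_val; apply; ring.
  - by apply: jet2_line_on => //; exact: class_CW.
  - under eq_fun do rewrite mxE; rewrite mxE.
    exact: (jet2_line_on e (cu.2 (unitv i)) Omx).
have H := @jet2_chain R X _ bas c _ _ _ F _ (co_bas (jet u x)) jc.
have E : (fun t => F (\sum_k c k t *: bas k)) = (fun t => F (jet u (x + t *: e))).
  by apply/funext => t; rewrite co_bas.
rewrite E in H; apply: H.
- have := near_line e Omx; apply: filterS => t Omt.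
  by rewrite co_bas; exact/dF/JU.
- by move=> k; have [+ _] := ddF (bas k); apply; exact: JU.
Qed.

End JetSpace.

(** * Consequences of regularity *)

Section RegularLower.
Context {R : realType} {n : nat}.
Local Notation V := 'rV[R]_n.
Local Notation X := (V * R * V)%type.

Lemma exchange4 (F : 'I_n -> 'I_n -> 'I_n -> 'I_n -> R) :
  \sum_i \sum_j \sum_k \sum_l F i j k l = \sum_k \sum_l \sum_i \sum_j F i j k l.
Proof.
under eq_bigr do rewrite exchange_big.
rewrite exchange_big; apply: eq_bigr => k _.
by under eq_bigr do rewrite exchange_big; rewrite exchange_big.
Qed.

Lemma sum_norm_le (I : finType) (f : I -> R) (c : R) :
  (forall i, `|f i| <= c) -> `|\sum_i f i| <= #|I|%:R * c.
Proof.
move=> fc; apply: le_trans (ler_norm_sum _ _ _) _.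
apply: (@le_trans _ _ (\sum_(i : I) c)); first by apply: ler_sum.
by rewrite sumr_const mulr_natl.
Qed.

Lemma sum_norm_ord (f : 'I_n -> R) (c : R) :
  (forall i, `|f i| <= c) -> `|\sum_i f i| <= n%:R * c.
Proof. by move/sum_norm_le; rewrite card_ord. Qed.

Lemma qform_norm_le (H : 'M[R]_n) (c : R) (x y : V) : (forall k l, `|H k l| <= c) ->
  `|qform H x y| <= n%:R ^+ 2 * c * `|x| * `|y|.
Proof.
move=> Hc; rewrite expr2 -!mulrA.
apply: sum_norm_ord => k; apply: sum_norm_ord => l.
rewrite !normrM -mulrA; apply: ler_pM => //.
by apply: ler_pM => //; exact: rV_coord_le.
Qed.

Lemma dot_norm_le (x y : V) : `|dot x y| <= n%:R * (`|x| * `|y|).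
Proof.
by apply: sum_norm_ord => k; rewrite normrM; apply: ler_pM => //; exact: rV_coord_le.
Qed.

Lemma unit_norm_le (x : V) : dot x x = 1 -> `|x| <= 1.
Proof. by move=> x1; apply: rV_norm_le => // i; exact: unit_coord_le. Qed.

(* Regularity says nothing along xi; splitting off that component of zeta costs
   one factor dot zeta xi. *)
Lemma regular_lower (H : 'M[R]_n) (c : R) (xi zeta : V) :
  (forall k l, `|H k l| <= c) -> dot xi xi = 1 ->
  (forall eta, dot xi eta = 0 -> 0 <= qform H eta eta) ->
  - (n%:R ^+ 2 * (n%:R + 2) * c * `|zeta| * `|dot zeta xi|) <= qform H zeta zeta.
Proof.
move=> Hc xi1 Hpos; set d := dot zeta xi.
(* A negative bound on absolute values excludes every index, so all vectors vanish. *)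
case: (ltrP c 0) => [c0|c0].
  have nz (x : V) : x = 0.
    by apply/rowP => k; have := le_lt_trans (Hc k k) c0; rewrite normr_lt0.
  have q0 : qform H 0 0 = 0 by rewrite -{1}(scale0r (0 : V)) qformZl mul0r.
  by rewrite (nz zeta) q0 normr0 mulr0 mul0r oppr0.
pose z' := zeta - d *: xi.
have zE : zeta = z' + d *: xi by rewrite subrK.
have oz : dot xi z' = 0.
  by rewrite /z' dotDr -scaleNr dotZr xi1 /d (dotC xi) mulr1 subrr.
have dle : `|d| <= n%:R * `|zeta|.
  apply: le_trans (dot_norm_le _ _) _; rewrite ler_wpM2l//.
  by rewrite ler_piMr// unit_norm_le.
have z'le : `|z'| <= (1 + n%:R) * `|zeta|.
  rewrite mulrDl mul1r; apply: le_trans (ler_normB _ _) _; rewrite lerD2l normrZ.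
  by apply: le_trans dle; rewrite ler_piMr// unit_norm_le.
have E : qform H zeta zeta = qform H z' z' + d * (qform H xi zeta + qform H z' xi).
  rewrite {1}zE !(qformDl, qformZl) (zE) !(qformDr, qformZr) -zE; ring.
have B : `|qform H xi zeta + qform H z' xi| <= n%:R ^+ 2 * (n%:R + 2) * c * `|zeta|.
  apply: le_trans (ler_normD _ _) _.
  have B1 := @qform_norm_le H c xi zeta Hc.
  have B2 := @qform_norm_le H c z' xi Hc.
  have nc : 0 <= n%:R ^+ 2 * c by rewrite mulr_ge0// sqr_ge0.
  have B3 : n%:R ^+ 2 * c * `|xi| * `|zeta| <= n%:R ^+ 2 * c * `|zeta|.
    by rewrite ler_wpM2r// ler_piMr// unit_norm_le.
  have B4 : n%:R ^+ 2 * c * `|z'| * `|xi| <= n%:R ^+ 2 * c * ((1 + n%:R) * `|zeta|).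
    apply: (@le_trans _ _ (n%:R ^+ 2 * c * `|z'|)); last by rewrite ler_wpM2l.
    by rewrite ler_piMr ?unit_norm_le// mulr_ge0.
  by lra.
have P := Hpos z' oz.
have Q : - (`|d| * `|qform H xi zeta + qform H z' xi|) <= d * (qform H xi zeta + qform H z' xi).
  by rewrite -normrM lerNl -normrN ler_norm.
have Q2 : `|d| * `|qform H xi zeta + qform H z' xi| <= `|d| * (n%:R ^+ 2 * (n%:R + 2) * c * `|zeta|).
  by rewrite ler_wpM2l.
by rewrite E mulrC; lra.
Qed.

Context (A : X -> 'M[R]_n) (U : set X).
Context (cA : forall i j, class_C 2 U (fun q => A q i j)).
Context (rA : regular U A).

Definition D2p (xi : V) (q : X) : 'M[R]_n :=
  \matrix_(k, l) \sum_i \sum_j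
    'D_(bas (inr k)) ('D_(bas (inr l)) (fun q => A q i j)) q * xi 0 i * xi 0 j.

Lemma D2p_bound (xi : V) q (c : R) : dot xi xi = 1 ->
  (forall i j k l, `|'D_(bas (inr k)) ('D_(bas (inr l)) (fun q => A q i j)) q| <= c) ->
  forall k l, `|D2p xi q k l| <= n%:R ^+ 2 * c.
Proof.
move=> xi1 Dc k l; rewrite mxE expr2 -mulrA.
apply: sum_norm_ord => i; apply: sum_norm_ord => j.
rewrite !normrM -mulrA; have := ler_pM (normr_ge0 _) _ (Dc i j k l).
move=> /(_ (`|xi 0 i| * `|xi 0 j|) 1); rewrite mulr1; apply; first by rewrite mulr_ge0.
by rewrite -[leRHS]mulr1; apply: ler_pM => //; exact: unit_coord_le.
Qed.

Lemma D2p_ge0 (xi eta : V) q : U q -> dot xi eta = 0 -> 0 <= qform (D2p xi q) eta eta.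
Proof.
case: q => [[x u] p] Uq o; have := rA Uq o.
set S := (X in 0 <= X -> _); suff -> : S = qform (D2p xi (x, u, p)) eta eta by [].
rewrite /S /qform.
transitivity (\sum_i \sum_j \sum_k \sum_l ('D_(bas (inr k)) ('D_(bas (inr l)) (fun q => A q i j)) (x, u, p)
   * xi 0 i * xi 0 j * eta 0 k * eta 0 l)).
  apply: eq_bigr => i _; apply: eq_bigr => j _; apply: eq_bigr => k _; apply: eq_bigr => l _.
  rewrite (@derive_fiber R n _ (fun q => A q i j)).
  exact: (congr1 (fun h => h p * xi 0 i * xi 0 j * eta 0 k * eta 0 l)
    (derive_fiber ('D_(bas (inr l)) (fun q => A q i j)) x u (unitv k))).
rewrite exchange4; apply: eq_bigr => k _; apply: eq_bigr => l _.
by rewrite mxE !mulr_suml; apply: eq_bigr => i _; rewrite !mulr_suml.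
Qed.


Lemma taylor_lower (psi psi1 psi2 : R -> R) (c : R) : 0 <= c ->
  (forall t : R, 0 <= t <= 1 -> is_derive t (1 : R) psi (psi1 t)) ->
  (forall t : R, 0 <= t <= 1 -> is_derive t (1 : R) psi1 (psi2 t)) ->
  (forall t : R, 0 <= t <= 1 -> - c <= psi2 t) ->
  - c <= psi 1 - psi 0 - psi1 0.
Proof.
move=> c0 d1 d2 lb.
have cont (f f' : R -> R) (a : R) : 0 <= a <= 1 ->
    (forall t : R, 0 <= t <= 1 -> is_derive t (1 : R) f (f' t)) ->
    {within `[0, a], continuous f}.
  move=> /andP[a0 a1] df; apply: continuous_in_subspaceT => t.
  rewrite inE/= in_itv/= => /andP[t0 ta].
  apply/differentiable_continuous/derivable1_diffP.
  by have [|//] := df t; rewrite t0 (le_trans ta).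
have [||a a01 E1] := @MVT R psi psi1 0 1 ltr01.
- by move=> t; rewrite in_itv/= => /andP[t0 t1]; apply: d1; rewrite !ltW.
- by apply: cont d1; rewrite ler01 lexx.
move: a01; rewrite in_itv/= => /andP[a0 a1].
have [||b b01 E2] := @MVT R psi1 psi2 0 a a0.
- move=> t; rewrite in_itv/= => /andP[t0 ta]; apply: d2.
  by rewrite !ltW// (lt_trans ta).
- by apply: cont d2; rewrite !ltW.
move: b01; rewrite in_itv/= => /andP[b0 ba].
rewrite E1 subr0 mulr1 E2 subr0.
have b01 : 0 <= b <= 1 by rewrite ltW//= ltW// (lt_trans ba).
have := ler_wpM2r (ltW a0) (lb b b01); apply: le_trans.
by rewrite mulNr lerN2 ler_piMr// ltW.
Qed.

(** A substitute for convexity of p |-> A xi . xi. The second derivative along the segment is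
    bounded below by [regular_lower], and the defect is proportional to the component of p' - p
    along xi. *)
Lemma regular_taylor (xi : V) x u p p' (c : R) : dot xi xi = 1 -> 0 <= c ->
  (forall t : R, 0 <= t <= 1 -> U (x, u, p + t *: (p' - p))) ->
  (forall t : R, 0 <= t <= 1 -> forall i j k l,
    `|'D_(bas (inr k)) ('D_(bas (inr l)) (fun q => A q i j)) (x, u, p + t *: (p' - p))| <= c) ->
  - (n%:R ^+ 2 * (n%:R + 2) * (n%:R ^+ 2 * c) * `|p' - p| * `|dot (p' - p) xi|) <=
  qform (A (x, u, p')) xi xi - qform (A (x, u, p)) xi xi
   - \sum_k (p' - p) 0 k * \sum_i \sum_j
      'D_(bas (inr k)) (fun q => A q i j) (x, u, p) * xi 0 i * xi 0 j.
Proof.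
move=> xi1 c0 seg Dc; set zeta := p' - p.
pose d : X := (0, 0, zeta).
pose q0 : X := (x, u, p).
have qE t : q0 + t *: d = (x, u, p + t *: zeta).
  rewrite /q0 /d scale3 scaler0 mulr0.
  by apply/eqP; rewrite /eq_op/= /eq_op/= !addr0 !eqxx.
pose psi t := \sum_i \sum_j A (q0 + t *: d) i j * (xi 0 i * xi 0 j).
pose psi1 t := \sum_i \sum_j (\sum_k zeta 0 k * 'D_(bas (inr k)) (fun q => A q i j) (q0 + t *: d)) * (xi 0 i * xi 0 j).
pose psi2 t := \sum_i \sum_j (\sum_k zeta 0 k * (\sum_l zeta 0 l * 'D_(bas (inr l)) ('D_(bas (inr k)) (fun q => A q i j)) (q0 + t *: d))) * (xi 0 i * xi 0 j).
have Ut t : 0 <= t <= 1 -> U (q0 + t *: d) by move=> t01; rewrite qE; exact: seg.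
have dir (F : X -> R) q : differentiable F q -> 'D_d F q = \sum_k zeta 0 k * 'D_(bas (inr k)) F q.
  by move=> dF; rewrite /d -sum_bas_p derive_comb.
have E0 q : \sum_i \sum_j A q i j * (xi 0 i * xi 0 j) = qform (A q) xi xi.
  by apply: eq_bigr => i _; apply: eq_bigr => j _; rewrite mulrA.
have -> : qform (A (x, u, p')) xi xi = psi 1.
  by rewrite /psi E0 qE scale1r /zeta addrC subrK.
have -> : qform (A (x, u, p)) xi xi = psi 0 by rewrite /psi E0 scale0r addr0.
have -> : \sum_k zeta 0 k * \sum_i \sum_j
      'D_(bas (inr k)) (fun q => A q i j) (x, u, p) * xi 0 i * xi 0 j = psi1 0.
  rewrite /psi1 scale0r addr0.
  under eq_bigr do rewrite mulr_sumr.
  rewrite exchange_big; apply: eq_bigr => i _.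
  under eq_bigr do rewrite mulr_sumr.
  rewrite exchange_big; apply: eq_bigr => j _.
  by rewrite mulr_suml; apply: eq_bigr => k _; rewrite !mulrA.
apply: (@taylor_lower psi psi1 psi2).
- by rewrite !mulr_ge0 ?sqr_ge0// addr_ge0.
- move=> t t01; apply: is_derive_bigsum => i; apply: is_derive_bigsum => j.
  have dA := (cA i j).1 _ (Ut t t01).
  have D : is_derive t (1 : R) (fun t => A (q0 + t *: d) i j)
      (\sum_k zeta 0 k * 'D_(bas (inr k)) (fun q => A q i j) (q0 + t *: d)).
    rewrite -(dir _ _ dA); apply: (@is_derive_line _ _ _ (fun q => A q i j)).
    exact/derivableP/diff_derivable.
  have := is_deriveM D (is_derive_cst (xi 0 i * xi 0 j) t (1 : R)).
  by move=> h; apply: is_derive_eq h _; rewrite scaler0 add0r /GRing.scale/= mulrC.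
- move=> t t01; apply: is_derive_bigsum => i; apply: is_derive_bigsum => j.
  have D : is_derive t (1 : R) (fun t => \sum_k zeta 0 k * 'D_(bas (inr k)) (fun q => A q i j) (q0 + t *: d))
     (\sum_k zeta 0 k * (\sum_l zeta 0 l * 'D_(bas (inr l)) ('D_(bas (inr k)) (fun q => A q i j)) (q0 + t *: d))).
    apply: is_derive_bigsum => k.
    have dA := ((cA i j).2 (bas (inr k))).1 _ (Ut t t01).
    rewrite -(dir _ _ dA); apply: is_deriveZ.
    apply: (@is_derive_line _ _ _ ('D_(bas (inr k)) (fun q => A q i j))).
    exact/derivableP/diff_derivable.
  have := is_deriveM D (is_derive_cst (xi 0 i * xi 0 j) t (1 : R)).
  by move=> h; apply: is_derive_eq h _; rewrite scaler0 add0r /GRing.scale/= mulrC.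
- move=> t t01; have Dt := Dc t t01.
  have Bd := D2p_bound xi1 Dt.
  have := regular_lower zeta Bd xi1 (fun eta => @D2p_ge0 xi eta _ (seg t t01)).
  move=> /le_trans; apply; rewrite le_eqVlt; apply/orP; left; apply/eqP.
  rewrite /psi2 qE /qform.
  under [RHS]eq_bigr do under eq_bigr do rewrite mulr_suml.
  under [RHS]eq_bigr do under eq_bigr do under eq_bigr do rewrite mulr_sumr mulr_suml.
  rewrite -exchange4 exchange_big/=; apply: eq_bigr => k _; apply: eq_bigr => l _.
  rewrite mxE !mulr_suml; apply: eq_bigr => i _; rewrite !mulr_suml; apply: eq_bigr => j _.
  ring.
Qed.

End RegularLower.

Local Opaque derive.

(** * The estimate at a maximum point *)

Section Commutation.
Context {R : realType} {n : nat}.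
Local Notation V := 'rV[R]_n.
Context (Om : set V) (oOm : open Om).

Lemma derive_eq_on (f g : V -> R) (v x : V) : (forall y, Om y -> f y = g y) -> Om x ->
  'D_v f x = 'D_v g x.
Proof.
move=> fg Omx.
have N : \forall y \near x, f y = g y.
  have N' : nbhs x Om by exact: open_nbhs_nbhs.
  by apply: filterS N' => y; exact: fg.
case: (pselect (v = 0)) => [->|v0]; first by rewrite !derive0.
by apply: near_eq_derive.
Qed.

Lemma derive3C (f : V -> R) (v w z x : V) : class_C 3 Om f -> Om x ->
  'D_v ('D_w ('D_z f)) x = 'D_w ('D_v ('D_z f)) x.
Proof. by move=> cf Omx; exact: (schwarz _ _ oOm (cf.2 z) Omx). Qed.

Lemma derive3Cr (f : V -> R) (v w z x : V) : class_C 2 Om f -> Om x ->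
  'D_v ('D_w ('D_z f)) x = 'D_v ('D_z ('D_w f)) x.
Proof.
move=> cf Omx; apply: (derive_eq_on _ _ Omx) => y Omy.
exact: (schwarz _ _ oOm cf Omy).
Qed.

Lemma derive3_rot (f : V -> R) (v z x : V) : class_C 3 Om f -> Om x ->
  'D_v ('D_v ('D_z f)) x = 'D_z ('D_v ('D_v f)) x.
Proof.
move=> cf Omx; 
exact: (etrans (derive3Cr v v z (class_CW cf) Omx) (derive3C v z v cf Omx)).
Qed.

Lemma derive4C (f : V -> R) (v w x : V) : class_C 4 Om f -> Om x ->
  'D_v ('D_v ('D_w ('D_w f))) x = 'D_w ('D_w ('D_v ('D_v f))) x.
Proof.
move=> cf Omx.
apply: etrans (derive3_rot v w (cf.2 w) Omx) _.
apply: (derive_eq_on _ _ Omx) => y Omy.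
exact: (derive3_rot v w (class_CW cf) Omy).
Qed.

Lemma hess_qform (f : V -> R) (v w x : V) : class_C 2 Om f -> Om x ->
  qform (hess f x) v w = 'D_v ('D_w f) x.
Proof.
move=> cf Omx; rewrite -{2}(sum_unitv w) (derive2_comb _ _ _ v oOm cf Omx).
rewrite /qform exchange_big; apply: eq_bigr => j _.
rewrite -(sum_unitv v) derive_comb; last by have [+ _] := cf.2 (unitv j); apply.
rewrite mulr_sumr; apply: eq_bigr => i _; rewrite mxE sum_unitv.
set d := 'D__ _ _; ring.
Qed.

End Commutation.

Section MaxPoint.
Context {R : realType} {n : nat}.
Local Notation V := 'rV[R]_n.
Local Notation X := (V * R * V)%type.
Context (Om : set V) (u : V -> R) (U : set X) (A : X -> 'M[R]_n) (B : X -> R).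
Context (oOm : open Om) (cu : class_C 4 Om u).
Context (JU : forall y, Om y -> U (jet u y)).
Context (cA : forall i j, class_C 2 U (fun q => A q i j)).
Context (sA : forall q, U q -> mxsymmetric (A q)).
Context (rA : regular U A) (cB : class_C 2 U B).
Context (eqn : forall y, Om y -> \det (hess u y - A (jet u y)) = B (jet u y)).

Let cu3 : class_C 3 Om u := class_CW cu.
Let cu2 : class_C 2 Om u := class_CW cu3.

Definition augm (y : V) : 'M[R]_n := hess u y - A (jet u y).

(** First and second derivatives along e of A(., u, Du) and of w, evaluated on the pair (v, w). In
    [W1] and [W2] the derivatives of u are kept as iterated directional ones, so that they can be
    permuted. *)
Definition A1 (v w x e : V) : R :=
  qform (\matrix_(i, j) chain1 u (fun q => A q i j) x e) v w.
Definition A2 (v w x e : V) : R :=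
  qform (\matrix_(i, j) chain2 u (fun q => A q i j) x e) v w.
Definition W1 (v w x e : V) : R := 'D_e ('D_v ('D_w u)) x - A1 v w x e.
Definition W2 (v w x e : V) : R := 'D_e ('D_e ('D_v ('D_w u))) x - A2 v w x e.

Lemma qform_augm (v w y : V) : Om y ->
  qform (augm y) v w = 'D_v ('D_w u) y - qform (A (jet u y)) v w.
Proof.
move=> Omy; rewrite -(hess_qform oOm v w cu2 Omy) /qform -sumrB.
apply: eq_bigr => i _; rewrite -sumrB; apply: eq_bigr => j _.
by rewrite !mxE -mulrBl -mulrBl.
Qed.

Lemma jet2_A (v w x e : V) : Om x ->
  jet2 (fun t => qform (A (jet u (x + t *: e))) v w) (qform (A (jet u x)) v w)
    (A1 v w x e) (A2 v w x e).
Proof.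
move=> Omx; apply: jet2_sum => i; apply: jet2_sum => j.
have := jet2_jet oOm cu3 JU e (cA i j) Omx => jA.
rewrite !mxE.
exact: (jet2Zr (w 0 j) (jet2Zr (v 0 i) jA)).
Qed.

Lemma jet2_augm (v w x e : V) : Om x ->
  jet2 (fun t => qform (augm (x + t *: e)) v w) (qform (augm x) v w)
    (W1 v w x e) (W2 v w x e).
Proof.
move=> Omx; rewrite (qform_augm v w Omx).
have ju := jet2_line_on oOm e ((cu.2 w).2 v) Omx.
apply: jet2_ext (jet2B ju (jet2_A v w e Omx)).
have := near_line oOm e Omx; apply: filterS => t Omt.
by rewrite qform_augm.
Qed.

Lemma A1C (v w x e : V) : Om x -> A1 v w x e = A1 w v x e.
Proof.
move=> Omx; have j1 := jet2_A v w e Omx.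
have j2 := jet2_A w v e Omx.
have j3 : jet2 (fun t => qform (A (jet u (x + t *: e))) v w) (qform (A (jet u x)) w v)
    (A1 w v x e) (A2 w v x e).
  apply: jet2_ext j2; have := near_line oOm e Omx; apply: filterS => t Omt.
  by apply: qformC; exact/sA/JU.
by have [_ -> _] := jet2_unique j1 j3.
Qed.

Lemma W1C (v w x e : V) : Om x -> W1 v w x e = W1 w v x e.
Proof.
move=> Omx; exact: (congr2 (fun a b => a - b) (derive3Cr oOm e v w cu2 Omx) (A1C v w e Omx)).
Qed.

Context (x : V) (Omx : Om x) (e : 'I_n -> V) (lam : 'I_n -> R) (o : 'I_n).
Context (on : forall a b, dot (e a) (e b) = (a == b)%:R).
Context (eig : forall a y, qform (augm x) (e a) y = lam a * dot (e a) y).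
Context (lam0 : forall a, 0 < lam a).
Context (B0 : 0 < B (jet u x)).

(** Conjugating by the orthogonal matrix of the frame leaves the determinant unchanged and makes w
    diagonal at x, the situation of [log_det_jet]. *)
Lemma equation_jet (v : V) :
  \sum_a W1 (e a) (e a) x v / lam a = chain1 u B x v / B (jet u x) /\
  \sum_a W2 (e a) (e a) x v / lam a
   - \sum_a \sum_c W1 (e a) (e c) x v * W1 (e c) (e a) x v / (lam a * lam c) =
  chain2 u B x v / B (jet u x) - (chain1 u B x v / B (jet u x)) ^+ 2.
Proof.
pose M (t : R) : 'M[R]_n := \matrix_(a, c) qform (augm (x + t *: v)) (e a) (e c).
pose E : 'M[R]_n := \matrix_(a, k) e a 0 k.
have EE : E *m E^T = 1%:M.
  apply/matrixP => a b; rewrite !mxE -on; apply: eq_bigr => k _.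
  by rewrite !mxE.
have ME t : M t = E *m augm (x + t *: v) *m E^T.
  apply/matrixP => a c; rewrite !mxE /qform exchange_big; apply: eq_bigr => j _.
  rewrite !mxE mulr_suml; apply: eq_bigr => i _; rewrite !mxE; ring.
have detM t : \det (M t) = \det (augm (x + t *: v)).
  have := congr1 determinant EE; rewrite det_mulmx det1 det_tr => d1.
  by rewrite ME !det_mulmx det_tr mulrC mulrA d1 mul1r.
have := @log_det_jet R n M lam (\matrix_(a, c) W1 (e a) (e c) x v)
  (\matrix_(a, c) W2 (e a) (e c) x v) _ _ _ _ lam0 _
  (jet2_jet oOm cu3 JU v cB Omx) _ B0.
set P := (\sum_a _ = _ /\ _); move=> H.
have {H} : \sum_a (\matrix_(a, c) W1 (e a) (e c) x v) a a / lam a =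
  chain1 u B x v / B (jet u x) /\
  \sum_a (\matrix_(a, c) W2 (e a) (e c) x v) a a / lam a -
  \sum_a \sum_c (\matrix_(a, c) W1 (e a) (e c) x v) a c *
     (\matrix_(a, c) W1 (e a) (e c) x v) c a / (lam a * lam c) =
  chain2 u B x v / B (jet u x) - (chain1 u B x v / B (jet u x)) ^+ 2.
  apply: H.
  - move=> a c; rewrite !mxE.
    under eq_fun do rewrite mxE.
    apply: jet2_val (jet2_augm (e a) (e c) v Omx) _ _ _ => //.
    by rewrite eig on; case: eqP => _; rewrite ?mulr1 ?mulr0.
  - have := near_line oOm v Omx; apply: filterS => t Omt.
    by rewrite detM eqn.
by under eq_bigr do rewrite mxE; under [X in _ /\ X - _ = _ -> _]eq_bigr do rewrite mxE;
  under [X in _ /\ _ - X = _ -> _]eq_bigr do under eq_bigr do rewrite !mxE.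
Qed.

Context (lamL : forall a, lam a <= lam o) (L1 : 1 <= lam o).
Context (D : R) (nD : n%:R + n%:R + 2 <= D).
Local Notation Jx := (jet u x).
Context (bA : forall i j, `|A Jx i j| <= D).
Context (bA1 : forall i j k, `|'D_(bas k) (fun q => A q i j) Jx| <= D).
Context (bA2 : forall i j k l, `|'D_(bas l) ('D_(bas k) (fun q => A q i j)) Jx| <= D).
Context (bB1 : forall k, `|'D_(bas k) B Jx| <= D).
Context (bB2 : forall k l, `|'D_(bas l) ('D_(bas k) B) Jx| <= D).
Context (bBi : (B Jx)^-1 <= D) (bu : forall i, `|'D_(unitv i) u x| <= D).

Let L := lam o.
Let Tr := \sum_a (lam a)^-1.

(* Every constant below is a power of D: as D >= 2 n + 2, summing over indices
   or adding two bounds only raises the exponent. *)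
Let n0R : 0 <= n%:R :> R. Proof. exact: ler0n. Qed.
Let nleD : n%:R <= D. Proof. by move: n0R nD; lra. Qed.
Let n2D : n%:R + 2 <= D. Proof. by move: n0R nD; lra. Qed.
Let D2 : 2 <= D. Proof. by move: n0R nD; lra. Qed.
Let D1 : 1 <= D. Proof. by move: D2; lra. Qed.
Let D0 : 0 <= D. Proof. by move: D2; lra. Qed.
Let Tr0 : 0 <= Tr. Proof. by apply: sumr_ge0 => a _; rewrite invr_ge0 ltW. Qed.
Let l1 a : 0 <= 1 + lam a. Proof. by rewrite addr_ge0// ltW. Qed.
Let L0 : 0 <= 1 + L. Proof. exact: l1. Qed.
Let lL a : 1 + lam a <= 1 + L. Proof. by rewrite lerD2l. Qed.
Let lge1 a : 1 <= 1 + lam a. Proof. by rewrite lerDl ltW. Qed.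
Let Lge1 : 1 <= 1 + L. Proof. exact: lge1. Qed.

Let XD k : 0 <= D ^+ k. Proof. exact: exprn_ge0. Qed.

Let powD (j k : nat) c : (j <= k)%N -> 0 <= c -> D ^+ j * c <= D ^+ k * c.
Proof. by move=> jk c0; rewrite ler_wpM2r// ler_weXn2l. Qed.

Let powD1 (j k : nat) : (j <= k)%N -> D ^+ j <= D ^+ k.
Proof. by move=> jk; rewrite ler_weXn2l. Qed.

Let sumD (f : 'I_n -> R) (c : R) : 0 <= c -> (forall i, `|f i| <= c) -> `|\sum_i f i| <= D * c.
Proof.
by move=> c0 fc; apply: le_trans (sum_norm_ord fc) _; rewrite ler_wpM2r.
Qed.

Let sumKD (f : ('I_n + unit + 'I_n)%type -> R) (c : R) : 0 <= c -> (forall i, `|f i| <= c) ->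
  `|\sum_i f i| <= D * c.
Proof.
move=> c0 fc; apply: le_trans (sum_norm_le fc) _; rewrite ler_wpM2r//.
by rewrite !card_sum !card_ord card_unit !natrD; move: n0R nD; lra.
Qed.

Let mulD (a b c d : R) : `|a| <= c -> `|b| <= d -> `|a * b| <= c * d.
Proof. by move=> h1 h2; rewrite normrM; apply: ler_pM. Qed.

Let addD (a b c d : R) : `|a| <= c -> `|b| <= d -> `|a + b| <= c + d.
Proof. by move=> h1 h2; apply: le_trans (ler_normD _ _) _; exact: lerD. Qed.

Let ul (v : V) := forall i, `|v 0 i| <= 1.

Let ule a : ul (e a).
Proof. by move=> i; apply: unit_coord_le; rewrite on eqxx. Qed.

Let uunit k : ul (unitv k).
Proof. by move=> i; rewrite mxE eqxx; case: eqP => _; rewrite ?normr1 ?normr0. Qed.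

Let qformD (M : 'M[R]_n) (c : R) (v w : V) : 0 <= c -> (forall i j, `|M i j| <= c) -> ul v -> ul w ->
  `|qform M v w| <= D ^+ 2 * c.
Proof.
move=> c0 Mc uv uw; rewrite expr2 -mulrA; apply: sumD; first by rewrite mulr_ge0.
move=> i; apply: sumD => // j; rewrite -[c]mulr1 -[c]mulr1.
by apply: mulD => //; apply: mulD.
Qed.

Let dot_unitv (v : V) k : dot v (unitv k) = v 0 k.
Proof.
rewrite /dot (bigD1 k)//= big1 => [|i ik]; first by rewrite mxE !eqxx mulr1 addr0.
by rewrite mxE eqxx (negbTE ik) mulr0.
Qed.

Let uav a (v : V) : 'D_(e a) ('D_v u) x = lam a * dot (e a) v + qform (A Jx) (e a) v.
Proof. by have := qform_augm (e a) v Omx; rewrite eig => ->; rewrite subrK. Qed.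

Let Aee v w : ul v -> ul w -> `|qform (A Jx) v w| <= D ^+ 3.
Proof. by move=> uv uw; rewrite exprSr; exact: qformD. Qed.

Let uak a k : `|'D_(e a) ('D_(unitv k) u) x| <= D ^+ 3 * (1 + lam a).
Proof.
rewrite uav mulrDr mulr1 addrC; apply: addD; first exact: Aee.
rewrite dot_unitv [leRHS]mulrC; apply: mulD; first by rewrite gtr0_norm.
by apply: le_trans (ule a k) _; exact: exprn_ege1.
Qed.

(** In the frame w has no off-diagonal entry, so only A contributes and the bound does not see the
    eigenvalues. This is what keeps the loss in [QAlow] linear in L. *)
Let uab a c : a != c -> `|'D_(e a) ('D_(e c) u) x| <= D ^+ 3.
Proof. by move=> ac; rewrite uav on (negbTE ac) mulr0 add0r; exact: Aee. Qed.

Let uaa a : `|'D_(e a) ('D_(e a) u) x| <= D ^+ 3 * (1 + lam a).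
Proof.
rewrite uav mulrDr mulr1 addrC on eqxx mulr1; apply: addD; first exact: Aee.
rewrite gtr0_norm// -[leLHS]mul1r ler_wpM2r//; first exact: ltW.
exact: exprn_ege1.
Qed.

Let uik i k : `|'D_(unitv i) ('D_(unitv k) u) x| <= D ^+ 4 * (1 + L).
Proof.
rewrite (frame_expand (unitv i) on) derive_comb; last exact: (cu.2 (unitv k)).1.
rewrite exprS -mulrA; apply: sumD; first by rewrite mulr_ge0.
move=> a; rewrite -[leRHS]mul1r; apply: mulD; first by rewrite dotC dot_unitv; exact: ule.
by apply: le_trans (uak a k) _; rewrite ler_wpM2l.
Qed.

Let uv (v : V) : ul v -> `|'D_v u x| <= D ^+ 2.
Proof.
move=> hv; rewrite -(sum_unitv v) derive_comb; last exact: cu.1.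
rewrite expr2; apply: sumD => // i.
by rewrite -[leRHS]mul1r; apply: mulD.
Qed.

Let jce a k : `|jc1 u x (e a) k| <= D ^+ 3 * (1 + lam a).
Proof.
case: k => [[i|[]]|k] /=; last exact: uak.
- apply: le_trans (ule a i) _; rewrite -[leLHS]mulr1; apply: ler_pM => //.
  exact: exprn_ege1.
- apply: le_trans (uv (ule a)) _; rewrite -[leLHS]mulr1; apply: ler_pM => //.
  exact: powD1.
Qed.

Let jcu i k : `|jc1 u x (unitv i) k| <= D ^+ 4 * (1 + L).
Proof.
case: k => [[j|[]]|k] /=; last exact: uik.
- apply: le_trans (uunit i j) _; rewrite -[leLHS]mulr1; apply: ler_pM => //.
  exact: exprn_ege1.
- apply: le_trans (uv (uunit i)) _; rewrite -[leLHS]mulr1; apply: ler_pM => //.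
  exact: powD1.
Qed.

Let chain1D (F : X -> R) (v : V) c : 0 <= c -> (forall k, `|'D_(bas k) F Jx| <= D) ->
  (forall k, `|jc1 u x v k| <= c) -> `|chain1 u F x v| <= D ^+ 2 * c.
Proof.
move=> c0 bF jv; rewrite expr2 -mulrA; apply: sumKD; first by rewrite mulr_ge0.
by move=> k; rewrite mulrC; apply: mulD.
Qed.

Let A1e v w a : ul v -> ul w -> `|A1 v w x (e a)| <= D ^+ 7 * (1 + lam a).
Proof.
move=> hv hw; rewrite (exprD D 2 5) -mulrA; apply: qformD => //; first by rewrite mulr_ge0.
move=> i j; rewrite mxE (exprD D 2 3) -mulrA; apply: chain1D => //; first by rewrite mulr_ge0.
Qed.

Let A1u v w i : ul v -> ul w -> `|A1 v w x (unitv i)| <= D ^+ 8 * (1 + L).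
Proof.
move=> hv hw; rewrite (exprD D 2 6) -mulrA; apply: qformD => //; first by rewrite mulr_ge0.
move=> j k; rewrite mxE (exprD D 2 4) -mulrA; apply: chain1D => //; first by rewrite mulr_ge0.
Qed.

Let B1e a : `|chain1 u B x (e a)| <= D ^+ 5 * (1 + lam a).
Proof.
rewrite (exprD D 2 3) -mulrA; apply: chain1D => //; first by rewrite mulr_ge0.
Qed.

Let B1u i : `|chain1 u B x (unitv i)| <= D ^+ 6 * (1 + L).
Proof.
rewrite (exprD D 2 4) -mulrA; apply: chain1D => //; first by rewrite mulr_ge0.
Qed.

Let Bi : `|(B Jx)^-1| <= D.
Proof. by rewrite gtr0_norm// invr_gt0. Qed.

(** [P i a] is the p_i-derivative of A_aa and [bb i] that of log B; [G] collects every coefficient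
    through which the differentiated equation is linear in the top derivatives. *)
Let P i a : R := qform (\matrix_(j, k) 'D_(bas (inr i)) (fun q => A q j k) Jx) (e a) (e a).
Let bb i : R := 'D_(bas (inr i)) B Jx / B Jx.
Let G i : R := \sum_a (lam a)^-1 * P i a + bb i.

Let PD i a : `|P i a| <= D ^+ 3.
Proof. by rewrite exprSr; apply: qformD => // j k; rewrite mxE. Qed.

Let bbD i : `|bb i| <= D ^+ 2.
Proof. by rewrite expr2; apply: mulD. Qed.

Let TrD (f : 'I_n -> R) c : 0 <= c -> (forall a, `|f a| <= c) -> `|\sum_a (lam a)^-1 * f a| <= c * Tr.
Proof.
move=> c0 fc; apply: le_trans (ler_norm_sum _ _ _) _; rewrite /Tr mulr_sumr.
apply: ler_sum => a _; rewrite normrM mulrC [X in _ * X]gtr0_norm ?invr_gt0//.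
by apply: ler_wpM2r (fc a); rewrite invr_ge0 ltW.
Qed.

Let GD i : `|G i| <= D ^+ 3 * (1 + Tr).
Proof.
rewrite mulrDr mulr1 addrC; apply: addD; first exact: TrD.
by apply: le_trans (bbD i) _; exact: powD1.
Qed.

Let low1 (F : X -> R) (v : V) : R :=
  \sum_i v 0 i * 'D_(bas (inl (inl i))) F Jx + 'D_v u x * 'D_(bas (inl (inr tt))) F Jx.

Let chain1E (F : X -> R) (v : V) : chain1 u F x v = low1 F v + \sum_i 'D_v ('D_(unitv i) u) x * 'D_(bas (inr i)) F Jx.
Proof. by rewrite /chain1 sum_K. Qed.

Let low1D (F : X -> R) (v : V) : ul v -> (forall k, `|'D_(bas k) F Jx| <= D) -> `|low1 F v| <= D ^+ 4.
Proof.
move=> hv bF; apply: (@le_trans _ _ (D * (1 * D) + D ^+ 2 * D)).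
  apply: addD; last by apply: mulD => //; exact: uv.
  by apply: sumD => // [|i]; [rewrite mul1r|apply: mulD].
rewrite mul1r -expr2 -exprSr [leRHS]exprSr.
apply: (@le_trans _ _ (D ^+ 3 * 2)); last by rewrite ler_wpM2l.
by have := @powD1 2 3 isT; lra.
Qed.

Let lowA a (v : V) : R := qform (\matrix_(i, j) low1 (fun q => A q i j) v) (e a) (e a).

Let qform_sum (I : finType) (M : I -> 'M[R]_n) (c : I -> R) v w :
  qform (\matrix_(i, j) \sum_k c k * M k i j) v w = \sum_k c k * qform (M k) v w.
Proof.
under [RHS]eq_bigr do rewrite mulr_sumr.
rewrite exchange_big; apply: eq_bigr => i _.
under [RHS]eq_bigr do rewrite mulr_sumr.
rewrite exchange_big; apply: eq_bigr => j _.
rewrite mxE !mulr_suml; apply: eq_bigr => k _; ring.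
Qed.

Let qform_add (M N : 'M[R]_n) v w : qform (M + N) v w = qform M v w + qform N v w.
Proof.
rewrite -big_split; apply: eq_bigr => i _; rewrite -big_split.
by apply: eq_bigr => j _; rewrite !mxE /= !mulrDl.
Qed.

Let A1E a (v : V) : A1 (e a) (e a) x v = lowA a v + \sum_i 'D_v ('D_(unitv i) u) x * P i a.
Proof.
rewrite /P -qform_sum -qform_add; congr (qform _ _ _); apply/matrixP => i j.
by rewrite !mxE chain1E; congr (_ + _); apply: eq_bigr => k _; rewrite mxE.
Qed.

Let lowAD a i : `|lowA a (unitv i)| <= D ^+ 6.
Proof.
by rewrite (exprD D 2 4); apply: qformD => // j k; rewrite mxE; apply: low1D.
Qed.

(** A splitting of [chain2] by order: third derivatives of u enter linearly through D_p F, and [Q]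
    is the rest. Within [quad], [quadpp] is the part with two second derivatives of u, the only one
    that can reach size L^2. *)
Let quad (F : X -> R) (v : V) : R :=
  \sum_k \sum_l jc1 u x v k * jc1 u x v l * 'D_(bas l) ('D_(bas k) F) Jx.
Let quadpp (F : X -> R) (v : V) : R :=
  \sum_k \sum_l 'D_v ('D_(unitv k) u) x * 'D_v ('D_(unitv l) u) x *
    'D_(bas (inr l)) ('D_(bas (inr k)) F) Jx.
Let Q (F : X -> R) (v : V) : R :=
  quad F v + 'D_v ('D_v u) x * 'D_(bas (inl (inr tt))) F Jx.

Let chain2E (F : X -> R) (v : V) : chain2 u F x v =
  Q F v + \sum_i 'D_v ('D_v ('D_(unitv i) u)) x * 'D_(bas (inr i)) F Jx.
Proof.
rewrite /chain2 [X in _ + X]sum_K /= [X in _ + (X + _ + _)]big1 => [|i _]; last by rewrite mul0r.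
by rewrite add0r addrA.
Qed.

Let QA a (v : V) : R := qform (\matrix_(i, j) Q (fun q => A q i j) v) (e a) (e a).

Let A2E a (v : V) : A2 (e a) (e a) x v = QA a v + \sum_i 'D_v ('D_v ('D_(unitv i) u)) x * P i a.
Proof.
rewrite /P -qform_sum -qform_add; congr (qform _ _ _); apply/matrixP => i j.
by rewrite !mxE chain2E; congr (_ + _); apply: eq_bigr => k _; rewrite mxE.
Qed.

Let l2 a : 0 <= (1 + lam a) ^+ 2. Proof. exact: sqr_ge0. Qed.
Let l12 a : 1 + lam a <= (1 + lam a) ^+ 2.
Proof. by rewrite expr2 ler_peMr. Qed.

Let dbl k c : 0 <= c -> D ^+ k * c + D ^+ k * c <= D ^+ k.+1 * c.
Proof.
move=> c0; rewrite exprS -mulrA; have := ler_wpM2r (mulr_ge0 (XD k) c0) D2; lra.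
Qed.

Let QD (F : X -> R) b : (forall k, `|'D_(bas k) F Jx| <= D) ->
  (forall k l, `|'D_(bas l) ('D_(bas k) F) Jx| <= D) ->
  `|Q F (e b)| <= D ^+ 10 * (1 + lam b) ^+ 2.
Proof.
move=> bF bF2.
have c0 : 0 <= D ^+ 3 * (1 + lam b) by rewrite mulr_ge0.
apply: le_trans (dbl 9 (l2 b)); apply: addD.
  rewrite (_ : D ^+ 9 * _ = D * (D * (D ^+ 3 * (1 + lam b) * (D ^+ 3 * (1 + lam b)) * D))); last by ring.
  have c1 : 0 <= D ^+ 3 * (1 + lam b) * (D ^+ 3 * (1 + lam b)) * D by rewrite !mulr_ge0.
  apply: sumKD => [|k]; first exact: mulr_ge0.
  apply: sumKD => // l.
  by apply: mulD; [apply: mulD; exact: jce|exact: bF2].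
apply: (@le_trans _ _ (D ^+ 3 * (1 + lam b) * D)); first by apply: mulD => //; exact: uaa.
rewrite mulrAC -exprSr; apply: (@le_trans _ _ (D ^+ 4 * (1 + lam b) ^+ 2)).
  by rewrite ler_wpM2l.
exact: powD.
Qed.

Let QAD a b : `|QA a (e b)| <= D ^+ 12 * (1 + lam b) ^+ 2.
Proof.
rewrite (exprD D 2 10) -mulrA; apply: qformD => //; first by rewrite mulr_ge0.
by move=> i j; rewrite mxE; exact: (QD b (bA1 i j) (bA2 i j)).
Qed.

Let jcn a k : ~~ (if k is inr _ then true else false) -> `|jc1 u x (e a) k| <= D ^+ 2.
Proof.
case: k => [[i|[]]|k] //= _; last exact: uv.
by apply: le_trans (ule a i) _; exact: exprn_ege1.
Qed.

(** Outside the block where both indices are p-indices, at least one of the two factors contains no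
    second derivative of u. *)
Let restD (F : X -> R) : (forall k l, `|'D_(bas l) ('D_(bas k) F) Jx| <= D) ->
  `|quad F (e o) - quadpp F (e o)| <= D ^+ 10 * (1 + L).
Proof.
move=> bF2.
pose f k l := jc1 u x (e o) k * jc1 u x (e o) l * 'D_(bas l) ('D_(bas k) F) Jx.
have E : quad F (e o) - quadpp F (e o) = \sum_i \sum_l f (inl (inl i)) l + \sum_l f (inl (inr tt)) l
   + \sum_i (\sum_j f (inr i) (inl (inl j)) + f (inr i) (inl (inr tt))).
  rewrite /quad sum_K -addrA; congr (_ + _).
  rewrite -sumrB; apply: eq_bigr => i _.
  by rewrite sum_K /= addrK.
have c0 : 0 <= D ^+ 6 * (1 + L) by rewrite mulr_ge0.
have c2 : 0 <= D ^+ 7 * (1 + L) by rewrite mulr_ge0.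
have c3 : D ^+ 6 * (1 + L) <= D ^+ 7 * (1 + L) by apply: powD.
have f1 k l : ~~ (if k is inr _ then true else false) -> `|f k l| <= D ^+ 6 * (1 + L).
  move=> nk; rewrite (_ : _ * _ = D ^+ 2 * (D ^+ 3 * (1 + L)) * D); last by ring.
  by apply: mulD => //; apply: mulD; [exact: jcn|exact: jce].
have f2 k l : ~~ (if l is inr _ then true else false) -> `|f k l| <= D ^+ 6 * (1 + L).
  move=> nk; rewrite (_ : _ * _ = D ^+ 3 * (1 + L) * D ^+ 2 * D); last by ring.
  by apply: mulD => //; apply: mulD; [exact: jce|exact: jcn].
have D77 : D ^+ 7 * (1 + L) = D * (D ^+ 6 * (1 + L)) by ring.
have D88 : D ^+ 8 * (1 + L) = D * (D ^+ 7 * (1 + L)) by ring.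
have D99 : D ^+ 10 * (1 + L) = D * (D * (D * (D ^+ 7 * (1 + L)))) by ring.
rewrite E; apply: (@le_trans _ _ (D ^+ 8 * (1 + L) + D ^+ 7 * (1 + L) + D * (D ^+ 7 * (1 + L) + D ^+ 6 * (1 + L)))).
  apply: addD.
    apply: addD; first by rewrite D88; apply: sumD => // i; rewrite D77; apply: sumKD => // l; exact: f1.
    by rewrite D77; apply: sumKD => // l; exact: f1.
  apply: sumD; first exact: addr_ge0.
  move=> i; apply: addD; last exact: f2.
  by rewrite D77; apply: sumD => // j; exact: f2.
rewrite D99 D88 [X in _ + X <= _]mulrDr -D77.
set t := D ^+ 7 * (1 + L) in c2 *.
have t1 : 2 * t <= D * t by rewrite ler_wpM2r.
have t2 : 2 * (D * t) <= D * (D * t) by rewrite ler_wpM2r// mulr_ge0.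
have t3 : 2 * (D * (D * t)) <= D * (D * (D * t)) by rewrite ler_wpM2r// !mulr_ge0.
by lra.
Qed.

(** The use of regularity for the fourth derivatives. The part of order L^2 is the form [D2p] at h =
    D_o Du; its defect is |h| |h . e_a|, where |h| is of order L and h . e_a = u_oa is bounded by
    [uab]. *)
Let QAlow a : a != o -> - (D ^+ 14 * (1 + L)) <= QA a (e o).
Proof.
move=> ao; pose h : V := \row_k 'D_(e o) ('D_(unitv k) u) x.
pose Mr : 'M[R]_n := \matrix_(i, j) (quad (fun q => A q i j) (e o) - quadpp (fun q => A q i j) (e o)
   + 'D_(e o) ('D_(e o) u) x * 'D_(bas (inl (inr tt))) (fun q => A q i j) Jx).
have E : QA a (e o) = qform (D2p A (e a) Jx) h h + qform Mr (e a) (e a).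
  have -> : qform (D2p A (e a) Jx) h h = qform (\matrix_(i, j) quadpp (fun q => A q i j) (e o)) (e a) (e a).
    transitivity (\sum_l \sum_k \sum_i \sum_j ('D_(bas (inr l)) ('D_(bas (inr k)) (fun q => A q i j)) Jx
       * e a 0 i * e a 0 j * h 0 l * h 0 k)).
      apply: eq_bigr => l _; apply: eq_bigr => k _; rewrite mxE !mulr_suml.
      by apply: eq_bigr => i _; rewrite !mulr_suml.
    rewrite -exchange4; apply: eq_bigr => i _; apply: eq_bigr => j _.
    rewrite mxE !mulr_suml exchange_big; apply: eq_bigr => k _; rewrite !mulr_suml.
    apply: eq_bigr => l _; rewrite !mxE.
    by move: ('D_(e o) _ x) ('D_(e o) _ x) ('D_(bas _) _ Jx) => z1 z2 z3; ring.
  rewrite -qform_add; congr (qform _ _ _); apply/matrixP => i j; rewrite !mxE /Q.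
  have key (z1 z2 z3 : R) : z1 + z3 = z2 + (z1 - z2 + z3) by ring.
  exact: key.
have hD : `|h| <= D ^+ 3 * (1 + L).
  by apply: rV_norm_le => [|k]; [rewrite mulr_ge0|rewrite mxE; exact: uak].
have dh : `|dot h (e a)| <= D ^+ 3.
  suff -> : dot h (e a) = 'D_(e o) ('D_(e a) u) x by apply: uab; rewrite eq_sym.
  rewrite -{2}(sum_unitv (e a)) (derive2_comb _ _ _ (e o) oOm cu2 Omx).
  by apply: eq_bigr => k _; rewrite mxE mulrC.
have ea1 : dot (e a) (e a) = 1 by rewrite on eqxx.
have B2 := @D2p_bound R n A (e a) Jx D ea1 (fun i j k l => bA2 i j (inr l) (inr k)).
have low := regular_lower h B2 ea1 (fun eta => @D2p_ge0 R n A U rA (e a) eta _ (JU Omx)).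
have up : n%:R ^+ 2 * (n%:R + 2) * (n%:R ^+ 2 * D) * `|h| * `|dot h (e a)| <= D ^+ 12 * (1 + L).
  have -> : D ^+ 12 * (1 + L) = (D ^+ 2 * D * (D ^+ 2 * D)) * (D ^+ 3 * (1 + L)) * D ^+ 3 by ring.
  have nn : n%:R ^+ 2 <= D ^+ 2 by rewrite lerXn2r.
  have n22 : 0 <= n%:R + 2 :> R by rewrite addr_ge0.
  apply: ler_pM => //; first by rewrite !mulr_ge0// ?sqr_ge0.
  apply: ler_pM => //; first by rewrite !mulr_ge0// ?sqr_ge0.
  have nn0 : 0 <= n%:R ^+ 2 :> R by exact: sqr_ge0.
  have w1 : n%:R ^+ 2 * (n%:R + 2) <= D ^+ 2 * D by exact: ler_pM.
  have w2 : n%:R ^+ 2 * D <= D ^+ 2 * D by exact: ler_pM.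
  by apply: ler_pM => //; exact: mulr_ge0.
have c11 : 0 <= D ^+ 11 * (1 + L) by rewrite mulr_ge0.
have upr : `|qform Mr (e a) (e a)| <= D ^+ 2 * (D ^+ 11 * (1 + L)).
  apply: qformD => // i j; rewrite mxE.
  apply: le_trans (dbl 10 L0); apply: addD; first exact: (restD (bA2 i j)).
  apply: (@le_trans _ _ (D ^+ 3 * (1 + L) * D)); first by apply: mulD => //; exact: uaa.
  rewrite mulrAC -exprSr; exact: powD.
have key (z1 z2 p q : R) : - p <= z1 -> `|z2| <= q -> - (p + q) <= z1 + z2.
  by rewrite ler_norml => h1 /andP[h2 _]; rewrite opprD lerD.
rewrite E; apply: le_trans (key _ _ _ _ low upr); rewrite lerN2.
apply: (@le_trans _ _ (D ^+ 13 * (1 + L) + D ^+ 13 * (1 + L))); last exact: dbl.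
apply: lerD; first by apply: le_trans up _; exact: powD.
by rewrite mulrA -exprD.
Qed.

Let w a : R := (lam a)^-1.
Let w0 a : 0 < w a. Proof. by rewrite invr_gt0. Qed.
Let Lp : 0 < L. Proof. exact: lam0. Qed.

Let T a b : R := W1 (e a) (e b) x (e o).
Let s i : R := W1 (e o) (e o) x (unitv i) / L.
Let b1 (v : V) : R := chain1 u B x v / B Jx.

Let z i : R := L * s i + A1 (e o) (e o) x (unitv i).
Let zE i : 'D_(e o) ('D_(e o) ('D_(unitv i) u)) x = z i.
Proof.
rewrite /z /s mulrC divfK ?gt_eqF// /W1 subrK.
exact: (derive3_rot oOm _ _ cu3 Omx).
Qed.

Let yE a i : 'D_(e a) ('D_(e a) ('D_(unitv i) u)) x =
  W1 (e a) (e a) x (unitv i) + A1 (e a) (e a) x (unitv i).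
Proof.
rewrite /W1 subrK.
exact: (derive3_rot oOm _ _ cu3 Omx).
Qed.

(** The fourth derivatives of u commute, so D_aa w_oo and D_oo w_aa differ by second derivatives of
    A. The equation, differentiated twice along e_o, controls only the latter. *)
Let WE a : W2 (e o) (e o) x (e a) =
  W2 (e a) (e a) x (e o) + A2 (e a) (e a) x (e o) - A2 (e o) (e o) x (e a).
Proof.
have key (p q a1 a2 : R) : p = q -> p - a2 = q - a1 + a1 - a2 by move=> ->; ring.
exact: (key _ _ _ _ (derive4C oOm _ _ cu Omx)).
Qed.

Let sumG (f : 'I_n -> R) : \sum_i G i * f i =
  \sum_a w a * (\sum_i f i * P i a) + \sum_i f i * bb i.
Proof.
under [X in _ = X + _]eq_bigr do rewrite mulr_sumr.
rewrite exchange_big -big_split; apply: eq_bigr => i _.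
rewrite /G /= mulrDl mulr_suml; congr (_ + _); last exact: mulrC.
by apply: eq_bigr => a _; rewrite /w; ring.
Qed.

Let Rem : R := \sum_i G i * A1 (e o) (e o) x (unitv i) + Q B (e o) / B Jx - b1 (e o) ^+ 2
  + \sum_a w a * QA a (e o) - \sum_a w a * QA o (e a)
  - \sum_i P i o * (b1 (unitv i) + \sum_a w a * A1 (e a) (e a) x (unitv i)).

(** Third derivatives u_ooi meet exactly the coefficients G and form L G . s; the other kind, u_aai,
    is removed by the first order equation. [Rem] holds only second derivatives of u. *)
Let H4eq : \sum_a w a * W2 (e o) (e o) x (e a) =
  \sum_a \sum_b T a b ^+ 2 * (w a * w b) + L * (\sum_i G i * s i) + Rem.
Proof.
have [_ E2] := equation_jet (e o).
have Ez : \sum_i G i * z i = L * (\sum_i G i * s i) + \sum_i G i * A1 (e o) (e o) x (unitv i).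
  by rewrite mulr_sumr -big_split; apply: eq_bigr => i _; rewrite /z /=; ring.
(* Weighted by 1 / lam_a, the u_aai add up to the trace in the equation differentiated once along
   the i-th coordinate. *)
have Ey : \sum_a w a * (\sum_i 'D_(e a) ('D_(e a) ('D_(unitv i) u)) x * P i o) =
   \sum_i P i o * (b1 (unitv i) + \sum_a w a * A1 (e a) (e a) x (unitv i)).
  under eq_bigr do rewrite mulr_sumr.
  rewrite exchange_big; apply: eq_bigr => i _.
  have [E1 _] := equation_jet (unitv i).
  rewrite /b1 -E1 -big_split mulr_sumr; apply: eq_bigr => a _.
  by rewrite yE /w /=; ring.
have Eb : chain2 u B x (e o) / B Jx = Q B (e o) / B Jx + \sum_i z i * bb i.
  rewrite chain2E mulrDl mulr_suml; congr (_ + _); apply: eq_bigr => i _.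
  by rewrite zE /bb mulrA.
have Ew : \sum_a w a * W2 (e o) (e o) x (e a) = \sum_a W2 (e a) (e a) x (e o) / lam a
   + \sum_a w a * QA a (e o) + \sum_a w a * (\sum_i z i * P i a)
   - \sum_a w a * QA o (e a) - \sum_a w a * (\sum_i 'D_(e a) ('D_(e a) ('D_(unitv i) u)) x * P i o).
  rewrite -!big_split -!sumrB/=; apply: eq_bigr => a _.
  have -> : \sum_i z i * P i a = \sum_i 'D_(e o) ('D_(e o) ('D_(unitv i) u)) x * P i a.
    by apply: eq_bigr => i _; rewrite zE.
  rewrite WE (A2E a (e o)) (A2E o (e a)).
  have key (p c q1 s1 q2 s2 : R) : c * (p + (q1 + s1) - (q2 + s2)) =
    p * c + c * q1 + c * s1 - c * q2 - c * s2 by ring.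
  exact: key.
have ET : \sum_a \sum_c W1 (e a) (e c) x (e o) * W1 (e c) (e a) x (e o) / (lam a * lam c) =
   \sum_a \sum_b T a b ^+ 2 * (w a * w b).
  apply: eq_bigr => a _; apply: eq_bigr => c _.
  by rewrite (W1C (e c) (e a) _ Omx) /T /w invfM expr2.
move: E2; rewrite ET -/(b1 (e o)) Eb => E2.
have Eg := sumG z.
rewrite Ew Ey /Rem; move: E2 Ez Eg.
move: (\sum_a W2 _ _ _ _ / _) (\sum_a \sum_b _) (\sum_i z i * bb i) (\sum_a w a * QA a _) => q1 q2 q3 q4.
move: (\sum_a w a * (\sum_i z i * _)) (\sum_a w a * QA o _) (\sum_i P i o * _) => q5 q6 q7.
move: (\sum_i G i * z i) (L * _) (\sum_i G i * A1 _ _ _ _) (Q B _ / _) (b1 _ ^+ 2) => q8 q9 q10 q11 q12.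
by lra.
Qed.

Let L2' : 1 + L <= 2 * L. Proof. by rewrite /L; move: L1; lra. Qed.
Let wo2 : w o * (1 + L) ^+ 2 <= 2 * (1 + L).
Proof.
rewrite /w -/L mulrC ler_pdivrMr// expr2 -mulrA [X in _ <= 2 * X]mulrC mulrA.
by rewrite ler_wpM2r.
Qed.

Let R1 : `|\sum_i G i * A1 (e o) (e o) x (unitv i)| <= D ^+ 12 * ((1 + Tr) * (1 + L)).
Proof.
have -> : D ^+ 12 * ((1 + Tr) * (1 + L)) = D * ((D ^+ 3 * (1 + Tr)) * (D ^+ 8 * (1 + L))) by ring.
apply: sumD => [|i]; first by rewrite !mulr_ge0// addr_ge0.
by apply: mulD => //; apply: A1u.
Qed.

Let R2 : `|Q B (e o) / B Jx| <= D ^+ 11 * (1 + L) ^+ 2.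
Proof.
have -> : D ^+ 11 * (1 + L) ^+ 2 = D ^+ 10 * (1 + L) ^+ 2 * D by ring.
by apply: mulD => //; exact: QD.
Qed.

Let b1e a : `|b1 (e a)| <= D ^+ 6 * (1 + lam a).
Proof.
have -> : D ^+ 6 * (1 + lam a) = D ^+ 5 * (1 + lam a) * D by ring.
by apply: mulD => //; exact: B1e.
Qed.

Let b1u i : `|b1 (unitv i)| <= D ^+ 7 * (1 + L).
Proof.
have -> : D ^+ 7 * (1 + L) = D ^+ 6 * (1 + L) * D by ring.
by apply: mulD => //; exact: B1u.
Qed.

Let R3 : b1 (e o) ^+ 2 <= D ^+ 12 * (1 + L) ^+ 2.
Proof.
have -> : D ^+ 12 * (1 + L) ^+ 2 = (D ^+ 6 * (1 + L)) ^+ 2 by ring.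
by rewrite -real_normK ?num_real// lerXn2r ?nnegrE// ?mulr_ge0//; exact: b1e.
Qed.

Let R4 : - (D ^+ 14 * (1 + L) * Tr + D ^+ 12 * (2 * (1 + L))) <= \sum_a w a * QA a (e o).
Proof.
apply: (@le_trans _ _ (\sum_a (- (D ^+ 14 * (1 + L) * w a) - (D ^+ 12 * (2 * (1 + L))) *+ (a == o)))).
  rewrite sumrB sumrN -mulr_sumr -/Tr (bigD1 o)//= [X in _ <= _ - (_ + X)]big1 => [|a ao].
    by rewrite eqxx mulr1n addr0 opprD.
  by rewrite (negbTE ao).
apply: ler_sum => a _; case: eqVneq => [->|ao].
  rewrite mulr1n; have h := QAD o o; rewrite ler_norml in h; have /andP[h1 _] := h.
  have h2 := ler_wpM2l (ltW (w0 o)) h1.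
  have h3 := ler_wpM2l (XD 12) wo2.
  have h4 : 0 <= D ^+ 14 * (1 + L) * w o by rewrite !mulr_ge0// ltW.
  move: h2 h3 h4; rewrite -/L mulrN mulrCA.
  move: (D ^+ 14 * (1 + L) * w o) (D ^+ 12 * (w o * (1 + L) ^+ 2)) (D ^+ 12 * (2 * (1 + L))) => q1 q2 q3.
  by move: (w o * QA o (e o)) => q4; lra.
rewrite mulr0n subr0 mulrC -mulrN.
exact: (ler_wpM2l (ltW (w0 a)) (QAlow ao)).
Qed.

Let R5 : `|\sum_a w a * QA o (e a)| <= D ^+ 12 * (Tr + 2 * D * (1 + L)).
Proof.
apply: le_trans (ler_norm_sum _ _ _) _.
apply: (@le_trans _ _ (\sum_a D ^+ 12 * (w a + 2 * (1 + L)))).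
  apply: ler_sum => a _; rewrite normrM gtr0_norm//.
  apply: (le_trans (ler_wpM2l (ltW (w0 a)) (QAD o a))).
  rewrite mulrCA ler_wpM2l//.
  have -> : w a * (1 + lam a) ^+ 2 = w a + (2 + lam a).
    by rewrite /w; field; rewrite gt_eqF.
  by rewrite lerD2l; move: (lamL a) Lp; rewrite /L; lra.
rewrite -mulr_sumr ler_wpM2l// big_split/= lerD2l sumr_const card_ord -mulr_natl.
by have := ler_wpM2r L0 nleD; lra.
Qed.

Let R6 : `|\sum_i P i o * (b1 (unitv i) + \sum_a w a * A1 (e a) (e a) x (unitv i))| <=
  D ^+ 12 * ((1 + Tr) * (1 + L)).
Proof.
have -> : D ^+ 12 * ((1 + Tr) * (1 + L)) = D * (D ^+ 3 * (D ^+ 8 * (1 + L) + D ^+ 8 * (1 + L) * Tr)) by ring.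
have c8 : 0 <= D ^+ 8 * (1 + L) by rewrite mulr_ge0.
apply: sumD => [|i]; first by rewrite !mulr_ge0// addr_ge0// mulr_ge0.
apply: mulD => //; apply: addD; first by apply: le_trans (b1u i) _; exact: powD.
by apply: TrD => // a; apply: A1u.
Qed.

(** The terms carry powers of D up to 14; [d1] to [d7] trade each factor 2 for one more power, and
    17 leaves room for the number of terms. *)
Let RemD : - (D ^+ 17 * (1 + Tr) * (1 + L)) - D ^+ 17 * (1 + L ^+ 2) <= Rem.
Proof.
have X0 : 0 <= (1 + Tr) * (1 + L) by rewrite mulr_ge0// addr_ge0.
set X0' := (1 + Tr) * (1 + L) in X0.
have e1 : (1 + L) * Tr <= X0' by rewrite /X0' mulrC ler_wpM2r//; lra.
have e2 : (1 + L) <= X0' by rewrite /X0' ler_peMl// lerDl.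
have e3 : Tr <= X0' by apply: le_trans e1; rewrite ler_peMl.
have e4 : (1 + L) ^+ 2 <= 2 * (1 + L ^+ 2).
  by have := sqr_ge0 (1 - L); rewrite !expr2; lra.
have e5 := ler_wpM2l (XD 12) e4.
have e6 : D ^+ 11 * (1 + L) ^+ 2 <= D ^+ 12 * (1 + L) ^+ 2 by apply: powD; rewrite ?sqr_ge0.
have e7 := ler_wpM2l (XD 14) e1; have e8 := ler_wpM2l (XD 12) e2.
have e9 := ler_wpM2l (XD 12) e3; have e10 := ler_wpM2l (XD 13) e2.
have Y0 : 0 <= 1 + L ^+ 2 by rewrite addr_ge0 ?sqr_ge0.
have d1 : 2 * (D ^+ 12 * X0') <= D ^+ 13 * X0' by have := dbl 12 X0; lra.
have d2 : 2 * (D ^+ 13 * X0') <= D ^+ 14 * X0' by have := dbl 13 X0; lra.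
have d3 : 2 * (D ^+ 14 * X0') <= D ^+ 15 * X0' by have := dbl 14 X0; lra.
have d4 : 2 * (D ^+ 15 * X0') <= D ^+ 16 * X0' by have := dbl 15 X0; lra.
have d5 : 2 * (D ^+ 16 * X0') <= D ^+ 17 * X0' by have := dbl 16 X0; lra.
have d6 : 2 * (D ^+ 12 * (1 + L ^+ 2)) <= D ^+ 13 * (1 + L ^+ 2) by have := dbl 12 Y0; lra.
have d7 : 2 * (D ^+ 13 * (1 + L ^+ 2)) <= D ^+ 14 * (1 + L ^+ 2) by have := dbl 13 Y0; lra.
have d8 : D ^+ 14 * (1 + L ^+ 2) <= D ^+ 17 * (1 + L ^+ 2) by exact: powD.
have -> : D ^+ 17 * (1 + Tr) * (1 + L) = D ^+ 17 * X0' by rewrite /X0' mulrA.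
have := R1; rewrite ler_norml => /andP[r1 _].
have := R2; rewrite ler_norml => /andP[r2 _].
have r3 := R3; have r4 := R4.
have := R5; rewrite ler_norml => /andP[_ r5].
have := R6; rewrite ler_norml => /andP[_ r6].
have p0 : 0 <= D ^+ 12 * X0' by rewrite mulr_ge0.
have f1 : D ^+ 14 * (1 + L) * Tr = D ^+ 14 * ((1 + L) * Tr) by rewrite mulrA.
have f2 : D ^+ 12 * (Tr + 2 * D * (1 + L)) = D ^+ 12 * Tr + 2 * (D ^+ 13 * (1 + L)) by ring.
have f3 : D ^+ 12 * (2 * (1 + L)) = 2 * (D ^+ 12 * (1 + L)) by ring.
have f4 : D ^+ 12 * (2 * (1 + L ^+ 2)) = 2 * (D ^+ 12 * (1 + L ^+ 2)) by ring.
rewrite f1 f3 in r4; rewrite f2 in r5; rewrite f4 in e5.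
rewrite /Rem -/X0'; move: r1 r2 r3 r4 r5 r6 e5 e6 e7 e8 e9 e10 d1 d2 d3 d4 d5 d6 d7 d8 p0; rewrite -/X0'.
move: (\sum_i G i * _) (Q B _ / _) (b1 _ ^+ 2) (\sum_a w a * QA a _) (\sum_a w a * QA o _) (\sum_i P i o * _) => q1 q2 q3 q4 q5 q6.
move: (D ^+ 12 * X0') (D ^+ 13 * X0') (D ^+ 14 * X0') (D ^+ 15 * X0') (D ^+ 16 * X0') (D ^+ 17 * X0') => x2 x3 x4 x5 x6 x7.
move: (D ^+ 12 * (1 + L ^+ 2)) (D ^+ 13 * (1 + L ^+ 2)) (D ^+ 14 * (1 + L ^+ 2)) (D ^+ 17 * (1 + L ^+ 2)) => y2 y3 y4 y5.
move: (D ^+ 11 * (1 + L) ^+ 2) (D ^+ 12 * (1 + L) ^+ 2) (D ^+ 14 * ((1 + L) * Tr)) (D ^+ 12 * (1 + L)) (D ^+ 12 * Tr) (D ^+ 13 * (1 + L)) => z1 z2 z3 z4 z5 z6.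
by lra.
Qed.

Context (eta d1 d2 : V -> R).
Context (jeta : forall v, jet2 (fun t => eta (x + t *: v)) (eta x) (d1 v) (d2 v)).
Context (d1E : forall v, d1 v = \sum_i v 0 i * d1 (unitv i)).
Context (eta0 : 0 < eta x) (eta1 : eta x <= 1).
Context (etaD : forall i, `|d1 (unitv i)| <= D).
(** For eta = g(., y0, z0 - h) - u the sum of d2 and the second derivative of u is that of g, which
    is A at the jet of g. The hypothesis is then a first order Taylor bound in p between the jets of
    u and of g. *)
Context (etaF : forall a, - (D * eta x) - D * `|d1 (e a)| <=
  d2 (e a) + 'D_(e a) ('D_(e a) u) x - qform (A Jx) (e a) (e a)
  - \sum_i d1 (unitv i) *
      qform (\matrix_(j, k) 'D_(bas (inr i)) (fun q => A q j k) Jx) (e a) (e a)).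
Context (beta kappa r : R) (tau : nat) (x0 : V) (r0 : 0 <= r).
Context (xr : forall i, `|(x - x0) 0 i| <= r).

(** The logarithm of the maximised quantity with the direction frozen at e_o: the largest eigenvalue
    of w need not be differentiable, while w in a fixed direction is. *)
Definition pogorelov_function (y : V) : R :=
  ln (qform (augm y) (e o) (e o)) + tau%:R * ln (eta y)
  + beta / 2 * (\sum_k 'D_(unitv k) u y * 'D_(unitv k) u y)
  + kappa / 2 * dot (y - x0) (y - x0).

Context (mx : \forall y \near x, pogorelov_function y <= pogorelov_function x).

Let gradq (v : V) : R := \sum_k 'D_(unitv k) u x * 'D_v ('D_(unitv k) u) x.
Let hessq (v : V) : R := \sum_k 'D_v ('D_(unitv k) u) x ^+ 2.
Let thirdq (v : V) : R := \sum_k 'D_(unitv k) u x * 'D_v ('D_v ('D_(unitv k) u)) x.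

Let jet2_pf (v : V) : jet2 (fun t => pogorelov_function (x + t *: v)) (pogorelov_function x)
  (W1 (e o) (e o) x v / L + tau%:R * (d1 v / eta x) + beta * gradq v + kappa * dot (x - x0) v)
  (W2 (e o) (e o) x v / L - (W1 (e o) (e o) x v / L) ^+ 2
   + tau%:R * (d2 v / eta x - (d1 v / eta x) ^+ 2)
   + beta * (hessq v + thirdq v) + kappa * dot v v).
Proof.
have qL : qform (augm x) (e o) (e o) = L by rewrite eig on eqxx mulr1.
have qp : 0 < qform (augm x) (e o) (e o) by rewrite qL.
have j1 := jet2_ln qp (jet2_augm (e o) (e o) v Omx); rewrite qL in j1.
have j2 := jet2Z tau%:R (jet2_ln eta0 (jeta v)).
have j3 : jet2 (fun t => \sum_k 'D_(unitv k) u (x + t *: v) * 'D_(unitv k) u (x + t *: v))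
   (\sum_k 'D_(unitv k) u x * 'D_(unitv k) u x) (2 * gradq v) (2 * (hessq v + thirdq v)).
  rewrite /gradq /hessq /thirdq -big_split !mulr_sumr; apply: jet2_sum => k.
  have jk := jet2_line_on oOm v (cu3.2 (unitv k)) Omx.
  apply: jet2_val (jet2M jk jk) _ _ _ => //.
    by move: ('D_(unitv k) u x) ('D_v _ x) => p q; ring.
  by move: ('D_(unitv k) u x) ('D_v _ x) ('D_v _ x) => p q q2 /=; ring.
have j4 : jet2 (fun t => dot (x + t *: v - x0) (x + t *: v - x0)) (dot (x - x0) (x - x0))
   (2 * dot (x - x0) v) (2 * dot v v).
  rewrite /dot !mulr_sumr; apply: jet2_sum => i.
  have ji : jet2 (fun t => (x + t *: v - x0) 0 i) ((x - x0) 0 i) (v 0 i) 0.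
    under eq_fun do rewrite !mxE; rewrite !mxE.
    have := jet2D (jet2_cst (x 0 i - x0 0 i)) (jet2Zr (v 0 i) (@jet2_id R)).
    under eq_fun do rewrite addrAC.
    by move/jet2_val; apply; ring.
  by apply: jet2_val (jet2M ji ji) _ _ _ => //; ring.
have := jet2D (jet2D (jet2D j1 j2) (jet2Z (beta / 2) j3)) (jet2Z (kappa / 2) j4).
rewrite -qL -/(pogorelov_function x) => h; apply: (jet2_val h) => //; rewrite qL.
- by move: (gradq v) (dot _ _) (W1 _ _ _ _ / L) (tau%:R * _) => p q q1 q2; field.
- by move: (hessq v + thirdq v) (dot _ _) (W2 _ _ _ _ / L - _) (tau%:R * _) => p q q1 q2; field.
Qed.

Let crit (v : V) :
  W1 (e o) (e o) x v / L + tau%:R * (d1 v / eta x) + beta * gradq v + kappa * dot (x - x0) v = 0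
  /\ W2 (e o) (e o) x v / L - (W1 (e o) (e o) x v / L) ^+ 2
   + tau%:R * (d2 v / eta x - (d1 v / eta x) ^+ 2)
   + beta * (hessq v + thirdq v) + kappa * dot v v <= 0.
Proof.
apply: (jet2_max (jet2_pf v)) => /=; rewrite scale0r addr0.
have c0 : (fun t : R => x + t *: v) @ (0 : R) --> x + 0 *: v.
  by apply: cvgD; [exact: cvg_cst|apply: cvgZr_tmp; exact: cvg_id].
rewrite scale0r addr0 in c0.
exact: (c0 _ mx).
Qed.

Let C := D ^+ 17.
Let C1 : 1 <= C. Proof. exact: exprn_ege1. Qed.
Let C0 : 0 <= C. Proof. exact: XD. Qed.

Let m1 k c : (k <= 17)%N -> 0 <= c -> D ^+ k * c <= C * c.
Proof. exact: powD. Qed.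

Let swapw (p c : 'I_n -> R) (q : 'I_n -> 'I_n -> R) :
  \sum_a c a * (\sum_k p k * q a k) = \sum_k p k * (\sum_a c a * q a k).
Proof.
under eq_bigr do rewrite mulr_sumr.
rewrite exchange_big; apply: eq_bigr => k _; rewrite mulr_sumr; apply: eq_bigr => a _.
exact: mulrCA.
Qed.

(** The radius passed to [pogorelov_bound] is D r: coordinates of x - x0 bounded by r in the
    standard basis are bounded by D r in the frame. *)
Lemma pogorelov_at_max : 0 < beta -> 0 < kappa -> 12 <= tau%:R :> R ->
  12 * beta ^+ 2 * C ^+ 2 * n%:R <= tau%:R -> beta = 2 * C + 2 ->
  kappa = 4 * (2 * C + 6 * C ^+ 2 + C * tau%:R + tau%:R * C ^+ 2 + 1 + beta * C) ->
  C * (D * r) <= 1 / 4 -> 24 * kappa * (D * r) ^+ 2 <= tau%:R ->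
  eta x ^+ 2 * lam o <= 2 * C + kappa + beta * (n%:R * C) + beta * C + C * tau%:R
     + 2 * tau%:R * C ^+ 2.
Proof.
move=> b0 k0 t12 tb bE kE Cr kr.
have n0 : (0 < n)%N by exact: leq_ltn_trans (ltn_ord o).
have Lnz : L != 0 by exact: lt0r_neq0.
have Dr0 : 0 <= D * r by exact: mulr_ge0.
apply: (@pogorelov_bound R n C beta kappa tau%:R (D * r) (eta x) lam o
  s (fun i => d1 (unitv i)) (fun i => gradq (unitv i)) (fun i => (x - x0) 0 i) G
  (fun a => W1 (e o) (e o) x (e a) / L) (fun a => d1 (e a)) (fun a => gradq (e a))
  (fun a => dot (x - x0) (e a)) (fun a => W2 (e o) (e o) x (e a))
  (fun a => d2 (e a)) (fun a => hessq (e a)) (fun a => thirdq (e a)) T) => //.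
- by move=> i; have [+ _] := crit (unitv i); rewrite dot_unitv.
- by move=> a; have [+ _] := crit (e a).
- apply: sumr_le0 => a _; rewrite pmulr_rle0 ?invr_gt0//.
  by have [_] := crit (e a); rewrite on eqxx mulr1.
- by rewrite H4eq -addrA lerD2l; exact: RemD.
- by move=> a; rewrite /T W1C.
(* In D_a w_oo - D_o w_oa the third derivatives of u cancel, leaving first derivatives of A of size
   L. *)
- move=> a; rewrite /T -mulrBl normrM [X in _ * X]gtr0_norm ?invr_gt0// ler_pdivrMr//.
  have -> : W1 (e o) (e o) x (e a) - W1 (e o) (e a) x (e o) =
     A1 (e o) (e a) x (e o) - A1 (e o) (e o) x (e a).
    have key (p q a1 a2 : R) : q = p -> p - a1 - (q - a2) = a2 - a1 by move=> ->; ring.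
    apply: key; exact: (derive3_rot oOm (e o) (e a) cu3 Omx).
  apply: (@le_trans _ _ (D ^+ 7 * (1 + L) + D ^+ 7 * (1 + L))).
    apply: le_trans (ler_normB _ _) _; apply: lerD; first by apply: A1e.
    apply: (@le_trans _ _ (D ^+ 7 * (1 + lam a))); first by apply: A1e.
    by rewrite ler_wpM2l.
  apply: le_trans (dbl 7 L0) _.
  apply: (@le_trans _ _ (D ^+ 8 * (2 * L))); first by rewrite ler_wpM2l.
  rewrite mulrA; apply: ler_wpM2r; first exact: ltW.
  apply: (@le_trans _ _ (D ^+ 9)); last exact: powD1.
  by rewrite [D ^+ 9]exprSr; exact: ler_wpM2l.
(* The equation differentiated along the k-th coordinate, multiplied by D_k u and summed over k. *)
- have Et : \sum_a (lam a)^-1 * thirdq (e a) = \sum_i G i * gradq (unitv i)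
     + \sum_k 'D_(unitv k) u x * (low1 B (unitv k) / B Jx + \sum_a w a * lowA a (unitv k)).
    have E3 k : \sum_a w a * 'D_(e a) ('D_(e a) ('D_(unitv k) u)) x =
       \sum_i G i * 'D_(unitv k) ('D_(unitv i) u) x
       + (low1 B (unitv k) / B Jx + \sum_a w a * lowA a (unitv k)).
      have [E1 _] := equation_jet (unitv k).
      transitivity (\sum_a w a * (W1 (e a) (e a) x (unitv k) + A1 (e a) (e a) x (unitv k))).
        by apply: eq_bigr => a _; exact: (congr1 (fun z => w a * z) (yE a k)).
      have -> : \sum_a w a * (W1 (e a) (e a) x (unitv k) + A1 (e a) (e a) x (unitv k)) =
         \sum_a W1 (e a) (e a) x (unitv k) / lam a + \sum_a w a * lowA a (unitv k)
         + \sum_a w a * (\sum_i 'D_(unitv k) ('D_(unitv i) u) x * P i a).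
        rewrite -!big_split; apply: eq_bigr => a _; rewrite A1E /w /=.
        by move: (W1 _ _ _ _) (lowA _ _) (\sum_i _) => q1 q2 q3; ring.
      rewrite E1 chain1E mulrDl mulr_suml sumG.
      have -> : \sum_i 'D_(unitv k) ('D_(unitv i) u) x * 'D_(bas (inr i)) B Jx / B Jx =
         \sum_i 'D_(unitv k) ('D_(unitv i) u) x * bb i.
        by apply: eq_bigr => i _; exact: esym (mulrA _ _ _).
      have key (q1 q2 q3 q4 : R) : q1 + q2 + q3 + q4 = q4 + q2 + (q1 + q3) by ring.
      exact: key.
    transitivity (\sum_k 'D_(unitv k) u x * (\sum_a w a * 'D_(e a) ('D_(e a) ('D_(unitv k) u)) x)).
      exact: swapw.
    transitivity (\sum_k 'D_(unitv k) u x * (\sum_i G i * 'D_(unitv k) ('D_(unitv i) u) x) +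
       \sum_k 'D_(unitv k) u x * (low1 B (unitv k) / B Jx + \sum_a w a * lowA a (unitv k))).
      rewrite -big_split; apply: eq_bigr => k _.
      exact: etrans (congr1 (fun z => 'D_(unitv k) u x * z) (E3 k)) (mulrDr _ _ _).
    apply: (congr1 (fun z => z + _)).
    apply: etrans (swapw _ _ _) _; apply: eq_bigr => i _.
    apply: (congr1 (fun z => G i * z)); apply: eq_bigr => k _.
    apply: (congr1 (fun z => 'D_(unitv k) u x * z)).
    exact: (schwarz _ _ oOm cu2 Omx).
  have key (p g q c : R) : p = g + q -> `|q| <= c -> g - c <= p.
    by move=> ->; rewrite ler_norml => /andP[h _]; rewrite lerD2l.
  apply: (key _ _ _ _ Et).
  have T1 : 0 <= 1 + Tr by exact: addr_ge0.
  apply: (@le_trans _ _ (D ^+ 8 * (1 + Tr))); last exact: m1.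
  rewrite (_ : D ^+ 8 * (1 + Tr) = D * (D * (D ^+ 6 + D ^+ 6 * Tr))); last by ring.
  apply: sumD => [|k]; first by rewrite mulr_ge0// addr_ge0// mulr_ge0.
  apply: mulD => //; apply: addD; last exact: TrD.
  apply: (@le_trans _ _ (D ^+ 5)); last exact: powD1.
  by rewrite exprSr; apply: mulD => //; apply: low1D.
(* D_a D_k u is lam_a (e_a)_k plus an entry of A; in the square, the cross term costs a multiple of
   lam_a and the square of the entry is dropped. *)
- move=> a; rewrite /hessq.
  have -> : \sum_k 'D_(e a) ('D_(unitv k) u) x ^+ 2 =
     \sum_k (lam a * e a 0 k + qform (A Jx) (e a) (unitv k)) ^+ 2.
    by apply: eq_bigr => k _; rewrite uav dot_unitv.
  have -> : \sum_k (lam a * e a 0 k + qform (A Jx) (e a) (unitv k)) ^+ 2 =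
     lam a ^+ 2 * dot (e a) (e a) + 2 * lam a * (\sum_k e a 0 k * qform (A Jx) (e a) (unitv k))
     + \sum_k qform (A Jx) (e a) (unitv k) ^+ 2.
    rewrite /dot !mulr_sumr -!big_split/=; apply: eq_bigr => k _; ring.
  have q2 : `|\sum_k e a 0 k * qform (A Jx) (e a) (unitv k)| <= D ^+ 4.
    rewrite exprS; apply: sumD => // k; rewrite -[leRHS]mul1r; apply: mulD; first exact: ule.
    exact: Aee.
  have q3 : 0 <= \sum_k qform (A Jx) (e a) (unitv k) ^+ 2.
    by apply: sumr_ge0 => k _; exact: sqr_ge0.
  rewrite on eqxx mulr1 -addrA lerD2l.
  move: q2; rewrite ler_norml => /andP[q2 _].
  have h1 := ler_wpM2l (ltW (lam0 a)) q2.
  have h2 : 2 * (D ^+ 4 * lam a) <= C * lam a.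
    apply: (@le_trans _ _ (D ^+ 5 * lam a)); last by apply: m1 => //; exact: ltW.
    have := dbl 4 (ltW (lam0 a)); lra.
  move: h1 h2 q3; move: (\sum_k e a 0 k * _) (\sum_k _ ^+ 2) => q4 q5.
  by rewrite mulrN => h1 h2 q6; lra.
(* In [etaF] the terms in u give u_aa - A_aa = lam_a, whose weighted sum is the constant n. *)
- have Ee : \sum_a (lam a)^-1 * (\sum_i d1 (unitv i) * P i a) =
     \sum_i G i * d1 (unitv i) - \sum_i d1 (unitv i) * bb i.
    by rewrite sumG addrK.
  have be : `|\sum_i d1 (unitv i) * bb i| <= D ^+ 4.
    rewrite (_ : D ^+ 4 = D * (D * D ^+ 2)); last by ring.
    by apply: sumD => [|i]; [exact: mulr_ge0|apply: mulD].
  have lo : \sum_a (lam a)^-1 * (\sum_i d1 (unitv i) * P i a - lam a - D * eta x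
       - D * `|d1 (e a)|) <= \sum_a (lam a)^-1 * d2 (e a).
    apply: ler_sum => a _; rewrite ler_pM2l ?invr_gt0//.
    have h1 := etaF a; have h2 : 'D_(e a) ('D_(e a) u) x = lam a + qform (A Jx) (e a) (e a).
      by rewrite uav on eqxx mulr1.
    move: h1; rewrite h2 -/(P _ a).
    move: (d2 (e a)) (qform (A Jx) (e a) (e a)) => q1 q2.
    rewrite (_ : \sum_i d1 (unitv i) * qform _ (e a) (e a) = \sum_i d1 (unitv i) * P i a) //.
    move: (\sum_i _ * P i a) `|d1 (e a)| => q3 q4.
    by lra.
  apply: le_trans lo.
  have -> : \sum_a (lam a)^-1 * (\sum_i d1 (unitv i) * P i a - lam a - D * eta x
       - D * `|d1 (e a)|) = \sum_a (lam a)^-1 * (\sum_i d1 (unitv i) * P i a)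
       - n%:R - D * eta x * Tr - D * \sum_a (lam a)^-1 * `|d1 (e a)|.
    have -> : n%:R = \sum_(a < n) (1 : R) by rewrite sumr_const card_ord.
    rewrite /Tr !mulr_sumr -!sumrB/=; apply: eq_bigr => a _.
    have lz : lam a != 0 by exact: lt0r_neq0.
    move: (\sum_i _ * P i a) => q1.
    by move: `|d1 (e a)| => q2; field; exact: lz.
  rewrite Ee; move: be; rewrite ler_norml => /andP[_ be].
  have S0 : 0 <= \sum_a (lam a)^-1 * `|d1 (e a)|.
    by apply: sumr_ge0 => a _; rewrite mulr_ge0// invr_ge0 ltW.
  have DC : D <= C by rewrite -[leLHS]expr1; exact: powD1.
  have h1 : D * eta x * Tr <= C * eta x * Tr.
    by rewrite ler_wpM2r// ler_wpM2r// ltW.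
  have h2 := ler_wpM2r S0 DC.
  have h3 : D ^+ 4 + n%:R <= C.
    apply: (@le_trans _ _ (D ^+ 5)); last exact: powD1.
    apply: (@le_trans _ _ (D ^+ 4 + D ^+ 4)).
      rewrite lerD2l; apply: le_trans nleD _; rewrite -[leLHS]expr1; exact: powD1.
    by have := dbl 4 (@ler01 R); rewrite !mulr1.
  move: be h1 h2 h3.
  move: (\sum_i G i * _) (\sum_i _ * bb i) (D * eta x * Tr) (C * eta x * Tr) => q1 q2 q3 q4.
  move: (D * \sum_a _) (C * \sum_a _) => q5 q6.
  by lra.
- apply: (@le_trans _ _ (D * (D ^+ 3 * (1 + Tr) * r))).
    apply: sumD => [|i]; first by rewrite !mulr_ge0// addr_ge0.
    by apply: mulD.
  have T1 : 0 <= (1 + Tr) * r by rewrite mulr_ge0// addr_ge0.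
  rewrite (_ : D * _ = D ^+ 4 * ((1 + Tr) * r)); last by ring.
  apply: (le_trans (@m1 4 _ isT T1)).
  rewrite -mulrA ler_wpM2l//; rewrite ler_wpM2l ?addr_ge0//.
  by rewrite ler_peMl.
- move=> a; apply: sumD => // i; rewrite -[leRHS]mulr1.
  by apply: mulD => //; exact: ule.
- move=> a; rewrite /gradq.
  apply: (@le_trans _ _ (D ^+ 5 * (1 + lam a))); last exact: m1.
  rewrite (_ : D ^+ 5 * (1 + lam a) = D * (D * (D ^+ 3 * (1 + lam a)))); last by ring.
  apply: sumD => [|k]; first by rewrite !mulr_ge0.
  by apply: mulD.
- rewrite d1E; apply: (@le_trans _ _ (D ^+ 2)); last exact: powD1.
  rewrite expr2; apply: sumD => // i; rewrite -[leRHS]mul1r; apply: mulD => //.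
  exact: ule.
Qed.

End MaxPoint.

(** * Compactness and segments *)

Section Compactness.
Context {R : realType}.

Lemma fin_bound (I : finType) (P : I -> R -> Prop) :
  (forall i c d, c <= d -> P i c -> P i d) -> (forall i, exists c, P i c) ->
  exists c, 0 <= c /\ forall i, P i c.
Proof.
move=> mono /choice[f Pf]; exists (\sum_i `|f i|); split; first exact: sumr_ge0.
move=> i; apply: mono (Pf i); rewrite (bigD1 i)//=.
by apply: le_trans (ler_norm _) _; rewrite lerDl; exact: sumr_ge0.
Qed.

Lemma compact_image (T W : topologicalType) (f : T -> W) (K : set T) :
  compact K -> (forall x, K x -> {for x, continuous f}) -> compact (f @` K).
Proof.
move=> cK cf; apply: continuous_compact cK.
by apply: continuous_in_subspaceT => x; rewrite inE; exact: cf.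
Qed.

Lemma compact_fun_bound (T : topologicalType) (f : T -> R) (K : set T) :
  compact K -> (forall x, K x -> {for x, continuous f}) ->
  exists c, forall x, K x -> `|f x| <= c.
Proof.
move=> cK cf; have /compact_bounded[M [_ HM]] := compact_image cK cf.
exists (M + 1) => x Kx; apply: (HM (M + 1)); first by rewrite ltrDl.
by exists x.
Qed.

Lemma compact_fun_min (T : topologicalType) (f : T -> R) (K : set T) :
  compact K -> (forall x, K x -> {for x, continuous f}) -> (forall x, K x -> 0 < f x) ->
  exists c, 0 < c /\ forall x, K x -> c <= f x.
Proof.
move=> cK cf fp; have [|c Hc] := @compact_fun_bound T (fun x => (f x)^-1) K cK.
  by move=> x Kx; apply: continuousV; [rewrite gt_eqF// fp|exact: cf].
exists (`|c| + 1)^-1; have c0 : 0 < `|c| + 1 by rewrite ltr_wpDl.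
split; first by rewrite invr_gt0.
move=> x Kx; have fx := fp x Kx.
rewrite -[leRHS]invrK lef_pV2 ?posrE ?invr_gt0//.
have := Hc x Kx; rewrite gtr0_norm ?invr_gt0// => h.
by apply: le_trans h _; apply: le_trans (ler_norm _) _; rewrite lerDl.
Qed.

(** Near-covering form of compactness, with the filter of small positive radii: half of the margin
    at q serves all points within half of it. *)
Lemma compact_margin (X : normedModType R) (K G : set X) : compact K -> open G -> K `<=` G ->
  exists2 ep : R, 0 < ep & forall q q', K q -> `|q - q'| <= ep -> G q'.
Proof.
move=> cK oG KG.
have /compact_near_coveringP ncK := cK.
have N : \forall ep \near (0 : R)^'+, K `<=` (fun q => forall q', `|q - q'| <= ep -> G q').
  apply: ncK => q Kq.
  have [r r0 Hr] := nbhs_norm (open_nbhs_nbhs (conj oG (KG q Kq))).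
  have r2 : 0 < r / 2 by rewrite divr_gt0.
  exists (ball q (r / 2), [set e : R | 0 < e < r / 2]); first split => /=.
  - exact: nbhsx_ballx.
  - by near=> e; apply/andP; split; near: e; [exact: nbhs_right_gt|exact: nbhs_right_lt].
  move=> [q1 e]/= [bq /andP[e0 e2]] q' qe; apply: Hr.
  rewrite -ball_normE/= in bq.
  rewrite (_ : q - q' = (q - q1) + (q1 - q')); last by rewrite addrA subrK.
  rewrite [r]splitr; apply: le_lt_trans (ler_normD _ _) _.
  by apply: ltr_leD => //; apply: le_trans qe _; exact: ltW.
have [ep [/= e0 He]] := filter_ex (filterI (nbhs_right_gt (0 : R)) N).
by exists ep => // q q' Kq; exact: He.
Unshelve. all: by end_near. Qed.

Lemma interval_compact (a b : R) : compact [set t : R | a <= t <= b].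
Proof.
rewrite (_ : [set t | _] = `[a, b]%classic); first exact: segment_compact.
by apply/seteqP; split => t /=; rewrite in_itv.
Qed.

Lemma mvt_bound (f f' : R -> R) (a b M : R) : a <= b ->
  (forall z, a <= z -> z <= b -> is_derive z (1 : R) f (f' z)) ->
  (forall z, a <= z -> z <= b -> `|f' z| <= M) -> `|f b - f a| <= M * (b - a).
Proof.
move=> ab df bf; have [||t] := @MVT_segment R f f' a b ab.
- by move=> t; rewrite in_itv/= => /andP[t1 t2]; apply: df; exact: ltW.
- apply: continuous_in_subspaceT => t; rewrite inE/= in_itv/= => /andP[t1 t2].
  by apply/differentiable_continuous/derivable1_diffP; have [] := df t t1 t2.
rewrite in_itv/= => /andP[t1 t2] ->; rewrite normrM (ger0_norm (_ : 0 <= b - a)) ?subr_ge0//.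
by rewrite ler_wpM2r ?subr_ge0//; exact: bf.
Qed.

Lemma continuous_comp_fst (T W W' : topologicalType) (f : T -> W') (q : T * W) :
  {for q.1, continuous f} -> {for q, continuous (fun s : T * W => f s.1)}.
Proof. by move=> cf; apply: (@cvg_comp _ _ _ fst f _ (nbhs q.1)); [exact: cvg_fst|exact: cf]. Qed.

Lemma continuous_comp_snd (T W W' : topologicalType) (f : W -> W') (q : T * W) :
  {for q.2, continuous f} -> {for q, continuous (fun s : T * W => f s.2)}.
Proof. by move=> cf; apply: (@cvg_comp _ _ _ snd f _ (nbhs q.2)); [exact: cvg_snd|exact: cf]. Qed.

End Compactness.

Section EuclideanSegments.
Context {R : realType} {n : nat}.
Local Notation V := 'rV[R]_n.

Lemma dot_unit_neq0 (v : V) : dot v v = 1 -> v != 0.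
Proof.
move=> v1; apply/eqP => v0; have : (1 : R) = 0; last by move/eqP; rewrite oner_eq0.
by rewrite -v1 v0 /dot big1// => i _; rewrite mxE mul0r.
Qed.

Lemma enorm_row (x : V) : enorm x = Num.sqrt (dot x x).
Proof. by rewrite /enorm big_ord_recl big_ord0 addr0; congr Num.sqrt; apply: eq_bigr => i _; rewrite expr2. Qed.

Lemma norm_le_enorm (x : V) : `|x| <= enorm x.
Proof.
rewrite enorm_row; apply: rV_norm_le => [|i]; first exact: sqrtr_ge0.
rewrite -sqrtr_sqr; apply: ler_wsqrtr; rewrite expr2 -expr2.
exact: sqr_coord_le_dot.
Qed.

Lemma eball_dot (x y : V) r : 0 < r -> eball x r y <-> dot (y - x) (y - x) < r ^+ 2.
Proof.
move=> r0; rewrite /eball /= enorm_row -{1}(ger0_norm (ltW r0)) -sqrtr_sqr ltr_sqrt//.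
by rewrite exprn_gt0.
Qed.

Lemma enormZ (t : R) (x : V) : enorm (t *: x) = `|t| * enorm x.
Proof.
rewrite !enorm_row dotZl dotZr mulrA -expr2 sqrtrM ?sqrtr_sqr//.
exact: sqr_ge0.
Qed.

Lemma enormN (x : V) : enorm (- x) = enorm x.
Proof. by rewrite -scaleN1r enormZ normrN1 mul1r. Qed.

Lemma segment_continuous (x v : V) t : {for t, continuous (fun t : R => x + t *: v)}.
Proof.
by apply: cvgD; [exact: cvg_cst|apply: cvgZ; [exact: cvg_id|exact: cvg_cst]].
Qed.

(** The least parameter at which the segment is outside Om exists by compactness; all earlier points
    are in Om, so this one is in its closure. *)
Lemma segment_meets_boundary (Om : set V) (x y : V) : open Om -> Om x -> ~ Om y ->
  exists2 t : R, 0 <= t <= 1 & boundary Om (x + t *: (y - x)).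
Proof.
move=> oOm Omx Omy.
pose f (t : R) := x + t *: (y - x).
have cf t : {for t, continuous f} by exact: segment_continuous.
have cT : compact [set t : R | 0 <= t <= 1 /\ ~ Om (f t)].
  apply: compact_closedI; first exact: interval_compact.
  by apply: (@preimage_closed _ _ f (~` Om)) => [t _|]; [exact: cf|exact: open_closedC].
have [||t] := @compact_EVT_min _ _ (fun t : R => t) _ _ cT.
- by exists 1; split; [rewrite ler01 lexx|rewrite /f scale1r addrC subrK].
- by apply: continuous_in_subspaceT => t _; exact: cvg_id.
rewrite inE => -[/andP[t0 t1] nt] tmin; exists t; first by rewrite t0 t1.
have tgt : 0 < t.
  rewrite lt_neqAle t0 andbT; apply: contra_not_neq nt => <-.
  by rewrite /f scale0r addr0.
split; last by move=> /interior_subset.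
move=> W /(cf t); rewrite /= => -[e/= e0 We].
have [s [s0 s1 s2]] : exists s, [/\ 0 < s, s < t & t - s < e].
  exists (Num.max (t / 2) (t - e / 2)); rewrite lt_max gt_max.
  have := @divr_gt0 _ t 2 tgt (ltr0n _ 2); have := @divr_gt0 _ e 2 e0 (ltr0n _ 2).
  move=> h1 h2; split.
  - by rewrite h2.
  - by apply/andP; split; move: h1 h2; lra.
  - by rewrite ltrBlDr -ltrBlDl lt_max; apply/orP; right; move: h1; lra.
exists (f s); split.
  apply: contrapT => ns; suff : t <= s by rewrite leNgt s1.
  by apply: tmin; rewrite inE; split => //; rewrite (ltW s0) (le_trans (ltW s1) t1).
by apply: We; rewrite /ball/= gtr0_norm// subr_gt0.
Qed.

Lemma edistance_ball (Om Om' : set V) (x y : V) : open Om -> Om' x -> Om x ->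
  enorm (y - x) < edistance Om' (boundary Om) -> Om y.
Proof.
move=> oOm Omx' Omx; apply: contraPP => Omy; apply/negP; rewrite -leNgt.
have [t /andP[t0 t1] bt] := segment_meets_boundary oOm Omx Omy.
apply: le_trans (_ : enorm (x - (x + t *: (y - x))) <= _).
  apply: ge_inf; last by exists x => //; exists (x + t *: (y - x)).
  by exists 0 => _ [a _ [b _ <-]]; exact: sqrtr_ge0.
by rewrite opprD addrA subrr add0r enormN enormZ ger0_norm// ler_piMl// sqrtr_ge0.
Qed.

(** Boundedness and n > 0 make the boundary nonempty; otherwise the infimum would be the default 0
    of the empty set. *)
Lemma edistance_gt0 (Om Om' : set V) : (0 < n)%N -> open Om -> bounded_set Om ->
  Om' !=set0 -> compactly_contained Om' Om -> 0 < edistance Om' (boundary Om).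
Proof.
move=> n0 oOm [M [_ bM]] [x Omx'] [cK KO].
have Omx : Om x by apply: KO; exact: subset_closure.
have [ep ep0 Hep] := compact_margin cK oOm KO.
have [y Omy] : exists y, ~ Om y.
  exists (const_mx (`|M| + 2)) => /(bM (`|M| + 1)); rewrite (le_lt_trans (ler_norm M)) ?ltrDl//.
  move=> /(_ isT); apply/negP; rewrite -ltNge.
  have := rV_coord_le (const_mx (`|M| + 2) : V) (Ordinal n0); rewrite mxE ger0_norm; last by rewrite addr_ge0.
  by apply: lt_le_trans; rewrite ltrD2l ltr1n.
have [t _ bt] := segment_meets_boundary oOm Omx Omy.
apply: lt_le_trans ep0 _; apply: lb_le_inf.
  by exists (enorm (x - (x + t *: (y - x)))); exists x => //; exists (x + t *: (y - x)).
move=> _ [a Oma [b [_ nb] <-]]; apply: le_trans (norm_le_enorm _).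
rewrite leNgt; apply/negP => /ltW ab; apply: nb.
rewrite (interior_id Om).1//; apply: (Hep a) => //; exact: subset_closure.
Qed.

Lemma qform_unitv (M : 'M[R]_n) i j : qform M (unitv i) (unitv j) = M i j.
Proof.
rewrite /qform (bigD1 i)//= [X in _ + X]big1 => [|k ki].
  rewrite addr0 (bigD1 j)//= [X in _ + X]big1 => [|k kj].
    by rewrite !mxE !eqxx !mulr1 addr0.
  by rewrite !mxE (negbTE kj) andbF mulr0.
by rewrite big1// => l _; rewrite !mxE (negbTE ki) andbF mulr0 mul0r.
Qed.

(** Testing the form on the sum and difference of two coordinate vectors bounds 2 |M_ij| by M_ii +
    M_jj. *)
Lemma psd_entry_le (M : 'M[R]_n) (b : R) : mxsymmetric M -> (forall v, 0 <= qform M v v) ->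
  (forall i, M i i <= b) -> forall i j, `|M i j| <= b.
Proof.
move=> sN pos Nb i j; have := pos (unitv i - unitv j); have := pos (unitv i + unitv j).
rewrite -scaleN1r !qformDl !qformDr !qformZl !qformZr !qform_unitv (sN j i).
have := Nb i; have := Nb j; rewrite ler_norml.
move: (M i i) (M j j) (M i j) => a d e h1 h2 h3 h4.
by apply/andP; split; move: h1 h2 h3 h4; lra.
Qed.

Lemma dot_unitv (i j : 'I_n) : dot (unitv i) (unitv j : V) = (i == j)%:R.
Proof.
rewrite /dot (bigD1 i)//= [X in _ + X]big1 => [|k ki].
  by rewrite !mxE !eqxx mul1r addr0.
by rewrite !mxE (negbTE ki) andbF mul0r.
Qed.

Lemma enorm_entries (M : 'M[R]_n) (b : R) : 0 <= b -> (forall i j, `|M i j| <= b) ->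
  enorm M <= n%:R * b.
Proof.
move=> b0 Mb; rewrite -[leRHS]ger0_norm ?mulr_ge0// -sqrtr_sqr; apply: ler_wsqrtr.
apply: le_trans (_ : \sum_(i < n) \sum_(j < n) b ^+ 2 <= _).
  apply: ler_sum => i _; apply: ler_sum => j _.
  by rewrite -(real_normK (num_real (M i j))) lerXn2r// nnegrE.
by rewrite !sumr_const !card_ord -mulrnA exprMn -natrX mulr_natl mulnn.
Qed.

End EuclideanSegments.

(** * Uniform constants on the jet set *)

Section GeneratingFunction.
Context {R : realType} {n : nat}.
Local Notation V := 'rV[R]_n.
Local Notation X := (V * R * V)%type.
Local Notation G := (V * V * R)%type.

Definition dirx (v : V) : G := (v, 0, 0).
Definition dirz : G := (0, 0, 1).

Lemma derive_fiberx (W : normedModType R) (F : G -> W) (y : V) (z : R) (v : V) :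
  'D_v (fun x : V => F (x, y, z)) = (fun x => 'D_(dirx v) F (x, y, z)).
Proof.
apply/funext => x.
have E : (fun h : R => h^-1 *: (((fun x : V => F (x, y, z)) \o shift x) (h *: v) - F (x, y, z))) =
    (fun h => h^-1 *: ((F \o shift ((x, y, z) : G)) (h *: dirx v) - F (x, y, z))).
  apply/funext => h /=; do 3 f_equal; rewrite /dirx.
  transitivity ((h *: v + x, h *: (0 : V) + y, h * 0 + z) : G); last by [].
  by rewrite scaler0 mulr0 !add0r.
by with_strategy transparent [derive] rewrite /derive E.
Qed.

Lemma derive_fiberz (W : normedModType R) (F : G -> W) (x y : V) :
  'D_(1 : R) (fun z : R => F (x, y, z)) = (fun z => 'D_dirz F (x, y, z)).
Proof.
apply/funext => z.
have E : (fun h : R => h^-1 *: (((fun z : R => F (x, y, z)) \o shift z) (h *: (1 : R)) - F (x, y, z))) =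
    (fun h => h^-1 *: ((F \o shift ((x, y, z) : G)) (h *: dirz) - F (x, y, z))).
  apply/funext => h /=; do 3 f_equal; rewrite /dirz.
  transitivity ((h *: (0 : V) + x, h *: (0 : V) + y, h * 1 + z) : G); last by [].
  by rewrite !scaler0 !add0r.
by with_strategy transparent [derive] rewrite /derive E.
Qed.

Context (Gam : set G) (g : G -> R) (Y : X -> V) (Z : X -> R).
Context (hg : generating_function Gam g) (hYZ : dual_maps Gam g Y Z).
Local Notation U := (jetset Gam g).
Local Notation A := (matA g Y Z).

(** [toJ] and [ofJ] are mutually inverse between Gam and the jet set, and A composed with [toJ] is
    g_xx ([matA_toJ]). *)
Definition toJ (P : G) : X := (P.1.1, g P, gx g P).
Definition ofJ (q : X) : G := (q.1.1, Y q, Z q).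

Lemma gx_coord (P : G) i : gx g P 0 i = 'D_(dirx (unitv i)) g P.
Proof.
case: P => [[x y] z]; rewrite /gx mxE /=.
exact: (congr1 (fun h => h x) (derive_fiberx g y z (unitv i))).
Qed.

Lemma gzE (P : G) : gz g P = 'D_dirz g P.
Proof.
case: P => [[x y] z]; rewrite /gz derive1E /=.
exact: (congr1 (fun h => h z) (derive_fiberz g x y)).
Qed.

Lemma gxx_coord (P : G) i j : gxx g P i j = 'D_(dirx (unitv i)) ('D_(dirx (unitv j)) g) P.
Proof.
case: P => [[x y] z]; rewrite /gxx mxE /= (derive_fiberx g y z (unitv j)).
exact: (congr1 (fun h => h x) (derive_fiberx ('D_(dirx (unitv j)) g) y z (unitv i))).
Qed.

Let oGam : open Gam. Proof. by case: hg => -[]. Qed.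
Let cg : class_C 2 Gam g. Proof. by case: hg. Qed.

Lemma dirxE (v : V) : dirx v = \sum_i v 0 i *: dirx (unitv i).
Proof.
have E (I : Type) (s : seq I) (f : I -> V) : \sum_(i <- s) dirx (f i) = dirx (\sum_(i <- s) f i).
  elim: s => [|i s IH]; first by rewrite !big_nil.
  rewrite !big_cons IH.
  transitivity ((f i + \sum_(j <- s) f j, (0 : V) + 0, (0 : R) + 0) : G); first by [].
  by rewrite !addr0.
rewrite -{1}(sum_unitv v) -E; apply: eq_bigr => i _.
transitivity ((v 0 i *: unitv i, v 0 i *: (0 : V), v 0 i * 0) : G); last by [].
by rewrite scaler0 mulr0.
Qed.

Lemma gxx_qform (P : G) v w : Gam P ->
  qform (gxx g P) v w = 'D_(dirx v) ('D_(dirx w) g) P.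
Proof.
move=> GP; rewrite (dirxE w) (derive2_comb _ _ _ (dirx v) oGam cg GP).
rewrite /qform exchange_big; apply: eq_bigr => j _.
rewrite (dirxE v) derive_comb; last exact: (cg.2 (dirx (unitv j))).1.
rewrite mulr_sumr; apply: eq_bigr => i _; rewrite gxx_coord.
by move: ('D__ _ _) => d; ring.
Qed.

Lemma gxx_sym (P : G) : Gam P -> mxsymmetric (gxx g P).
Proof. by move=> GP i j; rewrite !gxx_coord; exact: (schwarz _ _ oGam cg GP). Qed.

Lemma ofJ_in q : U q -> Gam (ofJ q).
Proof. by case: hYZ => h _ _; case: q => [[x u] p] /h/(_ (Y (x, u, p)) (Z (x, u, p)))[_ /(_ (conj erefl erefl))[]]. Qed.

Lemma toJ_ofJ q : U q -> toJ (ofJ q) = q.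
Proof.
case: hYZ => h _ _; case: q => [[x u] p] /h/(_ (Y (x, u, p)) (Z (x, u, p)))[_ /(_ (conj erefl erefl))[_ [e1 e2]]].
by rewrite /toJ /ofJ /= e1 e2.
Qed.

Lemma toJ_in P : Gam P -> U (toJ P).
Proof. by move=> GP; exists P. Qed.

Lemma ofJ_toJ P : Gam P -> ofJ (toJ P) = P.
Proof.
move=> GP; case: hYZ => h _ _; have UP := toJ_in GP.
case: P GP UP => [[x y] z] GP UP.
have [/(_ (conj GP (conj erefl erefl)))[e1 e2] _] := h _ _ _ UP y z.
by rewrite /ofJ /toJ /= -e1 -e2.
Qed.

Lemma matA_toJ P : Gam P -> A (toJ P) = gxx g P.
Proof. by move=> GP; rewrite /matA -[in RHS](ofJ_toJ GP). Qed.

Lemma matA_sym q : U q -> mxsymmetric (A q).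
Proof. by move=> Uq; exact: gxx_sym (ofJ_in Uq). Qed.

Context (B : X -> R) (U0 : set X).
Context (hconv : forall x u, convex_set [set p | U (x, u, p)]).
Context (hA : forall i j, class_C 2 U (fun q => A q i j)).
Context (hB : class_C 2 U B) (hBpos : forall q, U q -> 0 < B q).
Context (hU0 : compactly_contained U0 U).
Let K0 := closure U0.
Let cK0 : compact K0. Proof. by case: hU0. Qed.
Let K0U : K0 `<=` U. Proof. by case: hU0. Qed.

(** The points at which g is compared with u: y is frozen at Y q, while x runs over a small ball and
    z over an interval around Z q. *)
Definition fat (ep : R) : set G := [set P | exists q, [/\ K0 q, `|P.1.1 - q.1.1| <= ep,
  P.1.2 = Y q & `|P.2 - Z q| <= ep]].

Lemma pair_continuous (T W1 W2 : topologicalType) (f : T -> W1) (h : T -> W2) (t : T) :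
  {for t, continuous f} -> {for t, continuous h} -> {for t, continuous (fun s => (f s, h s))}.
Proof. by move=> cf ch; exact: cvg_pair. Qed.

Lemma cball_compact (ep : R) : compact [set a : V | `|a| <= ep].
Proof.
apply: bounded_closed_compact.
  exists ep; split=> [|r er a /= ae]; first exact: num_real.
  by apply: le_trans ae _; exact: ltW.
rewrite (_ : [set a | _] = (fun a : V => `|a|) @^-1` [set r | r <= ep])//.
by apply: preimage_closed; [move=> a _; exact: norm_continuous|exact: closed_le].
Qed.

Let cYZ q : U q -> {for q, continuous Y} /\ {for q, continuous Z}.
Proof.
case: hYZ => _ [dY _] [dZ _] Uq.
by split; apply: differentiable_continuous; [exact: dY|exact: dZ].
Qed.

Let cofJ q : U q -> {for q, continuous ofJ}.
Proof.
move=> /cYZ[cY cZ]; apply: (@cvg_pair _ _ _ (nbhs q) (nbhs (q.1.1, Y q)) (nbhs (Z q))); last exact: cZ.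
apply: (@cvg_pair _ _ _ (nbhs q) (nbhs q.1.1) (nbhs (Y q))); last exact: cY.
apply: (@cvg_comp _ _ _ fst fst _ (nbhs q.1)); exact: cvg_fst.
Qed.

Lemma fat_compact (ep : R) : compact (fat ep).
Proof.
pose f (t : X * V * R) : G := (t.1.1.1.1 + t.1.2, Y t.1.1, Z t.1.1 + t.2).
have -> : fat ep = f @` ((K0 `*` [set a : V | `|a| <= ep]) `*` [set b : R | - ep <= b <= ep]).
  apply/seteqP; split.
    move=> [[x y] z] [q [Kq /= xq -> zq]].
    exists ((q, x - q.1.1), z - Z q) => //=.
      by split=> //=; rewrite -ler_norml.
    by rewrite /f /= addrC subrK [_ + (z - _)]addrC subrK.
  move=> _ [[[q a] b] [[/= Kq ae] be] <-]; exists q; split => //=.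
    by rewrite addrAC subrr add0r.
  by rewrite addrAC subrr add0r ler_norml.
apply: compact_image.
  apply: compact_setX; last exact: interval_compact.
  by apply: compact_setX; [exact: cK0|exact: cball_compact].
move=> [[q a] b] [[/= Kq _] _]; have [cY cZ] := cYZ (K0U Kq).
have lift (W : topologicalType) (k : X -> W) : {for q, continuous k} ->
    {for (q, a, b), continuous (fun t : X * V * R => k t.1.1)}.
  by move=> ck; exact: (@continuous_comp_fst _ R _ (fun s : X * V => k s.1) (q, a, b) (continuous_comp_fst (q := (q, a)) ck)).
apply: pair_continuous; last by apply: cvgD; [exact: lift cZ|exact: cvg_snd].
apply: pair_continuous; last exact: lift cY.
apply: cvgD; first exact: lift _ (continuous_comp_fst (q := q) cvg_fst).
exact: (@continuous_comp_fst _ R _ snd (q, a, b) cvg_snd).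
Qed.

Lemma fat_margin : exists2 ep : R, 0 < ep & fat ep `<=` Gam.
Proof.
have cK : compact (ofJ @` K0).
  by apply: compact_image => [|q Kq]; [exact: cK0|exact/cofJ/K0U].
have [|ep ep0 Hep] := compact_margin cK oGam.
  by move=> _ [q Kq <-]; exact/ofJ_in/K0U.
exists ep => // -[[x y] z] [q [Kq /= xq -> zq]].
apply: (Hep (ofJ q)); first by exists q.
rewrite prod_normE /= prod_normE /= !ge_max.
by rewrite distrC xq subrr normr0 ltW//= distrC.
Qed.

Lemma toJ_continuous P : Gam P -> {for P, continuous toJ}.
Proof.
move=> GP; apply: pair_continuous.
  apply: pair_continuous.
    by apply: (@cvg_comp _ _ _ fst fst _ (nbhs P.1)); exact: cvg_fst.
  by apply: differentiable_continuous; exact: cg.1.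
have gE : gx g = \sum_i (fun Q => 'D_(dirx (unitv i)) g Q *: unitv i).
  apply/funext => Q; rewrite fct_sumE -[LHS]sum_unitv; apply: eq_bigr => i _.
  by rewrite gx_coord.
apply: differentiable_continuous; rewrite gE; apply: differentiable_sum => i.
by apply: differentiableZl; exact: (cg.2 _).1.
Qed.

(* A is compared at two jets over the same (x, u) along the segment joining
   them, which stays in the jet set by convexity in p. *)
Definition segs (K1 : set X) : set X := [set q | exists q0 q1 t, [/\ K0 q0, K1 q1, q0.1 = q1.1,
  0 <= t <= 1 & q = (q0.1.1, q0.1.2, q0.2 + t *: (q1.2 - q0.2))]].

Lemma segs_compact (K1 : set X) : compact K1 -> compact (segs K1).
Proof.
move=> cK1; pose f (t : X * X * R) : X := (t.1.1.1.1, t.1.1.1.2, t.1.1.2 + t.2 *: (t.1.2.2 - t.1.1.2)).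
pose D : set (X * X * R) := (K0 `*` K1) `*` [set t : R | 0 <= t <= 1].
(* The condition that both jets lie over the same (x, u), written as a closed condition. *)
pose E : set (X * X * R) := (fun t => `|t.1.1.1 - t.1.2.1|) @^-1` [set 0].
have pr (W : topologicalType) (h : X -> W) (t : X * X * R) :
    {for t.1.1, continuous h} -> {for t.1.2, continuous h} ->
    {for t, continuous (fun t : X * X * R => h t.1.1)} /\ {for t, continuous (fun t : X * X * R => h t.1.2)}.
  move=> c1 c2; split; first exact: (@continuous_comp_fst _ R _ (fun s : X * X => h s.1) t (continuous_comp_fst c1)).
  exact: (@continuous_comp_fst _ R _ (fun s : X * X => h s.2) t (continuous_comp_snd c2)).
have -> : segs K1 = f @` (D `&` E).
  apply/seteqP; split.
    move=> _ [q0 [q1 [t [Kq0 Kq1 e t01 ->]]]]; exists ((q0, q1), t) => //.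
    by split=> //; rewrite /E /= e subrr normr0.
  move=> _ [[[q0 q1] t] [[[/= Kq0 Kq1] t01] /= e] <-].
  by exists q0, q1, t; split => //; apply/eqP; rewrite -subr_eq0 -normr_eq0 e.
apply: compact_image.
  apply: compact_closedI; first by apply: compact_setX; [apply: compact_setX|exact: interval_compact].
  apply: preimage_closed => [t _|]; last exact: closed_eq.
  by apply: cvg_norm; have [h1 h2] := pr _ fst t cvg_fst cvg_fst; exact: cvgB.
move=> t _; have [d1 _] := pr _ fst t cvg_fst cvg_fst; have [e1 e2] := pr _ snd t cvg_snd cvg_snd.
apply: pair_continuous.
  apply: pair_continuous.
    exact: (@continuous_comp _ _ _ (fun t : X * X * R => t.1.1.1) fst _ d1 cvg_fst).
  exact: (@continuous_comp _ _ _ (fun t : X * X * R => t.1.1.1) snd _ d1 cvg_snd).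
apply: cvgD; first exact: e1.
by apply: cvgZ; [exact: cvg_snd|apply: cvgB].
Qed.

Lemma segs_sub (K1 : set X) : K1 `<=` U -> segs K1 `<=` U.
Proof.
move=> K1U _ [[[x u] p] [[[x1 u1] p1] [t [Kq0 Kq1 /= [ex eu] t01 ->]]]].
rewrite -ex -eu in Kq1.
move: t01 => /andP[t0 t1].
have := hconv (Itv01 t0 t1) (mem_set (K1U _ Kq1)) (mem_set (K0U Kq0)).
rewrite inE /=; congr (U (x, u, _)).
transitivity (t *: p1 + (1 - t) *: p); first by [].
by rewrite scalerBl scale1r scalerBr addrCA.
Qed.

Lemma finite_upper_bound (l : seq R) : exists D, all (fun d => d <= D) l.
Proof.
elim: l => [|d l [D HD]]; first by exists 0.
exists (Num.max d D); rewrite /= le_max lexx /=.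
by apply: sub_all HD => e /le_trans; apply; rewrite le_max lexx orbT.
Qed.

Lemma family_bound (T : topologicalType) (I : finType) (f : I -> T -> R) (K : set T) :
  compact K -> (forall i x, K x -> {for x, continuous (f i)}) ->
  exists c, 0 <= c /\ forall i x, K x -> `|f i x| <= c.
Proof.
move=> cK cf; apply: (@fin_bound _ I (fun i c => forall x, K x -> `|f i x| <= c)).
  by move=> i c d cd h x Kx; apply: le_trans (h x Kx) cd.
by move=> i; apply: compact_fun_bound cK (cf i).
Qed.

(** Everything is taken over compact sets built from [K0], hence independent of u and Om. First
    derivatives of A are also bounded on the image of [fat ep], where z moves, and second ones on
    the segments, where p moves. *)
Record uniform_bounds (D ep c : R) : Prop := {
  ub_n : n%:R + n%:R + 2 <= D;
  ub_ep : 0 < ep;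
  ub_c : 0 < c;
  ub_fat : fat ep `<=` Gam;
  ub_A : forall q i j, K0 q -> `|A q i j| <= D;
  ub_A1 : forall q i j k, K0 q \/ (toJ @` fat ep) q -> `|'D_(bas k) (fun q => A q i j) q| <= D;
  ub_A2 : forall q i j k l, K0 q \/ segs (toJ @` fat ep) q ->
    `|'D_(bas l) ('D_(bas k) (fun q => A q i j)) q| <= D;
  ub_B1 : forall q k, K0 q -> `|'D_(bas k) B q| <= D;
  ub_B2 : forall q k l, K0 q -> `|'D_(bas l) ('D_(bas k) B) q| <= D;
  ub_Bi : forall q, K0 q -> (B q)^-1 <= D;
  ub_p : forall q i, K0 q -> `|q.2 0 i| <= D;
  ub_gx : forall P i, fat ep P -> `|'D_(dirx (unitv i)) g P| <= D;
  ub_gz : forall P, fat ep P -> `|'D_dirz g P| <= D;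
  ub_gzc : forall P, fat ep P -> c <= - 'D_dirz g P;
  ub_gxz : forall P i, fat ep P -> `|'D_dirz ('D_(dirx (unitv i)) g) P| <= D }.

Lemma uniform_bounds_exist : exists D ep c, uniform_bounds D ep c.
Proof.
have [ep ep0 fG] := fat_margin.
have cf := @fat_compact ep.
have cK1 : compact (toJ @` fat ep).
  by apply: compact_image cf _ => P fP; exact/toJ_continuous/fG.
have K1U : toJ @` fat ep `<=` U by move=> _ [P fP <-]; exact/toJ_in/fG.
have cS := @segs_compact _ cK1.
have SU := segs_sub K1U.
have K01U q : (K0 `|` toJ @` fat ep) q -> U q by case=> [/K0U|/K1U].
have K0SU q : (K0 `|` segs (toJ @` fat ep)) q -> U q by case=> [/K0U|/SU].
have c01 := compactU cK0 cK1; have c0S := compactU cK0 cS.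
have gC P (fP : fat ep P) v : {for P, continuous ('D_v g)}.
  by apply: differentiable_continuous; exact: (cg.2 v).1 (fG _ fP).
have [c [c0 Hc]] : exists c, 0 < c /\ forall P, fat ep P -> c <= - 'D_dirz g P.
  apply: compact_fun_min cf _ _ => P fP; first by apply: cvgN; exact: gC.
  by rewrite oppr_gt0 -gzE; case: hg => _ _ _; apply; exact: fG.
have [d1 [_ H1]] := @family_bound _ ('I_n * 'I_n)%type (fun ij q => A q ij.1 ij.2) K0 cK0
  (fun ij q Kq => differentiable_continuous ((hA ij.1 ij.2).1 q (K0U Kq))).
have [d2 [_ H2]] := @family_bound _ ('I_n * 'I_n * ('I_n + unit + 'I_n))%type
  (fun t q => 'D_(bas t.2) (fun q => A q t.1.1 t.1.2) q) _ c01
  (fun t q Kq => differentiable_continuous (((hA t.1.1 t.1.2).2 (bas t.2)).1 q (K01U q Kq))).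
have [d3 [_ H3]] := @family_bound _ ('I_n * 'I_n * ('I_n + unit + 'I_n) * ('I_n + unit + 'I_n))%type
  (fun t q => 'D_(bas t.2) ('D_(bas t.1.2) (fun q => A q t.1.1.1 t.1.1.2)) q) _ c0S
  (fun t q Kq => ((hA t.1.1.1 t.1.1.2).2 (bas t.1.2)).2 (bas t.2) q (K0SU q Kq)).
have [d4 [_ H4]] := @family_bound _ ('I_n + unit + 'I_n)%type
  (fun k q => 'D_(bas k) B q) _ cK0
  (fun k q Kq => differentiable_continuous ((hB.2 (bas k)).1 q (K0U Kq))).
have [d5 [_ H5]] := @family_bound _ (('I_n + unit + 'I_n) * ('I_n + unit + 'I_n))%type
  (fun t q => 'D_(bas t.2) ('D_(bas t.1) B) q) _ cK0
  (fun t q Kq => (hB.2 (bas t.1)).2 (bas t.2) q (K0U Kq)).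
have [d6 H6] : exists c, forall q, K0 q -> `|(B q)^-1| <= c.
  apply: compact_fun_bound cK0 _ => q Kq; apply: continuousV.
    by rewrite gt_eqF// hBpos//; exact: K0U.
  by apply: differentiable_continuous; exact: hB.1 (K0U Kq).
have [d7 [_ H7]] : exists c, 0 <= c /\ forall i q, K0 q -> `|q.2 0 i| <= c.
  apply: (@family_bound _ _ (fun i (q : X) => q.2 0 i) _ cK0) => i q _.
  apply: (@cvg_comp _ _ _ snd (fun p : V => p 0 i) _ (nbhs q.2)); first exact: cvg_snd.
  exact: continuous_coord.
have [d8 [_ H8]] := @family_bound _ _ (fun i P => 'D_(dirx (unitv i)) g P) _ cf
  (fun i P fP => gC P fP _).
have [d9 H9] := compact_fun_bound cf (fun P fP => gC P fP dirz).
have [e10 [_ H10]] := @family_bound _ _ (fun i P => 'D_dirz ('D_(dirx (unitv i)) g) P) _ cf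
  (fun i P fP => (cg.2 (dirx (unitv i))).2 dirz P (fG P fP)).
have [D] := finite_upper_bound [:: n%:R + n%:R + 2; d1; d2; d3; d4; d5; d6; d7; d8; d9; e10].
rewrite /= => /and5P[le0 le1 le2 le3 /and5P[le4 le5 le6 le7 /and4P[le8 le9 le10 _]]].
exists D, ep, c; split => //.
- by move=> q i j Kq; exact: le_trans (H1 (i, j) q Kq) le1.
- by move=> q i j k Kq; exact: le_trans (H2 (i, j, k) q Kq) le2.
- by move=> q i j k l Kq; exact: le_trans (H3 (i, j, k, l) q Kq) le3.
- by move=> q k Kq; exact: le_trans (H4 k q Kq) le4.
- by move=> q k l Kq; exact: le_trans (H5 (k, l) q Kq) le5.
- by move=> q Kq; exact: le_trans (le_trans (ler_norm _) (H6 q Kq)) le6.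
- by move=> q i Kq; exact: le_trans (H7 i q Kq) le7.
- by move=> P i fP; exact: le_trans (H8 i P fP) le8.
- by move=> P fP; exact: le_trans (H9 P fP) le9.
- by move=> P i fP; exact: le_trans (H10 i P fP) le10.
Qed.

Context (hreg : regular U A).

Local Opaque matA.

Lemma final_arith (a1 sz st q1 qa qh v1 vh m1 m2 b4 b5 b6 b7 b8 : R) :
  - a1 <= q1 - qa - sz -> v1 = q1 -> vh = qh -> `|v1 - vh| <= b8 -> `|sz - st| <= b8 ->
  a1 <= b4 + b5 -> b7 <= m1 -> b4 <= m2 -> 2 * b5 <= b6 -> 2 * b6 <= b7 -> b8 <= b5 -> 0 <= b5 ->
  - m1 - m2 <= qh - qa - st.
Proof.
move=> tay' -> ->; rewrite !ler_norml => /andP[_ h1] /andP[h2 _] h3 h4 h5 h6 h7 h8 h9.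
by move: tay' h1 h2 h3 h4 h5 h6 h7 h8 h9; lra.
Qed.

(** * Comparison of g with u over one point *)

Section Comparison.
Context (D ep c : R) (ub : uniform_bounds D ep c).
Context (q0 : X) (Kq0 : K0 q0) (x : V) (ux : R) (p : V) (Kq : K0 (x, ux, p)).
Context (h : R) (h0 : 0 <= h) (hep : h <= ep) (xep : `|x - q0.1.1| <= ep).
Let y0 := Y q0.
Let z0 := Z q0.
Let zh := z0 - h.
Context (eta0 : ux < g (x, y0, zh)) (etaep : g (x, y0, z0 + ep) <= ux).
Let eta := g (x, y0, zh) - ux.
Let th := gx g (x, y0, zh) - p.

Let D2 : 2 <= D. Proof. by have := ub_n ub; have := ler0n R n; lra. Qed.
Let D1 : 1 <= D. Proof. by move: D2; lra. Qed.
Let D0 : 0 <= D. Proof. by move: D2; lra. Qed.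
Let nD : n%:R <= D. Proof. by have := ub_n ub; have := ler0n R n; lra. Qed.
Let n2D : n%:R + 2 <= D. Proof. by have := ub_n ub; have := ler0n R n; lra. Qed.
Let c0 : 0 < c. Proof. exact: ub_c ub. Qed.

Let P (z : R) : G := (x, y0, z).

Let Pfat z : zh <= z -> z <= z0 + ep -> fat ep (P z).
Proof.
move=> z1 z2; exists q0; split => //=; rewrite ler_norml; apply/andP; split.
  by move: z1 hep; rewrite /zh /z0; lra.
by move: z2; rewrite /z0; lra.
Qed.

Let PG z : zh <= z -> z <= z0 + ep -> Gam (P z).
Proof. by move=> z1 z2; exact/(ub_fat ub)/Pfat. Qed.

Let PE (z : R) : P z = (x, y0, 0) + z *: dirz.
Proof.
transitivity ((x + z *: (0 : V), y0 + z *: (0 : V), 0 + z * 1) : G); last by [].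
by rewrite !scaler0 !addr0 add0r mulr1.
Qed.

Let dP (F : G -> R) z : differentiable F (P z) ->
  is_derive z (1 : R) (fun s => F (P s)) ('D_dirz F (P z)).
Proof.
rewrite PE => dF.
have -> : (fun s => F (P s)) = (fun s => F ((x, y0, 0) + s *: dirz)).
  by apply/funext => s; rewrite PE.
exact/is_derive_line/derivableP/diff_derivable.
Qed.

Let dg z (v : G) : zh <= z -> z <= z0 + ep -> differentiable ('D_v g) (P z).
Proof. by move=> z1 z2; exact: (cg.2 v).1 (PG z1 z2). Qed.

Let zhep : zh <= z0 + ep. Proof. by rewrite /zh; move: h0 (ub_ep ub); lra. Qed.

(* Lowering z0 - h to the level z' at which g(x, y0, .) meets u(x) makes the two
   jets share (x, u(x)), so that only p varies; the cost is linear in eta. *)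
Let level : exists z', [/\ zh <= z', z' <= z0 + ep, g (P z') = ux & c * (z' - zh) <= eta].
Proof.
have dgz z : zh <= z -> z <= z0 + ep -> is_derive z (1 : R) (fun s => g (P s)) ('D_dirz g (P z)).
  by move=> z1 z2; apply: dP; exact: cg.1 (PG z1 z2).
have cgz a b : zh <= a -> b <= z0 + ep -> {within `[a, b], continuous (fun s => g (P s))}.
  move=> ah bh; apply: continuous_in_subspaceT => t; rewrite inE/= in_itv/= => /andP[t1 t2].
  apply/differentiable_continuous/derivable1_diffP.
  by have [] := dgz t (le_trans ah t1) (le_trans t2 bh).
have [||z' zin gz'] := @IVT R (fun s => g (P s)) zh (z0 + ep) ux zhep.
- exact: cgz.
- by rewrite ge_min le_max etaep (ltW eta0) orbT.
move: zin; rewrite in_itv/= => /andP[z1 z2]; exists z'; split => //.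
have [||t] := @MVT_segment R (fun s => g (P s)) (fun s => 'D_dirz g (P s)) zh z' z1.
- move=> t; rewrite in_itv/= => /andP[t1 t2]; apply: dgz; first exact: ltW.
  by apply: le_trans z2; exact: ltW.
- exact: cgz.
rewrite in_itv/= => /andP[t1 t2]; rewrite gz' => E.
rewrite /eta (_ : g (x, y0, zh) - ux = - 'D_dirz g (P t) * (z' - zh)).
  rewrite ler_wpM2r ?subr_ge0//; apply: (ub_gzc ub); apply: Pfat => //.
  exact: le_trans z2.
by rewrite mulNr -E opprB.
Qed.

(** The power of D collects the Taylor errors; 1 / c converts the shift in z into a multiple of eta,
    by [level]. *)
Let M := D ^+ 12 * (1 + c^-1).

Let XD k : 0 <= D ^+ k. Proof. exact: exprn_ge0. Qed.
Let powD1 (j k : nat) : (j <= k)%N -> D ^+ j <= D ^+ k.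
Proof. by move=> jk; rewrite ler_weXn2l. Qed.

Let sumD (f : 'I_n -> R) (d : R) : 0 <= d -> (forall i, `|f i| <= d) -> `|\sum_i f i| <= D * d.
Proof.
by move=> d0 fd; apply: le_trans (sum_norm_ord fd) _; rewrite ler_wpM2r.
Qed.

Let sumKD (f : ('I_n + unit + 'I_n)%type -> R) (d : R) : 0 <= d -> (forall i, `|f i| <= d) ->
  `|\sum_i f i| <= D * d.
Proof.
move=> d0 fd; apply: le_trans (sum_norm_le fd) _; rewrite ler_wpM2r//.
by rewrite !card_sum !card_ord card_unit !natrD; have := ub_n ub; have := ler0n R n; lra.
Qed.

Let mulD (a b e d : R) : `|a| <= e -> `|b| <= d -> `|a * b| <= e * d.
Proof. by move=> h1 h2; rewrite normrM; apply: ler_pM. Qed.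

Context (xi : V) (xi1 : dot xi xi = 1).

Let phi (z : R) := qform (A (toJ (P z))) xi xi.

Let qformD (N : 'M[R]_n) d : 0 <= d -> (forall i j, `|N i j| <= d) -> `|qform N xi xi| <= D ^+ 2 * d.
Proof.
move=> d0 Nd; rewrite expr2 -mulrA; apply: sumD; first by rewrite mulr_ge0.
move=> i; apply: sumD => // j; rewrite -[d]mulr1 -[d]mulr1.
by apply: mulD; [apply: mulD => //|]; exact: unit_coord_le.
Qed.

Let co' (z : R) (k : ('I_n + unit + 'I_n)%type) : R :=
  match k with
  | inl (inl _) => 0
  | inl (inr _) => 'D_dirz g (P z)
  | inr i => 'D_dirz ('D_(dirx (unitv i)) g) (P z)
  end.

Let dphi z : zh <= z -> z <= z0 + ep -> is_derive z (1 : R) phi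
  (qform (\matrix_(i, j) \sum_k co' z k * 'D_(bas k) (fun q => A q i j) (toJ (P z))) xi xi).
Proof.
move=> z1 z2.
have dc k : is_derive z (1 : R) (fun s => co (toJ (P s)) k) (co' z k).
  case: k => [[i|[]]|i] /=.
  - exact: is_derive_cst.
  - by apply: dP; exact: cg.1 (PG z1 z2).
  - have -> : (fun s => gx g (P s) 0 i) = (fun s => 'D_(dirx (unitv i)) g (P s)).
      by apply/funext => s; rewrite gx_coord.
    by apply: dP; exact: dg.
have UP : U (toJ (P z)) by exact/toJ_in/PG.
apply: is_derive_bigsum => i; apply: is_derive_bigsum => j.
have dA : differentiable (fun q => A q i j) (\sum_k co (toJ (P z)) k *: bas k).
  by rewrite co_bas; exact: (hA i j).1 UP.
have := @is_derive_chain R X _ (index_enum _) bas _ _ z _ dc dA.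
have -> : (fun r => (fun q => A q i j) (\sum_k co (toJ (P r)) k *: bas k)) = (fun r => A (toJ (P r)) i j).
  by apply/funext => r; rewrite co_bas.
rewrite co_bas => dd.
have h1 := is_deriveM (is_deriveM dd (is_derive_cst (xi 0 i) z (1 : R))) (is_derive_cst (xi 0 j) z (1 : R)).
apply: is_derive_eq h1 _; rewrite !scaler0 !add0r mxE /GRing.scale/=.
by move: (\sum_k _) => S; ring.
Qed.

Let nn0 : 0 <= n%:R ^+ 2 * (n%:R + 2) * (n%:R ^+ 2 * D).
Proof. by rewrite !mulr_ge0// ?sqr_ge0// addr_ge0. Qed.

Let nnD : n%:R ^+ 2 * (n%:R + 2) * (n%:R ^+ 2 * D) <= D ^+ 2 * D * (D ^+ 2 * D).
Proof.
have s0 : 0 <= n%:R ^+ 2 :> R by exact: sqr_ge0.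
have s1 : n%:R ^+ 2 <= D ^+ 2 by rewrite lerXn2r ?nnegrE.
have s2 : 0 <= n%:R + 2 :> R by rewrite addr_ge0.
have w1 : n%:R ^+ 2 * (n%:R + 2) <= D ^+ 2 * D by exact: ler_pM.
have w2 : n%:R ^+ 2 * D <= D ^+ 2 * D by exact: ler_pM.
by apply: ler_pM => //; exact: mulr_ge0.
Qed.

Let tri (a b t : R) : `|a - b| <= t -> `|a| <= `|b| + t.
Proof.
move=> h1; rewrite (_ : a = b + (a - b)); last by ring.
by apply: le_trans (ler_normD _ _) _; rewrite lerD2l.
Qed.

Let D8 (a b : R) : D ^+ 8 * (a + D ^+ 2 * b) = D ^+ 8 * a + D ^+ 10 * b.
Proof. by ring. Qed.

Let ic0 : 0 <= c^-1. Proof. by rewrite invr_ge0 ltW. Qed.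

Let Mle1 (d e : R) : 0 <= e -> d <= c^-1 * e -> D ^+ 12 * d <= M * e.
Proof.
move=> e0 de; rewrite /M -mulrA; apply: ler_wpM2l; first exact: XD.
by rewrite mulrDl mul1r; apply: le_trans de _; rewrite lerDr.
Qed.

Let Mle2 (e : R) : 0 <= e -> D ^+ 8 * e <= M * e.
Proof.
move=> e0; rewrite ler_wpM2r// /M; apply: (@le_trans _ _ (D ^+ 12)); first exact: powD1.
by rewrite ler_peMr// lerDl.
Qed.

Let Ddl (d : R) : 0 <= d -> [/\ 2 * (D ^+ 10 * d) <= D ^+ 11 * d,
  2 * (D ^+ 11 * d) <= D ^+ 12 * d, D ^+ 5 * d <= D ^+ 10 * d & 0 <= D ^+ 10 * d].
Proof.
move=> d0; split.
- by rewrite (exprS D 10) -mulrA ler_wpM2r// mulr_ge0.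
- by rewrite (exprS D 11) -mulrA ler_wpM2r// mulr_ge0.
- by rewrite ler_wpM2r//; exact: powD1.
- by rewrite mulr_ge0.
Qed.

(** The use of regularity for eta. [regular_taylor] needs jets over the same (x, u), so z is first
    moved from zh to the level z', which changes A, the slope in p and the component along xi by
    multiples of z' - zh, hence of eta. *)
Lemma comparison_lower : - (M * eta) - M * `|dot th xi| <=
  qform (gxx g (x, y0, zh)) xi xi - qform (A (x, ux, p)) xi xi
  - \sum_i th 0 i * qform (\matrix_(j, k) 'D_(bas (inr i)) (fun q => A q j k) (x, ux, p)) xi xi.
Proof.
have [z' [z1 z2 gz' cz']] := level.
set dl := z' - zh in cz'.
have dl0 : 0 <= dl by rewrite subr_ge0.
have GPh : Gam (P zh) by exact: PG.
have GP' : Gam (P z') by exact: PG.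
have phiD : `|phi z' - phi zh| <= D ^+ 5 * dl.
  apply: mvt_bound z1 (fun z h1 h2 => dphi h1 (le_trans h2 z2)) _ => z h1 h2.
  rewrite (exprD D 2 3); apply: qformD => // i j; rewrite mxE.
  rewrite exprS; apply: sumKD; first exact: XD.
  have fP := Pfat h1 (le_trans h2 z2).
  move=> k; rewrite expr2; apply: mulD; last by apply: (ub_A1 ub); right; exists (P z).
  case: k => [[i'|[]]|i'] /=; first by rewrite normr0.
    exact: (ub_gz ub).
  exact: (ub_gxz ub).
have gxD i : `|(gx g (P z') - gx g (P zh)) 0 i| <= D * dl.
  rewrite !mxE -/(gx g _ 0 i) -/(gx g _ 0 i).
  have := @mvt_bound R (fun s => 'D_(dirx (unitv i)) g (P s)) (fun s => 'D_dirz ('D_(dirx (unitv i)) g) (P s))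
    zh z' D z1.
  move=> /(_ (fun z h1 h2 => dP (dg _ h1 (le_trans h2 z2)))) H.
  have := H (fun z h1 h2 => ub_gxz ub i (Pfat h1 (le_trans h2 z2))).
  by rewrite -!gx_coord /gx !mxE.
set p' := gx g (P z').
have toJ' : toJ (P z') = (x, ux, p') by rewrite /toJ gz'.
have K1' : (toJ @` fat ep) (x, ux, p') by exists (P z') => //; exact: Pfat.
have seg t : 0 <= t <= 1 -> segs (toJ @` fat ep) (x, ux, p + t *: (p' - p)).
  by move=> t01; exists (x, ux, p), (x, ux, p'), t.
have K1U : toJ @` fat ep `<=` U by move=> _ [Q fQ <-]; exact/toJ_in/(ub_fat ub).
set zeta := p' - p.
pose Pi i := qform (\matrix_(j, k) 'D_(bas (inr i)) (fun q => A q j k) (x, ux, p)) xi xi.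
have e1 : phi z' = qform (A (x, ux, p')) xi xi := congr1 (fun q => qform (A q) xi xi) toJ'.
have e2 : phi zh = qform (gxx g (x, y0, zh)) xi xi := congr1 (fun N => qform N xi xi) (matA_toJ GPh).
have PiD i : `|Pi i| <= D ^+ 3.
  rewrite exprSr; apply: (qformD D0) => j k.
  have h1 := ub_A1 ub j k (inr i) (or_introl Kq).
  by rewrite mxE; exact: h1.
have zt i : zeta 0 i - th 0 i = (gx g (P z') - gx g (P zh)) 0 i.
  by rewrite /zeta /th /p' !mxE; ring.
have ztD i : `|zeta 0 i - th 0 i| <= D * dl by rewrite zt; exact: gxD.
have dd : `|dot zeta xi - dot th xi| <= D ^+ 2 * dl.
  rewrite /dot -sumrB expr2 -mulrA; apply: sumD; first exact: mulr_ge0.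
  move=> i; rewrite -mulrBl -[leRHS]mulr1; apply: mulD; [exact: ztD|exact: unit_coord_le].
have pp : `|\sum_k zeta 0 k * Pi k - \sum_k th 0 k * Pi k| <= D ^+ 5 * dl.
  rewrite -sumrB (_ : D ^+ 5 * dl = D * (D * dl * D ^+ 3)); last by ring.
  apply: sumD; first by rewrite !mulr_ge0.
  by move=> i; rewrite -mulrBl; apply: mulD; [exact: ztD|exact: PiD].
have zn : `|zeta| <= D ^+ 2.
  apply: rV_norm_le => [|i]; first exact: XD.
  have h1 : `|p' 0 i| <= D by rewrite /p' gx_coord; apply: (ub_gx ub); exact: Pfat.
  have h2 := ub_p ub i Kq.
  have -> : zeta 0 i = p' 0 i - p 0 i by rewrite /zeta !mxE.
  apply: le_trans (ler_normB _ _) _; apply: (le_trans (lerD h1 h2)).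
  by rewrite expr2 -mulr2n -mulr_natl; apply: ler_wpM2r.
have nn : n%:R ^+ 2 * (n%:R + 2) * (n%:R ^+ 2 * D) * `|zeta| <= D ^+ 8.
  rewrite (_ : D ^+ 8 = D ^+ 2 * D * (D ^+ 2 * D) * D ^+ 2); last by ring.
  exact: (ler_pM nn0 (normr_ge0 _) nnD zn).
have dz : `|dot zeta xi| <= `|dot th xi| + D ^+ 2 * dl by exact: tri dd.
have fin : n%:R ^+ 2 * (n%:R + 2) * (n%:R ^+ 2 * D) * `|zeta| * `|dot zeta xi| <=
    D ^+ 8 * `|dot th xi| + D ^+ 10 * dl.
  rewrite -(D8 (`|dot th xi|) dl).
    exact: (ler_pM (mulr_ge0 nn0 (normr_ge0 _)) (normr_ge0 _) nn dz).
have dle : dl <= c^-1 * eta by rewrite ler_pdivlMl.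
have e0 : 0 <= eta by rewrite subr_ge0 ltW.
have M1 := Mle1 e0 dle.
have M2 := Mle2 (normr_ge0 (dot th xi)).
have [d1 d2 d3 d4] := Ddl dl0.
have := @regular_taylor R n A U hA hreg xi x ux p p' D xi1 D0
  (fun t t01 => segs_sub K1U (seg t t01))
  (fun t t01 i j k l => ub_A2 ub i j (inr l) (inr k) (or_intror (seg t t01))).
rewrite -/zeta.
have -> : \sum_k zeta 0 k * (\sum_i \sum_j 'D_(bas (inr k)) (fun q => A q i j) (x, ux, p) * xi 0 i * xi 0 j) =
   \sum_k zeta 0 k * Pi k.
  apply: eq_bigr => k _; congr (_ * _); apply: eq_bigr => i _; apply: eq_bigr => j _.
  by rewrite mxE.
move=> tay.
exact: (final_arith tay e1 e2 phiD pp fin M1 M2 d1 d2 d3 d4).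
Qed.

End Comparison.

Lemma slice_point_differentiable (x y : V) (z : R) : differentiable (fun x' : V => (x', y, z) : G) x.
Proof.
apply: differentiable_pair; last exact: differentiable_cst.
by apply: differentiable_pair; [exact: ex_diff|exact: differentiable_cst].
Qed.

Lemma slice_differentiable (F : G -> R) (x y : V) (z : R) :
  differentiable F (x, y, z) -> differentiable (fun x' => F (x', y, z)) x.
Proof. exact: differentiable_comp (slice_point_differentiable x y z). Qed.

(** * The maximum over a small section *)

Section Local.
Context (D ep c : R) (ub : uniform_bounds D ep c).
Context (Om : set V) (u : V -> R) (oOm : open Om) (cu : class_C 4 Om u).
Context (ell : elliptic g Y Z Om u) (eqn : gje_solution g Y Z B Om u).
Context (JU0 : jet u @` Om `<=` U0).
Context (x0 : V) (r h : R) (r0 : 0 < r) (rep : r <= ep) (h0 : 0 < h) (hep : h <= ep).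
Let inball (x : V) := dot (x - x0) (x - x0) <= r ^+ 2.
Context (ballOm : forall x, inball x -> Om x).
Let q0 := jet u x0.
Let y0 := Y q0.
Let z0 := Z q0.
Let zh := z0 - h.
Context (sec : connected_component (gsection Gam g Om u y0 z0 h) x0 `<=` eball x0 r).
(** As u and g(., y0, z0) agree at x0, they differ by at most 2 D^2 r on the ball. So [small1] gives
    eta <= 1, and [small2] gives g(x, y0, z0 + ep) <= u(x), which [level] requires. *)
Context (small1 : D * h + 2 * (D ^+ 2 * r) <= 1) (small2 : 2 * (D ^+ 2 * r) <= c * ep).
Let eta x := g (x, y0, zh) - u x.
Let comp := connected_component (gsection Gam g Om u y0 z0 h) x0.

Let D2 : 2 <= D. Proof. by have := ub_n ub; have := ler0n R n; lra. Qed.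
Let D0 : 0 <= D. Proof. by move: D2; lra. Qed.
Let nD : n%:R <= D. Proof. by have := ub_n ub; have := ler0n R n; lra. Qed.
Let ep0 : 0 < ep. Proof. exact: ub_ep ub. Qed.

Let KJ x : Om x -> K0 (jet u x).
Proof. by move=> Omx; apply/subset_closure/JU0; exists x. Qed.

Let inball0 : inball x0.
Proof. by rewrite /inball subrr (_ : dot 0 0 = 0) ?sqr_ge0//; rewrite /dot big1// => i _; rewrite mxE mul0r. Qed.

Let inball_coord x i : inball x -> `|(x - x0) 0 i| <= r.
Proof.
move=> bx; rewrite -(ger0_norm (ltW r0)) -ler_sqr ?nnegrE// !real_normK ?num_real//.
exact: le_trans (sqr_coord_le_dot _ i) bx.
Qed.

Let inball_norm x : inball x -> `|x - x0| <= ep.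
Proof. by move=> bx; apply: le_trans rep; apply: rV_norm_le => [|i]; [exact: ltW|exact: inball_coord]. Qed.

Let inball_segment x t : inball x -> 0 <= t -> t <= 1 -> inball (x0 + t *: (x - x0)).
Proof.
move=> bx t0 t1; rewrite /inball addrAC subrr add0r dotZl dotZr mulrA.
apply: le_trans bx; rewrite ler_piMl ?dot_ge0//.
by rewrite mulr_ile1.
Qed.

Let fatx x z : inball x -> zh <= z -> z <= z0 + ep -> fat ep (x, y0, z).
Proof.
move=> bx z1 z2; exists q0; split => //=; first exact/KJ/ballOm.
  exact: inball_norm.
rewrite ler_norml; apply/andP; split; first by move: z1 hep; rewrite /zh /z0; lra.
by move: z2; rewrite /z0; lra.
Qed.

Let GPx x z : inball x -> zh <= z -> z <= z0 + ep -> Gam (x, y0, z).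
Proof. by move=> bx z1 z2; exact/(ub_fat ub)/fatx. Qed.

Let zh1 : zh <= z0. Proof. by rewrite /zh; move: h0; lra. Qed.
Let zh2 : zh <= z0 + ep. Proof. by rewrite /zh; move: h0 ep0; lra. Qed.
Let zh3 : z0 <= z0 + ep. Proof. by move: ep0; lra. Qed.

Let lipschitz_ball (F : V -> R) x : inball x ->
  (forall y, inball y -> differentiable F y) ->
  (forall y i, inball y -> `|'D_(unitv i) F y| <= D) -> `|F x - F x0| <= D ^+ 2 * r.
Proof.
move=> bx dF bF; pose f t := F (x0 + t *: (x - x0)).
have -> : F x - F x0 = f 1 - f 0 by rewrite /f scale0r addr0 scale1r [x0 + _]addrC subrK.
rewrite -[leRHS]mulr1 -[X in _ * X]subr0.
apply: (@mvt_bound R f (fun t => 'D_(x - x0) F (x0 + t *: (x - x0)))) => // t t0 t1.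
  exact/is_derive_line/derivableP/diff_derivable/dF/inball_segment.
have by' := inball_segment bx t0 t1.
rewrite -[X in 'D_X _ _](sum_unitv (x - x0)) derive_comb; last exact: dF.
apply: le_trans (ler_norm_sum _ _ _) _.
apply: le_trans (_ : \sum_(i < n) (D * r) <= _).
  apply: ler_sum => i _; rewrite normrM mulrC; apply: ler_pM => //; first exact: bF.
  exact: inball_coord.
rewrite sumr_const card_ord -mulr_natl mulrA expr2.
by apply: ler_wpM2r; [exact: ltW|exact: ler_wpM2r].
Qed.

Let du x : Om x -> differentiable u x. Proof. exact: cu.1. Qed.

Let grad_bound x i : Om x -> `|'D_(unitv i) u x| <= D.
Proof. by move=> /KJ Kx; have := ub_p ub i Kx; rewrite mxE. Qed.

Let gslice z : V -> R := fun x => g (x, y0, z).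

Let dgx x z : inball x -> zh <= z -> z <= z0 + ep -> differentiable (gslice z) x.
Proof. by move=> bx z1 z2; apply: slice_differentiable; exact: cg.1 (GPx bx z1 z2). Qed.

Let u_lip x : inball x -> `|u x - u x0| <= D ^+ 2 * r.
Proof.
move=> bx; apply: lipschitz_ball bx _ _ => [y by'|y i by']; first exact/du/ballOm.
exact/grad_bound/ballOm.
Qed.

Let g_lip x : inball x -> `|gslice z0 x - gslice z0 x0| <= D ^+ 2 * r.
Proof.
move=> bx; apply: lipschitz_ball bx _ _ => [y by'|y i by']; first exact: dgx.
have -> : 'D_(unitv i) (gslice z0) y = 'D_(dirx (unitv i)) g (y, y0, z0).
  exact: (congr1 (fun f => f y) (derive_fiberx g y0 z0 (unitv i))).
by apply: (ub_gx ub); exact: fatx.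
Qed.

Let g_x0 : gslice z0 x0 = u x0.
Proof. by have := toJ_ofJ (K0U (KJ (ballOm inball0))); rewrite /toJ /ofJ /= => -[]. Qed.

Let g_z x (a b : R) : inball x -> zh <= a -> a <= b -> b <= z0 + ep ->
  c * (b - a) <= g (x, y0, a) - g (x, y0, b) <= D * (b - a).
Proof.
move=> bx za ab bz; pose f (z : R) := g (x, y0, z).
have df z : a <= z -> z <= b -> is_derive z (1 : R) f ('D_dirz g (x, y0, z)).
  move=> az zb.
  have PE s : (x, y0, s) = ((x, y0, 0) : G) + s *: dirz.
    transitivity ((x + s *: (0 : V), y0 + s *: (0 : V), 0 + s * 1) : G); last by [].
    by rewrite !scaler0 !addr0 add0r mulr1.
  have -> : f = (fun s => g (((x, y0, 0) : G) + s *: dirz)) by apply/funext => s; rewrite /f PE.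
  rewrite (PE z); apply/is_derive_line/derivableP/diff_derivable/cg.1; rewrite -(PE z).
  by apply: GPx => //; [exact: le_trans az|exact: le_trans bz].
have [||t] := @MVT_segment R f (fun z => 'D_dirz g (x, y0, z)) a b ab.
- by move=> t; rewrite in_itv/= => /andP[t1 t2]; apply: df; exact: ltW.
- apply: continuous_in_subspaceT => t; rewrite inE/= in_itv/= => /andP[t1 t2].
  by apply/differentiable_continuous/derivable1_diffP; have [] := df t t1 t2.
rewrite in_itv/= => /andP[t1 t2] E.
have ft : fat ep (x, y0, t) by apply: fatx => //; [exact: le_trans t1|exact: le_trans bz].
have -> : g (x, y0, a) - g (x, y0, b) = - 'D_dirz g (x, y0, t) * (b - a).
  by rewrite mulNr -E opprB.
apply/andP; split; apply: ler_wpM2r; rewrite ?subr_ge0//; first exact: (ub_gzc ub).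
by apply: le_trans (ler_norm _) _; rewrite normrN; exact: (ub_gz ub).
Qed.

Let eta_le1 x : inball x -> eta x <= 1.
Proof.
move=> bx; have /andP[_ gz1] := g_z bx (lexx zh) zh1 zh3.
have := ler_normlW (g_lip bx); have := u_lip bx; rewrite ler_norml => /andP[ul _] gl.
move: gz1 gl ul small1 g_x0; rewrite /eta /gslice (_ : z0 - zh = h); last by rewrite /zh subKr.
by move: (g (x, y0, zh)) (g (x, y0, z0)) (g (x0, y0, z0)) (D ^+ 2 * r) (D * h) => a b d e f; lra.
Qed.

Let eta_ep x : inball x -> g (x, y0, z0 + ep) <= u x.
Proof.
move=> bx; have /andP[gz1 _] := g_z bx zh1 zh3 (lexx _).
have := ler_normlW (g_lip bx); have := u_lip bx; rewrite ler_norml => /andP[ul _] gl.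
move: gz1 gl ul small2 g_x0; rewrite /gslice (_ : z0 + ep - z0 = ep); last by rewrite addrAC subrr add0r.
by move: (g (x, y0, z0 + ep)) (g (x, y0, z0)) (g (x0, y0, z0)) (D ^+ 2 * r) (c * ep) => a b d e f; lra.
Qed.

Let eta_x0 : c * h <= eta x0.
Proof.
have /andP[gz1 _] := g_z inball0 (lexx zh) zh1 zh3.
by rewrite /eta -g_x0; move: gz1; rewrite (_ : z0 - zh = h)//; rewrite /zh subKr.
Qed.

Let S := closure comp.

Let gsec0 : gsection Gam g Om u y0 z0 h x0.
Proof.
split; [exact: ballOm|exact: GPx|].
by rewrite -subr_gt0; apply: lt_le_trans eta_x0; exact: mulr_gt0 (ub_c ub) h0.
Qed.

Let comp_x0 : comp x0. Proof. exact: connected_component_refl gsec0. Qed.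

Let comp_inball x : comp x -> inball x.
Proof. by move=> /sec /(eball_dot _ _ r0) /ltW. Qed.

Let comp_eta x : comp x -> 0 < eta x.
Proof. by move=> /connected_component_sub[_ _]; rewrite subr_gt0. Qed.

Let S_inball x : S x -> inball x.
Proof.
have cB : closed inball.
  apply: (@preimage_closed _ _ (fun x : V => dot (x - x0) (x - x0)) [set t | t <= r ^+ 2]).
    move=> y _; apply: (@continuous_comp _ _ _ (fun x : V => x - x0) (fun z => dot z z)); last exact: continuous_dot2.
    by apply: differentiable_continuous; exact: ex_diff.
  exact: closed_le.
move=> Sx; have : closure inball x by apply: closure_subset Sx => y; exact: comp_inball.
by rewrite -((closure_id _).1 cB).
Qed.

Let S_Om x : S x -> Om x. Proof. by move=> /S_inball/ballOm. Qed.

Let deta x : inball x -> differentiable eta x.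
Proof. by move=> bx; apply: differentiableB; [exact: dgx|exact/du/ballOm]. Qed.

Let ceta x : inball x -> {for x, continuous eta}.
Proof. by move=> bx; exact/differentiable_continuous/deta. Qed.

Let S_eta x : S x -> 0 <= eta x.
Proof.
move=> Sx; rewrite leNgt; apply/negP => ex.
have N : \forall y \near x, eta y < 0 by exact: (cvgr_lt _ (ceta (S_inball Sx))).
by have [y [/comp_eta h1 /= h2]] := Sx _ N; move: h1 h2; lra.
Qed.

(** A small ball around x lies in the section and meets the component, and segments in the ball join
    its points to the component. Hence eta can only vanish on the boundary of the component. *)
Let S_interior x : S x -> 0 < eta x -> \forall y \near x, comp y.
Proof.
move=> Sx ex; have bx := S_inball Sx.
have N : \forall y \near x, gsection Gam g Om u y0 z0 h y.
  have N1 : \forall y \near x, 0 < eta y by exact: (cvgr_gt _ (ceta bx)).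
  have N2 : \forall y \near x, Om y by exact: open_nbhs_nbhs (conj oOm (ballOm bx)).
  have N3 : \forall y \near x, Gam (y, y0, zh).
    have : {for x, continuous (fun y : V => (y, y0, zh) : G)}.
      exact/differentiable_continuous/slice_point_differentiable.
    by apply; exact: open_nbhs_nbhs (conj oGam (GPx bx (lexx zh) zh2)).
  near=> y; split; [near: y; exact: N2|near: y; exact: N3|].
  by rewrite -subr_gt0; near: y; exact: N1.
have [e e0 He] := nbhs_norm N.
have [y1 [cy1 by1]] := Sx _ (nbhsx_ballx x e e0).
rewrite -ball_normE /= in by1.
apply/nbhs_ballP; exists e => //= y; rewrite -ball_normE /= => by2.
apply: connected_component_trans cy1 _.
pose f (t : R) := y1 + t *: (y - y1).
apply: (@connected_component_max _ _ (f @` `[0, 1])).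
- by exists 0; [rewrite /= in_itv/= lexx ler01|rewrite /f scale0r addr0].
- move=> _ [t t01 <-]; apply: He; move: t01; rewrite /= in_itv/= => /andP[t0 t1].
  have -> : x - f t = t *: (x - y) + (1 - t) *: (x - y1).
    rewrite /f scalerBl scale1r !scalerBr; move: (t *: x) (t *: y) (t *: y1) => a b d.
    by rewrite !opprD !opprK; apply/rowP => i; rewrite !mxE; ring.
  apply: le_lt_trans (ler_normD _ _) _; rewrite !normrZ (ger0_norm t0) ger0_norm ?subr_ge0//.
  have -> : e = t * e + (1 - t) * e by ring.
  move: t0; rewrite le_eqVlt => /predU1P[<-|t0].
    by rewrite !mul0r !add0r subr0 !mul1r.
  by apply: ltr_leD; [rewrite ltr_pM2l|rewrite ler_wpM2l ?subr_ge0// ltW].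
- apply: connected_continuous_connected; first exact: segment_connected.
  by apply: continuous_in_subspaceT => t _; exact: segment_continuous.
- by exists 1; [rewrite /= in_itv/= lexx ler01|rewrite /f scale1r addrC subrK].
Unshelve. all: by end_near. Qed.

Let S_compact : compact S.
Proof.
apply: bounded_closed_compact; last exact: closed_closure.
exists (`|x0| + ep); split; first exact: num_real.
move=> M hM x /S_inball/inball_norm hx; apply: le_trans (ltW hM).
by rewrite -[x](subrK x0) addrC; apply: le_trans (ler_normD _ _) _; rewrite lerD2l.
Qed.

Context (beta kappa : R) (tau : nat).
Let weight x : R := beta / 2 * (\sum_k 'D_(unitv k) u x * 'D_(unitv k) u x) +
  kappa / 2 * dot (x - x0) (x - x0).
(** In product form the quantity is continuous also where eta vanishes, so it attains its maximum;
    logarithms are taken only at an interior maximum. *)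
Let Phi (q : V * V) : R :=
  eta q.1 ^+ tau * qform (augm u A q.1) q.2 q.2 * expR (weight q.1).

Let cD v x : Om x -> {for x, continuous ('D_v u)}.
Proof. by move=> Omx; exact: differentiable_continuous ((cu.2 v).1 x Omx). Qed.

Let cjet x : Om x -> {for x, continuous (jet u)}.
Proof.
move=> Omx; apply: pair_continuous.
  by apply: pair_continuous; [exact: cvg_id|exact/differentiable_continuous/du].
have -> : grad u = \sum_i (fun y => 'D_(unitv i) u y *: unitv i).
  apply/funext => y; rewrite fct_sumE -[LHS]sum_unitv; apply: eq_bigr => i _.
  by rewrite mxE.
apply: differentiable_continuous; apply: differentiable_sum => i.
by apply: differentiableZl; exact: (cu.2 _).1.
Qed.

Let caug x i j : Om x -> {for x, continuous (fun y => augm u A y i j)}.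
Proof.
move=> Omx.
have -> : (fun y => augm u A y i j) = (fun y => 'D_(unitv i) ('D_(unitv j) u) y - A (jet u y) i j).
  apply/funext => y; rewrite /augm mxE [X in X + _]mxE [X in _ + X]mxE; reflexivity.
apply: continuousB; first exact: differentiable_continuous (((cu.2 (unitv j)).2 (unitv i)).1 x Omx).
apply: (@continuous_comp _ _ _ (jet u) (fun q => A q i j)); first exact: cjet.
exact: differentiable_continuous ((hA i j).1 _ (K0U (KJ Omx))).
Qed.

Let cweight x : Om x -> {for x, continuous weight}.
Proof.
move=> Omx; apply: continuousD; apply: continuousM; try exact: cst_continuous.
  by apply: continuous_bigsum => k; apply: continuousM; exact: cD.
apply: (@continuous_comp _ _ _ (fun x : V => x - x0) (fun z => dot z z)); last exact: continuous_dot2.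
by apply: differentiable_continuous; exact: ex_diff.
Qed.

Let cPhi q : inball q.1 -> {for q, continuous Phi}.
Proof.
move=> bq; have Omq := ballOm bq.
have c1 : {for q, continuous (fun s : V * V => eta s.1 ^+ tau)}.
  apply: (@continuous_comp _ _ _ (fun s : V * V => eta s.1) (fun t : R => t ^+ tau)).
    exact: (@continuous_comp_fst V V R eta q (ceta bq)).
  exact: exprn_continuous.
have c2 : {for q, continuous (fun s : V * V => expR (weight s.1))}.
  apply: (@continuous_comp _ _ _ (fun s : V * V => weight s.1) expR).
    exact: (@continuous_comp_fst V V R weight q (cweight Omq)).
  exact: continuous_expR.
have c3 i : {for q, continuous (fun s : V * V => s.2 0 i)}.
  exact: (@continuous_comp_snd V V R (fun v : V => v 0 i) q (@continuous_coord _ _ i q.2)).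
have c4 i j : {for q, continuous (fun s : V * V => augm u A s.1 i j)}.
  exact: (@continuous_comp_fst V V R (fun y => augm u A y i j) q (@caug q.1 i j Omq)).
have c5 : {for q, continuous (fun s : V * V => qform (augm u A s.1) s.2 s.2)}.
  apply: continuous_bigsum => i; apply: continuous_bigsum => j.
  exact: (continuousM (continuousM (c4 i j) (c3 i)) (c3 j)).
exact: (continuousM (continuousM c1 c5) c2).
Qed.

Let M := D ^+ 12 * (1 + c^-1).
(** 2 D bounds the gradient of eta, a difference of two bounded gradients, and M is the constant of
    [comparison_lower]. *)
Let N := D + D + M.
Let C := N ^+ 17.

Let M0 : 0 <= M.
Proof. by rewrite mulr_ge0 ?exprn_ge0// addr_ge0// invr_ge0 ltW// (ub_c ub). Qed.
Let DN : D <= N. Proof. by rewrite /N; move: D0 M0; lra. Qed.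
Let DDN : D + D <= N. Proof. by rewrite /N; move: M0; lra. Qed.
Let MN : M <= N. Proof. by rewrite /N; move: D0; lra. Qed.
Let N0 : 0 <= N. Proof. exact: le_trans D0 DN. Qed.

Let aug_sym x : Om x -> mxsymmetric (augm u A x).
Proof.
move=> Omx i j.
have E a b : augm u A x a b = 'D_(unitv a) ('D_(unitv b) u) x - A (jet u x) a b.
  rewrite /augm mxE [X in X + _]mxE [X in _ + X]mxE; reflexivity.
have c2 : class_C 2 Om u.
  exact: class_CW (class_CW cu).
rewrite !E (schwarz _ _ oOm c2 Omx); congr (_ - _).
exact: matA_sym (K0U (KJ Omx)) i j.
Qed.

Let aug_pos x v : Om x -> dot v v = 1 -> 0 < qform (augm u A x) v v.
Proof.
move=> Omx v1; exact: (ell Omx (dot_unit_neq0 v1)).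
Qed.

Context (beta0 : 0 < beta) (kappa0 : 0 < kappa) (tau12 : 12 <= tau%:R :> R).
Context (tauC : 12 * beta ^+ 2 * C ^+ 2 * n%:R <= tau%:R).
Context (betaE : beta = 2 * C + 2).
Context (kappaE : kappa = 4 * (2 * C + 6 * C ^+ 2 + C * tau%:R + tau%:R * C ^+ 2 + 1 + beta * C)).
Context (rC : C * (N * r) <= 1 / 4) (rk : 24 * kappa * (N * r) ^+ 2 <= tau%:R).
Let Kc := 2 * C + kappa + beta * (n%:R * C) + beta * C + C * tau%:R + 2 * tau%:R * C ^+ 2.

Let Kc0 : 0 <= Kc.
Proof.
have C0 : 0 <= C by exact: exprn_ge0.
by rewrite /Kc !addr_ge0// ?mulr_ge0// ?exprn_ge0// ?ltW.
Qed.

Section AtMax.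
Context (x xi : V) (Sx : S x) (xi1 : dot xi xi = 1) (ex : 0 < eta x).
Context (mx : forall y v, S y -> dot v v = 1 -> Phi (y, v) <= Phi (x, xi)).
Let Ph : G := (x, y0, zh).
Let d1 v := 'D_(dirx v) g Ph - 'D_v u x.
Let d2 v := 'D_(dirx v) ('D_(dirx v) g) Ph - 'D_v ('D_v u) x.

Let Omx : Om x. Proof. exact: S_Om. Qed.
Let bx : inball x. Proof. exact: S_inball. Qed.
Let GPh : Gam Ph. Proof. exact: GPx. Qed.

Let jeta v : jet2 (fun t => eta (x + t *: v)) (eta x) (d1 v) (d2 v).
Proof.
have c2 : class_C 2 Om u by exact: class_CW (class_CW cu).
have E : (fun t => eta (x + t *: v)) = (fun t => g (Ph + t *: dirx v) - u (x + t *: v)).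
  apply/funext => t; rewrite /eta; congr (g _ - _).
  transitivity ((x + t *: v, y0 + t *: (0 : V), zh + t * 0) : G); last by [].
  by rewrite scaler0 mulr0 !addr0.
rewrite E; apply: jet2B; last exact: (jet2_line_on oOm v c2 Omx).
apply: jet2_line; last exact: (cg.2 (dirx v)).1 GPh.
by apply: filterS (open_nbhs_nbhs (conj oGam GPh)) => P; exact: cg.1.
Qed.

Let d1E v : d1 v = \sum_i v 0 i * d1 (unitv i).
Proof.
have E1 : 'D_(dirx v) g Ph = \sum_i v 0 i * 'D_(dirx (unitv i)) g Ph.
  by rewrite {1}(dirxE v) derive_comb//; exact: cg.1.
have E2 : 'D_v u x = \sum_i v 0 i * 'D_(unitv i) u x.
  by rewrite -{1}(sum_unitv v) derive_comb//; exact: du.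
rewrite /d1 E1 E2 -sumrB; apply: eq_bigr => i _.
by move: ('D__ g Ph) ('D__ u x) => a b; rewrite mulrBr.
Qed.

Let d1b i : `|d1 (unitv i)| <= N.
Proof.
apply: le_trans DDN; apply: le_trans (ler_normB _ _) _; apply: lerD; last exact: grad_bound.
exact: (ub_gx ub i (fatx bx (lexx zh) zh2)).
Qed.

Let etaF e : dot e e = 1 -> - (N * eta x) - N * `|d1 e| <= d2 e + 'D_e ('D_e u) x -
  qform (A (jet u x)) e e -
  \sum_i d1 (unitv i) * qform (\matrix_(j, k) 'D_(bas (inr i)) (fun q => A q j k) (jet u x)) e e.
Proof.
move=> e1; have eu : u x < g (x, y0, zh) by rewrite -subr_gt0.
have key (ql qa sl s dt : R) : - (M * eta x) - M * `|dt| <= ql - qa - sl ->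
    ql = d2 e + 'D_e ('D_e u) x -> sl = s -> dt = d1 e ->
    - (N * eta x) - N * `|d1 e| <= d2 e + 'D_e ('D_e u) x - qa - s.
  move=> le <- <- <-; apply: le_trans le; apply: lerB; last exact: ler_wpM2r.
  by rewrite lerN2; apply: ler_wpM2r; [exact: ltW|exact: MN].
have th_i i : (gx g Ph - grad u x) 0 i = d1 (unitv i).
  by rewrite /d1 mxE [X in _ + X]mxE gx_coord [X in - X]mxE.
apply: (key _ _ _ _ _ (comparison_lower ub (KJ (ballOm inball0)) (KJ Omx) (ltW h0) hep (inball_norm bx) eu (eta_ep bx) e1)).
- by rewrite /d2 subrK; exact: gxx_qform.
- by apply: eq_bigr => i _; exact: (congr1 (fun t => t * _) (th_i i)).
- by rewrite d1E dotC; apply: eq_bigr => i _; exact: (congr1 (fun t => _ * t) (th_i i)).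
Qed.

Let expR_pogorelov e o y : Om y -> 0 < eta y -> dot (e o) (e o) = 1 ->
  expR (pogorelov_function u A e o eta beta kappa tau x0 y) = Phi (y, e o).
Proof.
move=> Omy ey e1; rewrite /pogorelov_function -addrA expRD /Phi; congr (_ * _).
rewrite expRD lnK; last by rewrite posrE; exact: aug_pos.
by rewrite mulrC mulr_natl -lnXn// lnK// posrE exprn_gt0.
Qed.

Let qform_max v : dot v v = 1 -> qform (augm u A x) v v <= qform (augm u A x) xi xi.
Proof.
move=> v1; have := mx Sx v1; rewrite /Phi /= ler_pM2r ?expR_gt0//.
by rewrite ler_pM2l// exprn_gt0.
Qed.

Lemma max_bound : eta x ^+ 2 * qform (augm u A x) xi xi <= 1 + Kc.
Proof.
have [e [lam [k [eo orth eig lamo]]]] := spectral_frame (aug_sym Omx) xi1 qform_max.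
have e1 a : dot (e a) (e a) = 1 by rewrite orth eqxx.
have lamE a : lam a = qform (augm u A x) (e a) (e a) by rewrite eig e1 mulr1.
have lam0 a : 0 < lam a by rewrite lamE; exact: aug_pos.
have ex1 := eta_le1 bx.
(* [pogorelov_at_max] assumes L >= 1; for smaller L the bound 1 follows from eta <= 1, hence 1 +
   [Kc]. *)
rewrite -eo -lamE; have [L1|L1] := ltP (lam k) 1.
  apply: le_trans (_ : 1 * 1 <= _); last by rewrite mulr1 lerDl.
  by apply: ler_pM; [exact: sqr_ge0|exact: ltW|rewrite expr_le1// ltW|exact: ltW].
apply: le_trans (_ : Kc <= _); last by rewrite lerDr.
have Kx := KJ Omx; have Ux := K0U Kx.
have near_max : \forall y \near x, pogorelov_function u A e k eta beta kappa tau x0 y <=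
    pogorelov_function u A e k eta beta kappa tau x0 x.
  apply: filterS (S_interior Sx ex) => y cy.
  rewrite -ler_expR !expR_pogorelov//; [|exact/ballOm/comp_inball|exact: comp_eta].
  by rewrite eo; apply: mx; [exact: subset_closure|].
have JU y : Om y -> U (jet u y) by move=> Omy; exact/K0U/KJ.
have nN : n%:R + n%:R + 2 <= N by apply: le_trans DN; exact: (ub_n ub).
apply: (pogorelov_at_max oOm cu JU hA (@matA_sym) hreg hB eqn Omx orth eig lam0 (hBpos Ux) lamo L1 nN
  _ _ _ _ _ _ _ jeta d1E ex ex1 d1b (fun a => etaF (e1 a)) (ltW r0) (fun i => inball_coord i bx) near_max
  beta0 kappa0 tau12 tauC betaE kappaE rC rk).
- by move=> i j; apply: le_trans DN; exact: (ub_A ub).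
- by move=> i j a; apply: le_trans DN; apply: (ub_A1 ub); left.
- by move=> i j a b; apply: le_trans DN; apply: (ub_A2 ub); left.
- by move=> a; apply: le_trans DN; exact: (ub_B1 ub).
- by move=> a b; apply: le_trans DN; exact: (ub_B2 ub).
- by apply: le_trans DN; exact: (ub_Bi ub).
- by move=> i; apply: le_trans DN; exact: grad_bound.
Qed.

End AtMax.

Let E := beta / 2 * (D ^+ 3) + kappa / 2 * r ^+ 2.

Let weight_bound x : inball x -> 0 <= weight x <= E.
Proof.
move=> bx; have Omx := ballOm bx.
have b2 : 0 <= beta / 2 by apply: divr_ge0; [exact: ltW|].
have k2 : 0 <= kappa / 2 by apply: divr_ge0; [exact: ltW|].
have s0 : 0 <= \sum_k 'D_(unitv k) u x * 'D_(unitv k) u x.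
  by apply: sumr_ge0 => k _; rewrite -expr2 sqr_ge0.
have s1 : \sum_k 'D_(unitv k) u x * 'D_(unitv k) u x <= D ^+ 3.
  apply: le_trans (_ : \sum_(k < n) (D * D) <= _).
    apply: ler_sum => k _; apply: le_trans (ler_norm _) _; rewrite normrM.
    by apply: ler_pM => //; exact: grad_bound.
  rewrite sumr_const card_ord -mulr_natl !exprS expr0 mulr1.
  by apply: ler_wpM2r => //; exact: mulr_ge0.
apply/andP; split; first by apply: addr_ge0; apply: mulr_ge0 => //; exact: dot_ge0.
by apply: lerD; apply: ler_wpM2l.
Qed.

Lemma local_estimate xi : dot xi xi = 1 ->
  qform (augm u A x0) xi xi <= (1 + Kc) * expR E / (c * h) ^+ tau.
Proof.
move=> xi1; have ch0 : 0 < c * h by exact: mulr_gt0 (ub_c ub) h0.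
have tau2 : (2 <= tau)%N by move: tau12; rewrite (ler_nat R 12); apply: leq_trans.
pose T := S `*` [set v : V | dot v v = 1 /\ setT v].
have Sx0 : S x0 by exact: subset_closure comp_x0.
have cT : compact T by apply: compact_setX; [exact: S_compact|exact: sphere_compact closedT].
have wT : {within T, continuous Phi}.
  by apply: continuous_in_subspaceT => q; rewrite inE => -[/S_inball bq _]; exact: cPhi.
have [|[x v]] := compact_EVT_max _ cT wT; first by exists (x0, xi); split.
rewrite inE => -[/= Sx [v1 _]] mx.
have mx' y w : S y -> dot w w = 1 -> Phi (y, w) <= Phi (x, v).
  by move=> Sy w1; apply: mx; rewrite inE; split.
have bx := S_inball Sx; have q0' := aug_pos (ballOm inball0) xi1.
have e0 : 0 < eta x0 by exact: lt_le_trans ch0 eta_x0.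
have lo : (c * h) ^+ tau * qform (augm u A x0) xi xi <= Phi (x0, xi).
  rewrite /Phi /= -[leLHS]mulr1; apply: ler_pM => //.
  - by rewrite mulr_ge0 ?exprn_ge0// ltW.
  - by rewrite ler_pM2r//; apply: lerXn2r; rewrite ?nnegrE ?(ltW ch0) ?(ltW e0).
  - by have /andP[w0 _] := weight_bound inball0; rewrite -expR0 ler_expR.
have Phi0 : 0 < Phi (x0, xi) by apply: lt_le_trans lo; rewrite mulr_gt0// exprn_gt0.
(* At a zero of eta the positive power of eta would make [Phi] vanish, but its maximum is at least
   the positive value at x0. *)
have ex : 0 < eta x.
  rewrite lt_neqAle S_eta// andbT; apply/eqP => ex0.
  have := lt_le_trans Phi0 (mx' _ _ Sx0 xi1).
  by rewrite /Phi /= -ex0 expr0n gtn_eqF ?mul0r ?ltxx// (leq_trans _ tau2).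
have am := max_bound Sx v1 ex mx'.
have hi : Phi (x, v) <= (1 + Kc) * expR E.
  have qx := aug_pos (ballOm bx) v1.
  rewrite /Phi /=; apply: ler_pM.
  - by rewrite mulr_ge0 ?exprn_ge0// ltW.
  - exact: expR_ge0.
  (* As eta <= 1 and tau >= 2, the power eta^tau is at most eta^2. *)
  - apply: le_trans am; rewrite ler_pM2r//; apply: ler_wiXn2l => //; [exact: ltW|exact: eta_le1].
  - by rewrite ler_expR; have /andP[] := weight_bound bx.
rewrite ler_pdivlMr ?exprn_gt0// mulrC.
exact: le_trans lo (le_trans (mx' _ _ Sx0 xi1) hi).
Qed.

Lemma hessian_estimate :
  enorm (hess u x0) <= n%:R * ((1 + Kc) * expR E / (c * h) ^+ tau + D).
Proof.
have Omx := ballOm inball0; have sA := aug_sym Omx.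
set K := (X in n%:R * (X + D)).
have K1 i : augm u A x0 i i <= K.
  by rewrite -qform_unitv; apply: local_estimate; rewrite dot_unitv eqxx.
have Kge0 : 0 <= K.
  apply: divr_ge0; first by apply: mulr_ge0; [exact: addr_ge0|exact: expR_ge0].
  by apply/exprn_ge0/mulr_ge0; apply: ltW; [exact: ub_c ub|exact: h0].
have pos v : 0 <= qform (augm u A x0) v v.
  have [->|v0] := eqVneq v 0; last by rewrite ltW//; exact: (ell Omx v0).
  by rewrite /qform big1// => i _; rewrite big1// => j _; rewrite [X in _ * X]mxE mulr0.
have Kij := psd_entry_le sA pos K1.
apply: enorm_entries => [|i j]; first by rewrite addr_ge0.
have -> : hess u x0 i j = augm u A x0 i j + A (jet u x0) i j.
  by rewrite /augm [in RHS]mxE [X in _ = _ + X + _]mxE subrK.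
apply: le_trans (ler_normD _ _) _; apply: lerD; first exact: Kij.
exact: (ub_A ub i j (KJ Omx)).
Qed.

End Local.

End GeneratingFunction.

(** * Choice of the parameters *)

(** Meets finitely many smallness conditions a s <= b, listed as pairs (a, b), with one positive
    s. *)
Lemma small_scales (R : realType) (l : seq (R * R)) :
  all (fun p => (0 <= p.1) && (0 < p.2)) l ->
  exists2 s, 0 < s & all (fun p => p.1 * s <= p.2) l.
Proof.
elim: l => [|[a b] l IH] /=; first by exists 1.
move=> /andP[/andP[a0 b0] al]; have [s s0 Hs] := IH al.
have a1 : 0 < a + 1 by rewrite ltr_wpDl.
have t0 : 0 < b / (a + 1) by exact: divr_gt0.
exists (Num.min s (b / (a + 1))); first by rewrite lt_min s0.
apply/andP; split.
  apply: le_trans (_ : (a + 1) * (b / (a + 1)) <= _); last by rewrite mulrCA divff ?mulr1// gt_eqF.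
  apply: ler_pM => //; [by rewrite le_min !ltW|by rewrite lerDl|by rewrite ge_min lexx orbT].
have H : all (fun p => ((0 <= p.1) && (0 < p.2)) && (p.1 * s <= p.2)) l by rewrite all_predI al.
apply: sub_all H => p /andP[/andP[p0 _]]; apply: le_trans.
by apply: ler_wpM2l => //; rewrite ge_min lexx.
Qed.

(** The strict inequality yields an admissible height above h, and admissibility covers every lower
    section. *)
Lemma modulus_component (R : realType) (n : nat) (Gam : set ('rV[R]_n * 'rV[R]_n * R))
    (g : 'rV[R]_n * 'rV[R]_n * R -> R) (Y : 'rV[R]_n * R * 'rV[R]_n -> 'rV[R]_n)
    (Z : 'rV[R]_n * R * 'rV[R]_n -> R) (Om : set 'rV[R]_n) (u : 'rV[R]_n -> R)
    (x0 : 'rV[R]_n) (r h : R) :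
  0 < h -> (h%:E < modulus Gam g Y Z Om u x0 r)%E ->
  connected_component (gsection Gam g Om u (Y (jet u x0)) (Z (jet u x0)) h) x0 `<=` eball x0 r.
Proof.
move=> h0 /ereal_sup_gt[_ [k [_ Hk] <-]]; rewrite lte_fin => hk.
by have [] := Hk h h0 (ltW hk).
Qed.

Theorem theorem2p2 (R : realType) (n : nat) (hn : (0 < n)%N)
    (Gam : set ('rV[R]_n * 'rV[R]_n * R)) (g : 'rV[R]_n * 'rV[R]_n * R -> R)
    (Y : 'rV[R]_n * R * 'rV[R]_n -> 'rV[R]_n)
    (Z : 'rV[R]_n * R * 'rV[R]_n -> R)
    (B : 'rV[R]_n * R * 'rV[R]_n -> R)
    (U0 : set ('rV[R]_n * R * 'rV[R]_n))
    (R0 : R) (m : R -> R)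
    (hg : generating_function Gam g)
    (hYZ : dual_maps Gam g Y Z)
    (hconv : forall x u, convex_set [set p | jetset Gam g (x, u, p)])
    (hA : forall i j, class_C 2 (jetset Gam g) (fun q => matA g Y Z q i j))
    (hB : class_C 2 (jetset Gam g) B)
    (hBpos : forall q, jetset Gam g q -> 0 < B q)
    (hreg : regular (jetset Gam g) (matA g Y Z))
    (hU0 : compactly_contained U0 (jetset Gam g))
    (hm : forall r, 0 < r -> r < R0 -> 0 < m r) :
  exists C : R,
    forall (Om Om' : set 'rV[R]_n) (u : 'rV[R]_n -> R),
      domain Om -> bounded_set Om ->
      class_C 4 Om u -> [lipschitz u x | x in closure Om] ->
      elliptic g Y Z Om u ->
      gje_solution g Y Z B Om u ->
      jet u @` Om `<=` U0 ->
      domain Om' -> compactly_contained Om' Om ->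
      edistance Om' (boundary Om) = R0 ->
      (forall r, 0 < r -> r < R0 ->
         ((m r)%:E <= modulus_over Gam g Y Z Om u Om' r)%E) ->
      (ereal_sup [set (enorm (hess u x))%:E | x in Om'] <= C%:E)%E.
Proof.
have [D [ep [c ub]]] := uniform_bounds_exist hg hYZ hconv hA hB hBpos hU0.
(* This case is vacuous, since the distance to the boundary is positive. *)
have [R0_le0|R0_gt0] := leP R0 0.
  exists 0 => Om Om' u [oOm _ _] bOm _ _ _ _ _ [_ _ ne] cOm eR0 _.
  by have := edistance_gt0 hn oOm bOm ne cOm; rewrite eR0 ltNge R0_le0.
have ep0 := ub_ep ub; have c0 := ub_c ub.
have D0 : 0 <= D by have := ub_n ub; have := ler0n R n; lra.
pose N := D + D + D ^+ 12 * (1 + c^-1).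
have N0 : 0 <= N.
  by rewrite /N !addr_ge0// mulr_ge0 ?exprn_ge0// addr_ge0// invr_ge0 ltW.
pose C := N ^+ 17; have C0 : 0 <= C by exact: exprn_ge0.
pose beta := 2 * C + 2; have beta0 : 0 < beta by rewrite ltr_wpDl// mulr_ge0.
pose t := 12 + 12 * beta ^+ 2 * C ^+ 2 * n%:R.
have t1 : 0 <= 12 * beta ^+ 2 * C ^+ 2 * n%:R :> R by rewrite !mulr_ge0// ltW.
have t0 : 0 <= t by rewrite addr_ge0.
(* A natural number, as eta is raised to it; t exceeds both lower bounds required of tau. *)
pose tau := Num.Def.archi_bound t; have tau_t : t < tau%:R := archi_boundP t0.
have tau12 : 12 <= tau%:R :> R by apply: le_trans (ltW tau_t); rewrite lerDl.
have tauC : 12 * beta ^+ 2 * C ^+ 2 * n%:R <= tau%:R by apply: le_trans (ltW tau_t); rewrite lerDr.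
pose kappa := 4 * (2 * C + 6 * C ^+ 2 + C * tau%:R + tau%:R * C ^+ 2 + 1 + beta * C).
have kappa0 : 0 < kappa.
  by rewrite mulr_gt0// ltr_wpDr ?mulr_ge0// ?ltW// ltr_wpDl// !addr_ge0// !mulr_ge0// ?exprn_ge0.
have tau0 : 0 < tau%:R :> R by exact: lt_le_trans tau12.
have kN0 : 0 <= 24 * kappa * N ^+ 2 by rewrite mulr_ge0 ?exprn_ge0// mulr_ge0// ltW.
have cep0 : 0 < c * ep by exact: mulr_gt0.
(* The half of R0 makes r < R0 strict, and r <= 1 reduces the condition on r^2 to a linear one. *)
have [|r r0 Hr] := @small_scales R [:: (1, R0 / 2); (1, ep); (1, 1); (C * N, 1 / 4);
    (24 * kappa * N ^+ 2, tau%:R); (2 * D ^+ 2, 1 / 2); (2 * D ^+ 2, c * ep)].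
  have h1 : 0 <= C * N by exact: mulr_ge0.
  have h3 : 0 <= 2 * D ^+ 2 by rewrite mulr_ge0 ?exprn_ge0.
  by rewrite /= ler01 ep0 ltr01 tau0 cep0 h1 kN0 h3 !divr_gt0.
rewrite /= !mul1r andbT in Hr; case/and5P: Hr => rR0 rep r1 rC /and3P[rk r2 r3].
have rR : r < R0 by move: rR0 R0_gt0; lra.
have mr := hm r r0 rR.
(* The modulus enters only through its value at this r; the half makes h < m r strict, as
   [modulus_component] demands. *)
have [|h h0 Hh] := @small_scales R [:: (1, m r / 2); (1, ep); (D, 1 / 2)].
  by rewrite /= ler01 ep0 D0 !divr_gt0.
rewrite /= !mul1r andbT in Hh; case/and3P: Hh => hmr hep Dh.
have hm' : h < m r by move: hmr mr; lra.
have small1 : D * h + 2 * (D ^+ 2 * r) <= 1 by move: Dh r2; rewrite mulrA; lra.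
have small2 : 2 * (D ^+ 2 * r) <= c * ep by rewrite (mulrA 2); exact: r3.
have rC' : C * (N * r) <= 1 / 4 by rewrite mul1r (mulrA C N r); exact: rC.
have rk' : 24 * kappa * (N * r) ^+ 2 <= tau%:R.
  apply: le_trans rk; rewrite exprMn mulrA; apply: ler_wpM2l; first exact: kN0.
  by rewrite expr2 ler_piMl// ltW.
exists (n%:R * ((1 + (2 * C + kappa + beta * (n%:R * C) + beta * C + C * tau%:R + 2 * tau%:R * C ^+ 2)) *
  expR (beta / 2 * D ^+ 3 + kappa / 2 * r ^+ 2) / (c * h) ^+ tau + D)).
move=> Om Om' u [oOm _ _] bOm cu _ ell eqn JU0 _ cOm eR0 hmod.
apply: ge_ereal_sup => _ [x0 Omx0' <-]; rewrite lee_fin.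
have Omx0 : Om x0 by case: cOm => _; apply; exact: subset_closure.
have ballOm x : dot (x - x0) (x - x0) <= r ^+ 2 -> Om x.
  move=> bx; apply: (edistance_ball oOm Omx0' Omx0); rewrite eR0; apply: le_lt_trans rR.
  by rewrite enorm_row -(ger0_norm (ltW r0)) -sqrtr_sqr; exact: ler_wsqrtr.
have sec := @modulus_component R n Gam g Y Z Om u x0 r h h0.
apply: (hessian_estimate hg hYZ hconv hA hB hBpos hU0 hreg ub oOm cu ell eqn JU0 r0 rep h0 hep ballOm _
  small1 small2 beta0 kappa0 tau12 tauC erefl erefl rC' rk').
apply: sec; apply: lt_le_trans (_ : (m r)%:E <= _)%E; first by rewrite lte_fin.
apply: le_trans (hmod r r0 rR) _; apply: ge_ereal_inf.
by exists (modulus Gam g Y Z Om u x0 r) => //; exists x0.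
Qed.
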